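(* Let $X$ be an algebraic curve in $(\mathbb K^* )^2$ which is not a line and whose tropicalization $C=Trop(X)$ is a non-singular tropical curve. Let $q\in X$ be an inflection point of $X$ with tangent line $T$, let $L=Trop(T)$, let $v$ be the vertex of $L$, let $p=Val(q)$, and let $E$ be the connected component of $C\cap L$ containing $p$. Then $p\in\mathfrak I_L$.
   Context: Field and valuation. $\mathbb K$ is the field of locally convergent generalized Puiseux series $a(t)=\sum_{r\in R}\alpha_rt^r$ ($R\subset\mathbb R$ well-ordered, $\alpha_r\in\mathbb C$, convergent for small $t>0$), with $val(a)=-\min\{r:\alpha_r\ne0\}$, $val(0)=-\infty$; $Val$ is $val$ coordinate-wise. Tropical curves. A tropical polynomial $F(x,y)=\max_{(i,j)}(a_{i,j}+ix+jy)$ defines the tropical curve of points of $\mathbb R^2$ where the maximum is attained at least twice. Faces $G$ of the induced subdivision of $\mathbb R^2$ have dual cells $\Delta_G$ (convex hull of the exponents realizing the maximum on the relative interior of $G$), forming the dual subdivision of the Newton polygon; edges $e$ have weight $w(e)=\mathrm{Card}(\Delta_e\cap\mathbb Z^2)-1$. For $P=\sum a_{i,j}z^iw^j\in\mathbb K[z,w]$ and $X=V(P)\subset(\mathbb K^* )^2$, $Trop(X)=Val(X)$ is the tropical curve of $P_{trop}=\max(val(a_{i,j})+ix+jy)$. $C$ is non-singular if all 2-dimensional cells of its dual subdivision are primitive triangles (Euclidean area $1/2$). A bounded edge $e$ with end points $v_1,v_2$ and primitive integer direction $u$ has length $l(e)=\|v_1v_2\|/(w(e)\|u\|)$; distances along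 edges are measured in the same normalization. Inflection points of $X=V(P)\subset(\mathbb K^* )^2$ are the inflection points lying in $(\mathbb K^* )^2=\{zwu\ne0\}$ of the projective curve $\{P^{hom}(z,w,u)=0\}$ defined by the homogenization, i.e. the intersection points with its Hessian curve (determinant of the matrix of second partial derivatives of $P^{hom}$). The set $\mathfrak I_L$. In the situation of the claim, it is known that $v$ is a common vertex of $C$ and $L$, that $v\in E$, and that $E$ is either $\{v\}$, or an edge of $C$, or the union of three adjacent edges of $C$ at least two of which are bounded. The subset $\mathfrak I_L\subset E$ is defined by: - if $E=\{v\}$ or $E$ is an unbounded edge of $L$: $\mathfrak I_L=\{v\}$; - if $E$ is a bounded edge $e$ of $C$: $\mathfrak I_L=\{v,p_e\}$, where $p_e$ is the point of $e$ at distance $l(e)/3$ from $v$; - if $E$ is the union of two bounded edges $e_1,e_2$ and one unbounded edge $e_3$: if $l(e_1)>l(e_2)$, $\mathfrak I_L=\{p_{e_1}\}$, where $p_{e_1}$ is the point of $e_1$ at distance $\frac{l(e_1)-l(e_2)}3$ from $v$; if $l(e_1)=l(e_2)$, $\mathfrak I_L$ is the whole edge $e_3$; - if $E$ is the union of three bounded edges $e_1,e_2,e_3$: if $l(e_1)\ge l(e_2)>l(e_3)$, $\mathfrak I_L=\{p_{e_1},p_{e_2}\}$, where $p_{e_i}$ is the point of $e_i$ at distance $\frac{l(e_i)-l(e_3)}3$ from $v$; if $l(e_1)>l(e_2)=l(e_3)$, $\mathfrak I_L$ is the segment $[v,p_{e_1}]$, where $p_{e_1}$ is the point of $e_1$ at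 distance $\frac{l(e_1)-l(e_2)}3$ from $v$; if $l(e_1)=l(e_2)=l(e_3)$, $\mathfrak I_L=\{v\}$. *)

(* Defs.v *)
From HB Require Import structures.
From mathcomp Require Import all_boot all_order all_algebra.
From mathcomp Require Import all_classical all_reals all_analysis.
From mathcomp Require Import finmap complex lra.
From mathcomp Require mpoly.
(* The notations of mpoly clash with those of mathcomp-analysis. *)
Import -(notations) mpoly.

Set Implicit Arguments.
Unset Strict Implicit.
Unset Printing Implicit Defensive.

Import Order.TTheory GRing.Theory Num.Theory numFieldNormedType.Exports.
Local Open Scope classical_set_scope.
Local Open Scope ring_scope.

Section WellOrdered.
Variable R : realType.
Implicit Types A B S U : set R.

Definition well_ordered A :=
  forall U, U `<=` A -> U !=set0 -> exists2 m, U m & forall x, U x -> m <= x.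

Lemma well_orderedS A B : A `<=` B -> well_ordered B -> well_ordered A.
Proof. by move=> AB wB U UA; apply: wB; apply: subset_trans UA AB. Qed.

Lemma well_orderedU A B :
  well_ordered A -> well_ordered B -> well_ordered (A `|` B).
Proof.
move=> wA wB U UAB [u Uu].
have [[a UAa]|nA] := pselect ((U `&` A) !=set0); last first.
  apply: wB; last by exists u.
  by move=> x Ux; case: (UAB x Ux) => // Ax; case: nA; exists x.
have [[b UBb]|nB] := pselect ((U `&` B) !=set0); last first.
  apply: wA; last by exists u.
  by move=> x Ux; case: (UAB x Ux) => // Ax; case: nB; exists x.
have [|m [Um _] mP] := wA (U `&` A) _ (ex_intro _ a UAa); first by move=> ? [].
have [|n [Un _] nP] := wB (U `&` B) _ (ex_intro _ b UBb); first by move=> ? [].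
have [mn|nm] := leP m n.
  exists m => // x Ux; case: (UAB x Ux) => Hx; first by apply: mP.
  by apply: le_trans mn _; apply: nP.
exists n => // x Ux; case: (UAB x Ux) => Hx; last by apply: nP.
by apply: le_trans (ltW nm) _; apply: mP.
Qed.

Lemma well_ordered1 a : well_ordered [set a].
Proof.
move=> U Ua [u Uu]; exists u => // x Ux.
by rewrite (Ua _ Uu) (Ua _ Ux).
Qed.

Lemma finite_well_ordered A : finite_set A -> well_ordered A.
Proof.
move=> /finite_seqP[s ->]; elim: s => [|x s ih].
  by move=> U U0 [u /U0].
apply: (@well_orderedS _ ([set x] `|` [set` s])).
  by move=> y /=; rewrite inE => /orP[/eqP|]; [left|right].
by apply: well_orderedU => //; exact: well_ordered1.
Qed.

Lemma well_ordered_finite S : well_ordered S ->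
  (forall U, U `<=` S -> U !=set0 -> exists2 m, U m & forall x, U x -> x <= m) ->
  finite_set S.
Proof.
move=> wS dS; have [[s Ss]|S0] := pselect (S !=set0); last first.
  rewrite (_ : S = set0)//; apply/seteqP; split=> // x Sx.
  by case: S0; exists x.
have [m Sm mP] := wS S (fun _ => id) (ex_intro _ s Ss).
pose T := [set x | S x /\ finite_set (S `&` [set y | y <= x])].
have Tm : T m.
  split=> //; apply: (@sub_finite_set _ _ [set m]) => // x [Sx /= xm].
  by apply/eqP; rewrite eq_le xm mP.
have [|M [SM finM] MP] := dS T _ (ex_intro _ m Tm); first by move=> ? [].
pose V := S `&` [set y | M < y].
have [[v Vv]|V0] := pselect (V !=set0); last first.
  apply: sub_finite_set finM => x Sx; split=> //=.
  by rewrite leNgt; apply/negP => Mx; apply: V0; exists x.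
have [|n [Sn Mn] nP] := wS V _ (ex_intro _ v Vv); first by move=> ? [].
suff /MP : T n by rewrite leNgt Mn.
split=> //; apply: (@sub_finite_set _ _ ((S `&` [set y | y <= M]) `|` [set n])).
  move=> x [Sx /= xn]; have [xM|Mx] := leP x M; first by left.
  by right; apply/eqP; rewrite eq_le xn nP.
by rewrite finite_setU; split.
Qed.

Definition sumset A B := [set x | exists a b, [/\ A a, B b & x = a + b]].

Lemma well_ordered_fiber A B q : well_ordered A -> well_ordered B ->
  finite_set [set r | A r /\ B (q - r)].
Proof.
move=> wA wB; apply: well_ordered_finite; first by apply: well_orderedS wA => ? [].
move=> U US [u Uu].
have [||m [r Ur <-] mP] := wB [set q - r | r in U].
- by move=> _ [r /US[_ Br] <-].
- by exists (q - u); exists u.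
exists r => // x Ux; rewrite -(lerD2l q) -lerBlDr.
have := mP (q - x) (ex_intro2 _ _ x Ux erefl); lra.
Qed.

Lemma well_ordered_sumset A B : well_ordered A -> well_ordered B ->
  well_ordered (sumset A B).
Proof.
move=> wA wB U UAB [u0 Uu0].
pose pareto r s := [/\ A r, B s, U (r + s) &
  forall r' s', A r' -> B s' -> U (r' + s') -> r' <= r -> s' <= s ->
    r' = r /\ s' = s].
pose P := [set r | exists s, pareto r s].
have dom r s : A r -> B s -> U (r + s) ->
    exists r' s', [/\ pareto r' s', r' <= r & s' <= s].
  move=> Ar Bs Urs.
  pose V := [set x | A x /\ exists2 y, B y /\ y <= s & U (x + y)].
  have [||x [Ax [y [By ys] Uxy]] xP] := wA V; first by move=> ? [].
    by exists r; split => //; exists s.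
  pose W := [set z | B z /\ U (x + z)].
  have [||z [Bz Uxz] zP] := wB W; first by move=> ? [].
    by exists y.
  have zy : z <= y by apply: zP.
  exists x, z; split.
  - split=> // r' s' Ar' Bs' Urs' r'x s'z.
    have r'E : r' = x.
      apply/eqP; rewrite eq_le r'x; apply: xP; split => //.
      by exists s' => //; split => //; lra.
    split=> //; apply/eqP; rewrite eq_le s'z zP//.
    by split => //; rewrite -r'E.
  - by apply: xP; split => //; exists s.
  - lra.
have finP : finite_set P.
  apply: well_ordered_finite; first by apply: well_orderedS wA => r [s []].
  move=> Q QP [p0 Qp0].
  pose Y := [set s | exists2 r, Q r & pareto r s].
  have [||s [r Qr prs] sP] := wB Y; first by move=> s [r _ []].
    by have [s ps] := QP _ Qp0; exists s; exists p0.
  exists r => // x Qx; have [y pxy] := QP _ Qx.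
  have sy : s <= y by apply: sP; exists x.
  rewrite leNgt; apply/negP => rx.
  case: prs => Ar Bs Urs _; case: pxy => _ _ _ /(_ r s Ar Bs Urs (ltW rx) sy)[rE _].
  by rewrite rE ltxx in rx.
pose f r := xget 0 [set s | pareto r s].
have fP r : P r -> pareto r (f r) by move=> Pr; rewrite /f; apply: xgetPex.
have fU r s : pareto r s -> f r = s.
  move=> prs; have /fP : P r by exists s.
  case: prs => Ar Bs Urs mrs [_ Bf Uf mf].
  have [sf|fs] := leP s (f r).
    by have [_ ->] := mf r s Ar Bs Urs (lexx _) sf.
  by have [_ ->] := mrs r (f r) Ar Bf Uf (lexx _) (ltW fs).
have [a [b [Aa Bb uE]]] := UAB _ Uu0; rewrite {}uE in Uu0.
have [a' [b' [pab _ _]]] := dom _ _ Aa Bb Uu0.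
have Pa' : P a' by exists b'.
have wg : well_ordered [set r + f r | r in P].
  by apply: finite_well_ordered; apply: finite_image.
have [|i [Ui [r Pr rE]] iP] := wg (U `&` [set r + f r | r in P]) (@subIsetr _ _ _).
  exists (a' + f a'); split; last by exists a'.
  by have [] := fP _ Pa'.
exists i => // x Ux.
have [c [d [Ac Bd xE]]] := UAB _ Ux.
have [|c' [d' [pcd c'c d'd]]] := dom c d Ac Bd; first by rewrite -xE.
have [_ _ Ucd _] := pcd.
have : i <= c' + d'.
  by apply: iP; split => //; exists c'; [exists d'|rewrite (fU _ _ pcd)].
by rewrite xE => h; apply: le_trans h _; apply: lerD.
Qed.

End WellOrdered.

Section Series.
Variable R : realType.
Local Notation C := (R[i]).
Local Notation normc := (@ComplexField.Normc.normc R).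
Implicit Types (a b c : R -> C) (t e : R).

Definition psupp a : set R := [set r | a r != 0].

(* sum_r a_r t^r is understood as an unordered sum over the support of a, so
   that its convergence amounts to its absolute convergence. *)
Definition abs_sum a t : \bar R := \esum_(r in [set: R]) (normc (a r) * t `^ r)%:E.

Definition locally_convergent a :=
  exists2 e, 0 < e & forall t, 0 < t < e -> (abs_sum a t < +oo)%E.

(* The sum has finite support as soon as the supports of a and b are well
   ordered. *)
Definition cauchy a b : R -> C := fun q => \sum_(r \in [set: R]) a r * b (q - r).

Lemma normc_ge0 (x : C) : 0 <= normc x.
Proof. by case: x => x y; exact: sqrtr_ge0. Qed.

Lemma term_ge0 a t r : (0 <= (normc (a r) * t `^ r)%:E)%E.
Proof. by rewrite lee_fin mulr_ge0 ?normc_ge0 ?powR_ge0. Qed.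

Lemma abs_sum_ge0 a t : (0 <= abs_sum a t)%E.
Proof. by apply: esum_ge0 => r _; exact: term_ge0. Qed.

Lemma abs_sumD a b t : (abs_sum (a \+ b)%R t <= abs_sum a t + abs_sum b t)%E.
Proof.
rewrite /abs_sum -esumD; try by move=> *; exact: term_ge0.
apply: le_esum => r _; rewrite lee_fin -mulrDl ler_wpM2r ?powR_ge0//.
exact: le_normcD.
Qed.

Lemma abs_sumN a t : abs_sum (\- a) t = abs_sum a t.
Proof. by apply: eq_esum => r _; rewrite normcN. Qed.

Lemma esumZ (T : choiceType) (I : set T) (f : T -> \bar R) (x : R) :
  0 <= x -> (forall i, I i -> (0 <= f i)%E) ->
  (\esum_(i in I) (x%:E * f i) <= x%:E * \esum_(i in I) f i)%E.
Proof.
move=> x0 f0; apply: ge_ereal_sup => /= _ [X [finX XI] <-].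
rewrite fsbig_finite//= big_seq -ge0_sume_distrr; last first.
  by move=> i; rewrite in_fset_set// => /set_mem /XI /f0.
by rewrite -big_seq lee_wpmul2l ?lee_fin// -fsbig_finite// esum_ge//; exists X.
Qed.

Lemma normc_cauchy a b q t : 0 < t ->
  ((normc (cauchy a b q) * t `^ q)%:E <=
   \esum_(r in [set: R])
     ((normc (a r) * t `^ r)%:E * (normc (b (q - r)) * t `^ (q - r))%:E))%E.
Proof.
move=> t0.
have F0 r : (0 <= (normc (a r) * t `^ r)%:E *
  (normc (b (q - r)) * t `^ (q - r))%:E)%E.
  by rewrite mule_ge0// term_ge0.
rewrite /cauchy; case: finite_supportP => [_|X _ _ _].
  rewrite big_nil ComplexField.Normc.normc0 mul0r; apply: esum_ge0 => r _; exact: F0.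
apply: esum_ge; exists [set` X]; first by split.
rewrite -fsbig_seq//=.
rewrite [leRHS](eq_bigr (fun r => (normc (a r * b (q - r)) * t `^ q)%:E)); last first.
  move=> r _; rewrite -EFinM ComplexField.Normc.normcM; congr (_ %:E).
  rewrite mulrACA -powRD; first by rewrite [r + _]addrC subrK.
  by rewrite (gt_eqF t0) implybT.
rewrite sumEFin lee_fin -mulr_suml ler_wpM2r ?powR_ge0//.
elim: (X : seq R) => [|r s ih]; first by rewrite !big_nil ComplexField.Normc.normc0.
by rewrite !big_cons; apply: le_trans (le_normcD _ _) _; rewrite lerD2l.
Qed.

Lemma abs_sum_cauchy a b t : 0 < t -> (abs_sum b t < +oo)%E ->
  (abs_sum (cauchy a b) t <= abs_sum a t * abs_sum b t)%E.
Proof.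
move=> t0 bfin.
have bE : abs_sum b t = (fine (abs_sum b t))%:E.
  by rewrite fineK// ge0_fin_numE// abs_sum_ge0.
pose F (x y : R) := ((normc (a x) * t `^ x)%:E * (normc (b y) * t `^ y)%:E)%E.
have F0 x y : (0 <= F x y)%E by rewrite mule_ge0// term_ge0.
apply: (@le_trans _ _ (\esum_(q in [set: R]) \esum_(r in [set: R]) F r (q - r)%R)%E).
  by apply: le_esum => q _; exact: normc_cauchy.
rewrite (@esum_esum _ _ _ _ (fun=> setT) (fun q r => F r (q - r)))//.
rewrite (@reindex_esum _ _ _ ([set: R] `*`` (fun=> [set: R])) _
  (fun z : R * R => (z.1 + z.2, z.1))); last first.
  split=> //.
  - by move=> [x y] [x' y'] _ _ /= [] h1 h2; congr (_, _) => //; lra.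
  - move=> [x y] _ /=; exists (y, x - y) => //=.
    by congr (_, _); rewrite addrC subrK.
rewrite (eq_esum (b := fun k => F k.1 k.2)); last first.
  by move=> [x y] _ /=; congr (F _ _); rewrite addrAC subrr add0r.
rewrite -(@esum_esum _ _ _ _ (fun=> setT) F)//.
apply: (@le_trans _ _
  (\esum_(x in [set: R]) ((fine (abs_sum b t))%:E * (normc (a x) * t `^ x)%:E))%E).
  apply: le_esum => x _; rewrite muleC -bE.
  apply: esumZ; first by rewrite mulr_ge0 ?normc_ge0 ?powR_ge0.
  by move=> *; exact: term_ge0.
rewrite muleC {2}bE; apply: esumZ; first by rewrite fine_ge0 ?abs_sum_ge0.
by move=> *; exact: term_ge0.
Qed.

Lemma locally_convergentD a b : locally_convergent a -> locally_convergent b ->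
  locally_convergent (a \+ b).
Proof.
move=> [e e0 ea] [d d0 db]; exists (Num.min e d); first by rewrite lt_min e0.
move=> t /andP[t0]; rewrite lt_min => /andP[te td].
apply: le_lt_trans (abs_sumD _ _ _) _.
by apply: lte_add_pinfty; [apply: ea|apply: db]; rewrite t0.
Qed.

Lemma locally_convergentN a : locally_convergent a -> locally_convergent (\- a).
Proof. by move=> [e e0 ea]; exists e => // t /ea; rewrite abs_sumN. Qed.

Lemma locally_convergent_cauchy a b :
  locally_convergent a -> locally_convergent b -> locally_convergent (cauchy a b).
Proof.
move=> [e e0 ea] [d d0 db]; exists (Num.min e d); first by rewrite lt_min e0.
move=> t /andP[t0]; rewrite lt_min => /andP[te td].
have at_ : (abs_sum a t < +oo)%E by apply: ea; rewrite t0.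
have bt : (abs_sum b t < +oo)%E by apply: db; rewrite t0.
apply: le_lt_trans (abs_sum_cauchy _ _ _) _ => //.
by apply: lte_mul_pinfty => //; [exact: abs_sum_ge0|rewrite ge0_fin_numE ?abs_sum_ge0].
Qed.

Definition monom (x : C) (s : R) : R -> C := fun r => if r == s then x else 0.

Lemma abs_sum_monom x s t : abs_sum (monom x s) t = (normc x * t `^ s)%:E.
Proof.
rewrite /abs_sum (esumID [set s]); last by move=> *; exact: term_ge0.
rewrite setTI esum_set1 ?term_ge0// esum1 ?adde0 /monom ?eqxx//.
move=> r [_ /= /eqP/negPf ->].
by rewrite ComplexField.Normc.normc0 mul0r.
Qed.

Lemma locally_convergent_monom x s : locally_convergent (monom x s).
Proof. by exists 1 => // t _; rewrite abs_sum_monom ltry. Qed.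

Lemma psupp_monom x s : well_ordered (psupp (monom x s)).
Proof.
apply: (@well_orderedS _ _ [set s]); last exact: well_ordered1.
move=> r; rewrite /psupp/monom/=.
by case: (eqVneq r s) => // _; rewrite eqxx.
Qed.

Lemma psupp_cauchy a b : psupp (cauchy a b) `<=` sumset (psupp a) (psupp b).
Proof.
move=> q /= h.
have [r rP] : exists r, a r * b (q - r) != 0.
  apply: contrapT => h'; case/negP: h; rewrite /cauchy fsbig1// => r _.
  by apply: contrapT => /eqP ?; apply: h'; exists r.
exists r, (q - r); split; rewrite ?(addrC r) ?subrK//.
  by apply: contra_neq rP => ->; rewrite mul0r.
by apply: contra_neq rP => ->; rewrite mulr0.
Qed.

Lemma cauchyE a b q (X : set R) : finite_set X ->
  (forall r, a r != 0 -> b (q - r) != 0 -> X r) ->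
  cauchy a b q = \sum_(r \in X) a r * b (q - r).
Proof.
move=> finX XP; rewrite /cauchy; apply/esym/fsbig_widen => // r [_ /= nX].
have [->|ar] := eqVneq (a r) 0; first by rewrite mul0r.
have [->|br] := eqVneq (b (q - r)) 0; first by rewrite mulr0.
by case: nX; apply: XP.
Qed.

Lemma cauchy_fiber a b q : well_ordered (psupp a) -> well_ordered (psupp b) ->
  finite_set [set r | a r != 0 /\ b (q - r) != 0].
Proof. exact: well_ordered_fiber. Qed.

Lemma cauchyC a b : cauchy a b = cauchy b a.
Proof.
apply/funext => q; rewrite /cauchy (@reindex_fsbigT _ _ _ _ _ (fun r => q - r)).
  by apply: eq_fsbigr => r _; rewrite subKr mulrC.
by exists (fun r => q - r) => r; rewrite subKr.
Qed.

Lemma cauchyDl a b c : well_ordered (psupp a) -> well_ordered (psupp b) ->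
  well_ordered (psupp c) -> cauchy (a \+ b) c = cauchy a c \+ cauchy b c.
Proof.
move=> wa wb wc; apply/funext => q /=.
pose X := [set r | a r != 0 /\ c (q - r) != 0] `|`
          [set r | b r != 0 /\ c (q - r) != 0].
have finX : finite_set X by rewrite finite_setU; split; exact: cauchy_fiber.
rewrite !(@cauchyE _ _ _ X)//.
- by rewrite -fsbig_split//; apply: eq_fsbigr => r _; rewrite mulrDl.
- by move=> r /= br cr; right.
- by move=> r /= ar cr; left.
move=> r /= abr cr; have [a0|a0] := eqVneq (a r) 0; last by left.
by right; rewrite a0 add0r in abr.
Qed.

Lemma cauchy_monom x s a q : cauchy (monom x s) a q = x * a (q - s).
Proof.
rewrite (@cauchyE _ _ _ [set s])//; last first.
  by move=> r; rewrite /monom; case: (eqVneq r s) => // _; rewrite eqxx.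
by rewrite fsbig_set1 /monom eqxx.
Qed.

Lemma cauchy1 a : cauchy (monom 1 0) a = a.
Proof. by apply/funext => q; rewrite cauchy_monom mul1r subr0. Qed.

Lemma cauchyA a b c : well_ordered (psupp a) -> well_ordered (psupp b) ->
  well_ordered (psupp c) -> cauchy a (cauchy b c) = cauchy (cauchy a b) c.
Proof.
move=> wa wb wc; apply/funext => q.
have wab := well_ordered_sumset wa wb; have wbc := well_ordered_sumset wb wc.
pose S := [set s | sumset (psupp a) (psupp b) s /\ psupp c (q - s)].
pose T := [set r | psupp a r /\ sumset (psupp b) (psupp c) (q - r)].
have finS : finite_set S by exact: well_ordered_fiber.
have finT : finite_set T by exact: well_ordered_fiber.
rewrite (@cauchyE a _ _ T)//; last by move=> r ar bcr; split=> //; exact: psupp_cauchy.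
rewrite (@cauchyE _ c _ S)//; last by move=> s abs cs; split=> //; exact: psupp_cauchy.
transitivity (\sum_(r \in T) \sum_(s \in S) (a r * (b (s - r) * c (q - s)))).
  apply: eq_fsbigr => r /set_mem[ar _].
  rewrite -mulr_fsumr; congr (_ * _).
  rewrite /cauchy (@reindex_fsbigT _ _ _ _ _ (fun s => s - r)); last first.
    by exists (fun s => s + r) => s; rewrite ?subrK ?addrK.
  apply: (@eq_trans _ _ (\sum_(s \in S) b (s - r) * c (q - r - (s - r)))); last first.
    by apply: eq_fsbigr => s _; congr (_ * c _); rewrite opprB addrA subrK.
  apply/esym/fsbig_widen => // s [_ /= nS].
  have [->|bs] := eqVneq (b (s - r)) 0; first by rewrite mul0r.
  have [->|cs] := eqVneq (c (q - r - (s - r))) 0; first by rewrite mulr0.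
  case: nS; split; last by move: cs; rewrite opprB addrA subrK.
  by exists r, (s - r); split=> //; rewrite addrC subrK.
rewrite exchange_fsbig//; apply: eq_fsbigr => s /set_mem[_ cs].
rewrite /cauchy mulr_fsuml.
apply: (@eq_trans _ _ (\sum_(r \in T) a r * b (s - r) * c (q - s))).
  by apply: eq_fsbigr => r _; rewrite mulrA.
apply: fsbig_widen => // r [_ /= nT].
have [->|ar] := eqVneq (a r) 0; first by rewrite !mul0r.
have [->|bs] := eqVneq (b (s - r)) 0; first by rewrite mulr0 mul0r.
case: nT; split=> //; exists (s - r), (q - s); split=> //.
by rewrite [RHS]addrC addrA subrK.
Qed.

End Series.

Record puiseux (R : realType) := Puiseux {
  pcoef :> R -> R[i];
  pcoef_wo : well_ordered (psupp pcoef);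
  pcoef_cvg : locally_convergent pcoef }.

HB.instance Definition _ (R : realType) := gen_eqMixin (puiseux R).
HB.instance Definition _ (R : realType) := gen_choiceMixin (puiseux R).

Section PuiseuxField.
Variable R : realType.
Local Notation C := (R[i]).
Local Notation normc := (@ComplexField.Normc.normc R).
Local Notation K := (puiseux R).
Implicit Types (a b c : K) (t e : R).

Lemma puiseux_eqP a b : pcoef a =1 pcoef b -> a = b.
Proof.
case: a b => [a wa ca] [b wb cb] /= /funext ab; rewrite -ab in wb cb *.
by congr Puiseux; exact: Prop_irrelevance.
Qed.

Definition pmonom (x : C) (s : R) : K :=
  Puiseux (@psupp_monom R x s) (@locally_convergent_monom R x s).

Fact padd_wo a b : well_ordered (psupp (a \+ b)).
Proof.
apply: (@well_orderedS _ _ (psupp a `|` psupp b)); last first.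
  by apply: well_orderedU; exact: pcoef_wo.
move=> r /= abr; have [a0|a0] := eqVneq (a r) 0; last by left.
by right; rewrite /psupp /= a0 add0r in abr.
Qed.

Definition padd a b : K := Puiseux (@padd_wo a b)
  (locally_convergentD (pcoef_cvg a) (pcoef_cvg b)).

Fact popp_wo a : well_ordered (psupp (\- a)).
Proof.
apply: (@well_orderedS _ _ (psupp a)); last exact: pcoef_wo.
by move=> r; rewrite /psupp /= oppr_eq0.
Qed.

Definition popp a : K := Puiseux (@popp_wo a) (locally_convergentN (pcoef_cvg a)).

Fact pmul_wo a b : well_ordered (psupp (cauchy a b)).
Proof.
apply: (well_orderedS (@psupp_cauchy _ a b)).
by apply: well_ordered_sumset; exact: pcoef_wo.
Qed.

Definition pmul a b : K := Puiseux (@pmul_wo a b)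
  (locally_convergent_cauchy (pcoef_cvg a) (pcoef_cvg b)).

Fact paddA : associative padd.
Proof. by move=> a b c; apply: puiseux_eqP => r /=; rewrite addrA. Qed.

Fact paddC : commutative padd.
Proof. by move=> a b; apply: puiseux_eqP => r /=; rewrite addrC. Qed.

Fact padd0 : left_id (pmonom 0 0) padd.
Proof.
by move=> a; apply: puiseux_eqP => r /=; rewrite /monom if_same add0r.
Qed.

Fact paddN : left_inverse (pmonom 0 0) popp padd.
Proof.
by move=> a; apply: puiseux_eqP => r /=; rewrite /monom if_same addNr.
Qed.

HB.instance Definition _ := GRing.isZmodule.Build K paddA paddC padd0 paddN.

Fact pmulA : associative pmul.
Proof.
move=> a b c; apply: puiseux_eqP => r /=.
by rewrite cauchyA//; exact: pcoef_wo.
Qed.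

Fact pmulC : commutative pmul.
Proof. by move=> a b; apply: puiseux_eqP => r /=; rewrite cauchyC. Qed.

Fact pmul1 : left_id (pmonom 1 0) pmul.
Proof. by move=> a; apply: puiseux_eqP => r /=; rewrite cauchy1. Qed.

Fact pmulDl : left_distributive pmul padd.
Proof.
move=> a b c; apply: puiseux_eqP => r /=.
by rewrite cauchyDl//; exact: pcoef_wo.
Qed.

Fact pone_neq0 : pmonom 1 0 != 0.
Proof.
apply/eqP => /(congr1 (fun a : K => pcoef a 0)) /=.
by rewrite /monom eqxx => /eqP; rewrite oner_eq0.
Qed.

HB.instance Definition _ :=
  GRing.Zmodule_isComNzRing.Build K pmulA pmulC pmul1 pmulDl pone_neq0.

Lemma pcoef0 r : (0 : K) r = 0.
Proof. by rewrite /= /monom if_same. Qed.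

Lemma pcoef1 r : (1 : K) r = (r == 0)%:R.
Proof. by rewrite /= /monom; case: eqP. Qed.

Lemma pcoefD a b r : (a + b) r = a r + b r. Proof. by []. Qed.
Lemma pcoefN a r : (- a) r = - a r. Proof. by []. Qed.
Lemma pcoefM a b r : (a * b) r = cauchy a b r. Proof. by []. Qed.

Lemma pcoef_monomM x s a r : (pmonom x s * a) r = x * a (r - s).
Proof. by rewrite pcoefM cauchy_monom. Qed.

Lemma pcoef_sum (I : Type) (l : seq I) (F : I -> K) r :
  (\sum_(i <- l) F i) r = \sum_(i <- l) F i r.
Proof.
elim: l => [|i l ih]; first by rewrite !big_nil pcoef0.
by rewrite !big_cons pcoefD ih.
Qed.

Lemma pcoefM_lt a b u v q : (forall r, r < u -> a r = 0) ->
  (forall r, r < v -> b r = 0) -> q < u + v -> (a * b) q = 0.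
Proof.
move=> au bv quv; rewrite pcoefM /cauchy fsbig1// => r _.
have [ru|ur] := ltP r u; first by rewrite au ?mul0r.
by rewrite (bv (q - r)) ?mulr0//; lra.
Qed.

(* ||b||_t tends to 0 with t when b has positive order. *)
Lemma abs_sum_small b (s0 : R) : 0 < s0 -> (forall r, r < s0 -> b r = 0) ->
  exists2 e, 0 < e & forall t, 0 < t < e -> (abs_sum b t <= 2^-1%:E)%E.
Proof.
move=> s0_gt0 b0; have [d d0 db] := pcoef_cvg b.
pose t0 := d / 2; have t00 : 0 < t0 by rewrite divr_gt0.
have bt0 : (abs_sum b t0 < +oo)%E by apply: db; rewrite t00 /t0; lra.
pose B := fine (abs_sum b t0).
have B0 : 0 <= B by rewrite fine_ge0 ?abs_sum_ge0.
have BE : abs_sum b t0 = B%:E by rewrite /B fineK// ge0_fin_numE ?abs_sum_ge0.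
pose k := (2 * (B + 1))^-1; have k0 : 0 < k by rewrite invr_gt0; lra.
have k1 : k <= 1 by rewrite invf_le1; lra.
pose x := k `^ (s0^-1); have x0 : 0 < x by exact: powR_gt0.
have x1 : x <= 1.
  rewrite -(powRr0 k); apply: ger_powR; first by rewrite k0.
  by rewrite invr_ge0 ltW.
have xs : x `^ s0 = k.
  by rewrite -powRrM mulVf ?gt_eqF// powRr1// ltW.
exists (t0 * x); first by rewrite mulr_gt0.
move=> t /andP[t_gt0 tx].
pose y := t / t0.
have y0 : 0 < y by rewrite divr_gt0.
have yx : y <= x by rewrite ler_pdivrMr// mulrC ltW.
have y1 : y <= 1 by apply: le_trans yx x1.
have ys : y `^ s0 <= k.
  by rewrite -xs; apply: ge0_ler_powR; rewrite ?nnegrE//; exact: ltW.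
have tE : t = t0 * y by rewrite /y mulrC divfK// gt_eqF.
apply: (@le_trans _ _ (k * B)%:E); last first.
  rewrite lee_fin /k mulrC ler_pdivrMr; lra.
rewrite EFinM -BE; apply: (@le_trans _ _
    (\esum_(r in [set: R]) (k%:E * (normc (b r) * t0 `^ r)%:E))%E); last first.
  by apply: esumZ; [exact: ltW|move=> *; exact: term_ge0].
apply: le_esum => r _; rewrite -EFinM lee_fin.
have [rs|sr] := ltP r s0.
  by rewrite b0// ComplexField.Normc.normc0 !mul0r mulr0.
rewrite mulrCA ler_wpM2l ?normc_ge0// tE powRM ?(ltW t00) ?(ltW y0)//.
rewrite mulrC ler_wpM2r ?powR_ge0//; apply: le_trans ys.
by apply: ger_powR; rewrite ?y0.
Qed.

Lemma geom_inverse b (s0 : R) : 0 < s0 -> (forall r, r < s0 -> b r = 0) ->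
  exists g : K, (1 - b) * g = 1.
Proof.
move=> s0_gt0 b0.
pose h N := \sum_(n < N) b ^+ n.
have bn n r : r < n%:R * s0 -> (b ^+ n) r = 0.
  elim: n r => [|n ih] r rn.
    by rewrite expr0 pcoef1 lt_eqF//; rewrite mul0r in rn.
  rewrite exprS; apply: (pcoefM_lt b0 ih).
  by move: rn; rewrite -addn1 natrD mulrDl mul1r addrC.
have hS N : h N.+1 = 1 + b * h N.
  rewrite /h big_ord_recl expr0 mulr_sumr; congr (_ + _).
  by apply: eq_bigr => i _; rewrite -exprS.
have hr N : h N.+1 = h N + b ^+ N by rewrite /h big_ord_recr.
have hst N M q : (N <= M)%N -> q < N%:R * s0 -> h M q = h N q.
  move=> NM qN; rewrite -(subnKC NM); elim: (M - N)%N => [|m ih]; first by rewrite addn0.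
  rewrite addnS hr pcoefD ih bn ?addr0//.
  by apply: lt_le_trans qN _; rewrite ler_wpM2r ?(ltW s0_gt0)// ler_nat leq_addr.
pose N (q : R) := Num.bound (`|q| / s0).
have NP q : q < (N q)%:R * s0.
  apply: le_lt_trans (ler_norm q) _; rewrite -ltr_pdivrMr//.
  by apply: archi_boundP; rewrite divr_ge0// ltW.
pose g q := h (N q) q.
have gE M q : q < M%:R * s0 -> g q = h M q.
  move=> qM; rewrite /g; have [NM|MN] := leqP (N q) M.
    by rewrite -(hst _ _ _ NM).
  by rewrite (hst _ _ _ (ltnW MN)).
have g_wo : well_ordered (psupp g).
  move=> U Ug [u Uu].
  pose V := U `&` [set x | x <= u].
  have [||m [Um mu] mP] := @pcoef_wo R (h (N u)) V.
  - move=> x [Ux /= xu]; have := Ug x Ux; rewrite /psupp /= (gE (N u))//.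
    by apply: le_lt_trans xu (NP u).
  - by exists u; split => //=.
  exists m => // x Ux; have [xu|ux] := leP x u; first by apply: mP.
  by apply: le_trans (ltW ux).
have g_cvg : locally_convergent g.
  have [e e0 eP] := abs_sum_small s0_gt0 b0.
  exists e => // t te; have t0 : 0 < t by case/andP: te.
  have bt := eP t te.
  have hb M : (abs_sum (h M) t <= 2%:E)%E.
    elim: M => [|M ih].
      rewrite /h big_ord0 abs_sum_monom ComplexField.Normc.normc0 mul0r.
      by rewrite lee_fin.
    rewrite hS; apply: le_trans (abs_sumD _ _ _) _.
    rewrite abs_sum_monom powRr0 mulr1 ComplexField.Normc.normc1.
    rewrite (_ : 2%:E = 1%:E + 1%:E)%E; last by rewrite -EFinD.
    rewrite leeD2l//; apply: le_trans (abs_sum_cauchy _ _ _) _ => //.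
      by apply: le_lt_trans ih _; rewrite ltry.
    apply: (@le_trans _ _ (2^-1%:E * 2%:E)%E).
      by apply: lee_pmul => //; exact: abs_sum_ge0.
    by rewrite -EFinM mulVf.
  apply: (@le_lt_trans _ _ 2%:E); last by rewrite ltry.
  apply: ge_ereal_sup => _ [X [finX _] <-].
  have [M MP] : exists M, forall q, X q -> q < M%:R * s0.
    move/finite_seqP: finX => [l ->]; exists (\max_(q <- l) N q)%N => q /= ql.
    apply: lt_le_trans (NP q) _; rewrite ler_wpM2r ?(ltW s0_gt0)// ler_nat.
    exact: leq_bigmax_seq.
  apply: le_trans (hb M); apply: esum_ge; exists X => //.
  rewrite le_eqVlt; apply/orP; left; apply/eqP; apply: eq_fsbigr => q /set_mem Xq.
  by rewrite (gE M)// MP.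
exists (Puiseux g_wo g_cvg); apply: puiseux_eqP => q.
pose M := (N q).+1.
have qM : q < M%:R * s0.
  apply: lt_le_trans (NP q) _; rewrite ler_wpM2r ?(ltW s0_gt0)// ler_nat.
  exact: leqnSn.
rewrite mulrBl mul1r pcoefD pcoefN.
have -> : (b * Puiseux g_wo g_cvg) q = (b * h M) q.
  rewrite !pcoefM; apply: eq_fsbigr => r _ /=.
  have [rs|sr] := ltP r s0; first by rewrite b0 ?mul0r.
  by rewrite (gE M)//; lra.
rewrite /= (gE M)// -(hst M M.+1)// hS pcoefD -pcoefM.
by rewrite [(b * h M) q]pcoefM addrK.
Qed.

Lemma puiseux_inverse a : a != 0 -> exists b, b * a = 1.
Proof.
move=> a0.
have [r ar] : psupp a !=set0.
  apply: contrapT => h; case/eqP: a0; apply: puiseux_eqP => r.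
  by rewrite pcoef0; apply: contrapT => /eqP ?; apply: h; exists r.
have [|m am mP] := @pcoef_wo R a _ (fun _ => id); first by exists r.
pose u := pmonom (a m)^-1 (- m).
have uE q : (u * a) q = (a m)^-1 * a (q + m) by rewrite pcoef_monomM opprK.
pose b := 1 - u * a.
have bE q : b q = (q == 0)%:R - (a m)^-1 * a (q + m).
  by rewrite /b pcoefD pcoefN pcoef1 uE.
have b_le q : q <= 0 -> b q = 0.
  move=> q0; rewrite bE; have [->|q0'] := eqVneq q 0.
    by rewrite add0r mulVf ?subrr.
  rewrite sub0r; have [->|/mP] := eqVneq (a (q + m)) 0.
    by rewrite mulr0 oppr0.
  by move=> mq; exfalso; move: q0'; rewrite neq_lt => /orP[]; lra.
have [s0 s00 sP] : exists2 s0, 0 < s0 & forall q, q < s0 -> b q = 0.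
  have [bs|bs] := pselect (psupp b !=set0); last first.
    exists 1 => // q _; apply: contrapT => /eqP ?; apply: bs; by exists q.
  have [s bs' sP] := @pcoef_wo R b _ (fun _ => id) bs.
  exists s; first by rewrite ltNge; apply/negP => /b_le h; move/eqP: bs'; apply.
  move=> q qs; apply: contrapT => /eqP bq.
  by have := sP q bq; rewrite leNgt qs.
have [g] := geom_inverse s00 sP.
by rewrite /b opprB addrC subrK => h; exists (g * u); rewrite -mulrA mulrC.
Qed.

Definition pinv a : K := xget 0 [set b | b * a = 1].

Fact pmulV a : a != 0 -> pinv a * a = 1.
Proof. by move=> /puiseux_inverse; exact: xgetPex. Qed.

Fact pinv0 : pinv 0 = 0.
Proof.
by apply: xgetPN => b /=; rewrite mulr0 => /eqP; rewrite eq_sym oner_eq0.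
Qed.

HB.instance Definition _ := GRing.ComNzRing_isField.Build K pmulV pinv0.

End PuiseuxField.

Section AlgebraicCurves.
Variable R : realType.
Local Notation K := (puiseux R).
Local Notation i0 := (@ord0 1).
Local Notation i1 := (@ord_max 1).
Implicit Types (P : mpoly 2 K) (q : K * K) (X : set (K * K)).

Definition valuation (a : K) : \bar R :=
  if a == 0 then -oo%E else (- inf (psupp a))%:E.

(* Only meaningful on (K^* )^2, where the valuation is finite. *)
Definition Val q : R * R := (fine (valuation q.1), fine (valuation q.2)).

Definition Trop X : set (R * R) := Val @` X.

Definition affine_pt q : 'I_2 -> K := fun i => nth 0 [:: q.1; q.2] i.

Definition projective_pt q : 'I_3 -> K := fun i => nth 0 [:: q.1; q.2; 1] i.

(* V(P), inside the torus (K^* )^2. *)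
Definition curve P : set (K * K) :=
  [set q | [/\ q.1 != 0, q.2 != 0 & meval (affine_pt q) P = 0]].

(* msize is 1 + the total degree. *)
Definition is_line X := exists l : mpoly 2 K,
  mpoly.msize l = 2%N /\ X = curve l.

Definition homogenization P : mpoly 3 K :=
  \sum_(m <- msupp P)
    mcoeff m P *: mpolyX K (Multinom
      [tuple m i0; m i1; (mpoly.msize P).-1 - (m i0 + m i1)]%N).

Definition hessian (Q : mpoly 3 K) : mpoly 3 K :=
  \det (\matrix_(i < 3, j < 3) mderiv i (mderiv j Q)).

Definition inflection_point P q := [/\ q.1 != 0, q.2 != 0,
  meval (projective_pt q) (homogenization P) = 0 &
  meval (projective_pt q) (hessian (homogenization P)) = 0].

(* Equation of the tangent line of V(P) at a smooth point q; it is the zero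
   polynomial when q is singular. *)
Definition tangent_line P q : mpoly 2 K :=
  meval (affine_pt q) (mderiv i0 P) *:
    (mpolyX K (mnm1 i0) - mpolyC 2 q.1) +
  meval (affine_pt q) (mderiv i1 P) *:
    (mpolyX K (mnm1 i1) - mpolyC 2 q.2).

End AlgebraicCurves.

Section TropicalCurves.
Variable R : realType.
Local Notation i0 := (@ord0 1).
Local Notation i1 := (@ord_max 1).
Local Notation exponent := (multinom 2).
Implicit Types (m : exponent) (x y v : R * R) (D : set (R * R)).

(* The tropical polynomial max_(m in exps) (tcoef m + m_0 x + m_1 y). *)
Record tropical_poly := TropicalPoly {
  exps : seq exponent;
  tcoef : exponent -> R }.

Definition tropicalize (P : mpoly 2 (puiseux R)) : tropical_poly :=
  TropicalPoly (msupp P) (fun m => fine (valuation (mcoeff m P))).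

Definition monomial_value (F : tropical_poly) m x : R :=
  tcoef F m + (m i0)%:R * x.1 + (m i1)%:R * x.2.

Definition maximizers (F : tropical_poly) x : set exponent :=
  [set m | m \in exps F /\
    forall m', m' \in exps F -> monomial_value F m' x <= monomial_value F m x].

(* A face of the subdivision of R^2 induced by F is encoded by the exponents
   realizing the maximum on its relative interior. *)
Record face (F : tropical_poly) := Face {
  face_label : set exponent;
  face_labelP : exists x, maximizers F x = face_label }.

Definition face_set (F : tropical_poly) (G : face F) : set (R * R) :=
  [set x | face_label G `<=` maximizers F x].

Definition convex_hull D : set (R * R) :=
  \bigcap_(B in [set B : set (R * R) | convex_set B /\ D `<=` B]) B.

Definition dual_cell (F : tropical_poly) (G : face F) : set (R * R) :=
  convex_hull [set ((m i0)%:R, (m i1)%:R) | m in face_label G].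

Definition det2 x y : R := x.1 * y.2 - x.2 * y.1.

Definition two_dimensional D :=
  exists a b c, [/\ D a, D b, D c & det2 (b - a) (c - a) != 0].

Definition one_dimensional D :=
  ~ two_dimensional D /\ exists a b, [/\ D a, D b & a != b].

Definition lattice_pt (z : int * int) : R * R := (z.1%:~R, z.2%:~R).

Definition primitive_triangle D := exists a b c : int * int,
  let A := lattice_pt a in let B := lattice_pt b in let C := lattice_pt c in
  D = convex_hull [set A; B; C] /\ `|det2 (B - A) (C - A)| / 2 = 1 / 2.

Definition nonsingular (F : tropical_poly) :=
  forall G : face F, two_dimensional (dual_cell G) ->
  primitive_triangle (dual_cell G).

Definition is_vertex (F : tropical_poly) v :=
  exists G : face F, two_dimensional (dual_cell G) /\ face_set G = [set v].

Definition is_edge (F : tropical_poly) (G : face F) :=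
  one_dimensional (dual_cell G).

Section Edges.
Variables (F : tropical_poly) (e : face F).

Definition weight : nat :=
  (#|` fset_set [set z : int * int | dual_cell e (lattice_pt z)]|).-1.

Definition enorm x : R := Num.sqrt (x.1 ^+ 2 + x.2 ^+ 2).

(* Determined by the edge e up to sign. *)
Definition direction : int * int :=
  xget (0, 0) [set u | coprimez u.1 u.2 /\ exists x y,
    [/\ face_set e x, face_set e y, x != y & det2 (y - x) (lattice_pt u) = 0]].

Definition edge_dist x y : R :=
  enorm (y - x) / (weight%:R * enorm (lattice_pt direction)).

Definition segment x y : set (R * R) :=
  [set (1 - s) *: x + s *: y | s in `[0, 1]].

Definition bounded_edge := is_edge e /\ bounded_set (face_set e).

Definition unbounded_edge := is_edge e /\ ~ bounded_set (face_set e).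

(* Only meaningful for bounded edges, whose end points v1, v2 are determined
   up to order. *)
Definition edge_length : R :=
  xget 0 [set l | exists v1 v2,
    face_set e = segment v1 v2 /\ l = edge_dist v1 v2].

(* Determines p when v is an end point of e. *)
Definition edge_point v d p := face_set e p /\ edge_dist v p = d.

End Edges.

Definition adjacent_union (F : tropical_poly) v (E : set (R * R))
    (e1 e2 e3 : face F) :=
  [/\ [/\ e1 <> e2, e1 <> e3 & e2 <> e3],
      [/\ face_set e1 v, face_set e2 v & face_set e3 v] &
      E = face_set e1 `|` face_set e2 `|` face_set e3].

Inductive inflection_set (C L : tropical_poly) v (E : set (R * R)) :
    set (R * R) :=
| Infl_vertex of E = [set v] :
    inflection_set C L v E v
| Infl_line_edge (e : face L) of unbounded_edge e & E = face_set e :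
    inflection_set C L v E v
| Infl_edge_vertex (e : face C) of
    bounded_edge e & face_set e v & E = face_set e :
    inflection_set C L v E v
| Infl_edge_third (e : face C) p of
    bounded_edge e & face_set e v & E = face_set e &
    edge_point e v (edge_length e / 3) p :
    inflection_set C L v E p
| Infl_two_lt (e1 e2 e3 : face C) p of
    bounded_edge e1 & bounded_edge e2 & unbounded_edge e3 &
    adjacent_union v E e1 e2 e3 &
    edge_length e1 > edge_length e2 &
    edge_point e1 v ((edge_length e1 - edge_length e2) / 3) p :
    inflection_set C L v E p
| Infl_two_eq (e1 e2 e3 : face C) p of
    bounded_edge e1 & bounded_edge e2 & unbounded_edge e3 &
    adjacent_union v E e1 e2 e3 &
    edge_length e1 = edge_length e2 & face_set e3 p :
    inflection_set C L v E p
| Infl_three_ge_lt (e1 e2 e3 e : face C) p of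
    bounded_edge e1 & bounded_edge e2 & bounded_edge e3 &
    adjacent_union v E e1 e2 e3 &
    edge_length e1 >= edge_length e2 & edge_length e2 > edge_length e3 &
    e = e1 \/ e = e2 &
    edge_point e v ((edge_length e - edge_length e3) / 3) p :
    inflection_set C L v E p
| Infl_three_lt_eq (e1 e2 e3 : face C) p1 p of
    bounded_edge e1 & bounded_edge e2 & bounded_edge e3 &
    adjacent_union v E e1 e2 e3 &
    edge_length e1 > edge_length e2 & edge_length e2 = edge_length e3 &
    edge_point e1 v ((edge_length e1 - edge_length e2) / 3) p1 &
    segment v p1 p :
    inflection_set C L v E p
| Infl_three_eq (e1 e2 e3 : face C) of
    bounded_edge e1 & bounded_edge e2 & bounded_edge e3 &
    adjacent_union v E e1 e2 e3 &
    edge_length e1 = edge_length e2 & edge_length e2 = edge_length e3 :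
    inflection_set C L v E v.

End TropicalCurves.

(* Main.v *)
Require Import Defs.
From mathcomp Require Import all_boot all_order all_algebra.
From mathcomp Require Import all_classical all_reals all_analysis.
From mathcomp Require Import finmap complex lra ring zify.
From mathcomp Require mpoly.
Import -(notations) mpoly.

Import Order.TTheory GRing.Theory Num.Theory numFieldNormedType.Exports.
Local Open Scope classical_set_scope.
Local Open Scope ring_scope.

(* Let u_0 = (1,1), u_1 = (-1,0), u_2 = (0,-1) be the directions of a tropical
   line, so that p = v + s u_k for some k and s >= 0, and let h_0, h_1, h_2 be the
   exponents of a monomial in homogeneous coordinates, up to constants. If t_m are
   the monomials of P at q, and X_0, X_1, X_2 those of the tangent line, then
     sum t_m = 0,   sum t_m h_k = X_k,
     sum t_m (h_1 X_2 - h_2 X_1)^2 = - X_0 X_1 X_2,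
   the last relation being the vanishing of the Hessian. The position of p on L
   gives the valuations of the ratios X_k / X_i. The linear relations combine to
   sum t_m (h (h - 1) - 2 h g rho + g (g - 1) rho^2) = 0 with h = h_k, g = h_i,
   rho = X_k / X_i, for any normalization of the exponents.
   No summand can have a valuation larger than all the others; applied to the
   monomials found at the far ends of the edges of C that start at v, this
   determines s in terms of the lengths of these edges. Such edges exist, as C is
   non-singular: the maximal monomials at v form a unimodular triangle, whose
   sides give zero, one or three edges in the directions of L. By Hensel's lemma
   every point of these edges is in Trop(X), which identifies E. *)

Set Implicit Arguments.
Unset Strict Implicit.

(** * Valuations *)

(** The factor 1/3 has one source. On the ray, rho has valuation -s, so the coefficient of a
    monomial in the second order relation has valuation at most -s for h = 1 and at most -2s for h =
    0, and it vanishes at (h, g) = (0, 0), (0, 1), (1, 0), the three monomials of a line. Going from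
    v to p, a monomial loses a further hs. Hence whatever is maximal at v and has h >= 0 contributes
    at least 2s below the top, whereas the far end of an edge of length l along the ray, where h =
    -1, is only l - s below it. Balancing the two gives l - s = 2s, up to a shift by the length of
    another edge. If the curve looks like a line near v, the monomials seen there drop out
    altogether: the edges then compete through their far ends only, and ties, which allow
    cancellation, leave a whole segment undetermined. Identifying E needs points of Trop(X), not
    only necessary conditions on them. By non-singularity every reduction met is a trinomial with
    unimodular support; its roots in the torus are smooth, so Hensel's lemma in one of the two
    variables suffices. *)

Section Valuation.
Variable R : realType.
Local Notation K := (puiseux R).
Local Notation C := (R[i]).
Implicit Types (a b : K) (r s : R).

(** In the max convention these are val(a) <= r, val(a) < r and val(a) = r. Stated on coefficients,
    the first two hold for a = 0 and every r, so sums need no separate treatment of zero terms. *)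
Definition vle a r := forall s, s < - r -> a s = 0.
Definition vlt a r := forall s, s <= - r -> a s = 0.
Definition veq a r := vle a r /\ a (- r) != 0.

Lemma vltW a r : vlt a r -> vle a r.
Proof. by move=> h s /ltW; exact: h. Qed.

Lemma vle_le a r s : vle a r -> r <= s -> vle a s.
Proof. by move=> h rs x xs; apply: h; lra. Qed.

Lemma vle_lt a r s : vle a r -> r < s -> vlt a s.
Proof. by move=> h rs x xs; apply: h; lra. Qed.

Lemma vle0 r : vle 0 r. Proof. by move=> s _; rewrite pcoef0. Qed.

Lemma vlt0 r : vlt 0 r. Proof. by move=> s _; rewrite pcoef0. Qed.

Lemma vle_vltP a r : vle a r -> a (- r) = 0 -> vlt a r.
Proof. by move=> h a0 s; rewrite le_eqVlt => /orP[/eqP->//|]; exact: h. Qed.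

Lemma vleD a b r : vle a r -> vle b r -> vle (a + b) r.
Proof. by move=> ar br s sr; rewrite pcoefD ar// br// addr0. Qed.

Lemma vltD a b r : vlt a r -> vlt b r -> vlt (a + b) r.
Proof. by move=> ar br s sr; rewrite pcoefD ar// br// addr0. Qed.

Lemma vleN a r : vle a r -> vle (- a) r.
Proof. by move=> ar s sr; rewrite pcoefN ar// oppr0. Qed.

Lemma vltN a r : vlt a r -> vlt (- a) r.
Proof. by move=> ar s sr; rewrite pcoefN ar// oppr0. Qed.

Lemma vleB a b r : vle a r -> vle b r -> vle (a - b) r.
Proof. by move=> ar br; apply/vleD/vleN. Qed.

Lemma veqN a r : veq a r -> veq (- a) r.
Proof. by case=> ar a0; split; [exact: vleN|rewrite pcoefN oppr_eq0]. Qed.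

Lemma vle_sum (I : eqType) (l : seq I) (F : I -> K) r :
  {in l, forall i, vle (F i) r} -> vle (\sum_(i <- l) F i) r.
Proof. by move=> h s sr; rewrite pcoef_sum big_seq big1// => i /h; apply. Qed.

Lemma vlt_sum (I : eqType) (l : seq I) (P : pred I) (F : I -> K) r :
  {in l, forall i, P i -> vlt (F i) r} -> vlt (\sum_(i <- l | P i) F i) r.
Proof.
move=> h s sr; rewrite -big_filter pcoef_sum big_seq big1// => i.
by rewrite mem_filter => /andP[Pi /h]; apply.
Qed.

Lemma vleM a b r s : vle a r -> vle b s -> vle (a * b) (r + s).
Proof.
move=> ar bs q qrs; apply: (pcoefM_lt ar bs).
by apply: lt_le_trans qrs _; rewrite opprD.
Qed.

(** Any other splitting of the exponent -(r + s) goes below the order of one of the factors. *)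
Lemma leadM a b r s : vle a r -> vle b s ->
  (a * b) (- (r + s)) = a (- r) * b (- s).
Proof.
move=> ar bs; rewrite pcoefM (@cauchyE _ _ _ _ [set - r])//.
  by rewrite fsbig_set1; congr (_ * b _); lra.
move=> x ax bx /=; apply/eqP; rewrite eq_le !leNgt.
apply/andP; split; apply/negP => xr.
- by move/eqP: bx; apply; apply: bs; lra.
- by move/eqP: ax; apply; apply: ar; lra.
Qed.

Lemma veqM a b r s : veq a r -> veq b s -> veq (a * b) (r + s).
Proof.
move=> [ar a0] [bs b0]; split; first exact: vleM.
by rewrite leadM// mulf_neq0.
Qed.

Lemma vleM_to a b r s q : vle a r -> vle b s -> r + s <= q -> vle (a * b) q.
Proof. by move=> ar bs; apply: vle_le; exact: vleM. Qed.

Lemma vltM_to a b r s q : vle a r -> vle b s -> r + s < q -> vlt (a * b) q.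
Proof. by move=> ar bs; apply: vle_lt; exact: vleM. Qed.

Lemma veqM_to a b r s q : veq a r -> veq b s -> r + s = q -> veq (a * b) q.
Proof. by move=> ar bs <-; exact: veqM. Qed.

Lemma veqD_lt a b r : veq a r -> vlt b r -> veq (a + b) r.
Proof.
move=> [ar a0] br; split; first by apply: vleD => //; exact: vltW.
by rewrite pcoefD (br (- r))// addr0.
Qed.

Lemma veq_neq0 a r : veq a r -> a != 0.
Proof. by case=> _; apply: contra_neq => ->; rewrite pcoef0. Qed.

Lemma veq_uniq a r s : veq a r -> veq a s -> r = s.
Proof.
move=> [ar a0] [as_ as0]; apply/eqP; rewrite eq_le !leNgt.
apply/andP; split; apply/negP => rs.
- by move/eqP: a0; apply; apply: as_; lra.
- by move/eqP: as0; apply; apply: ar; lra.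
Qed.

Lemma veq_lt a r s : veq a r -> vlt a s -> r < s.
Proof.
move=> [_ a0] as_; rewrite ltNge; apply/negP => rs.
by move/eqP: a0; apply; apply: as_; lra.
Qed.

Lemma veq_ex a : a != 0 -> exists r, veq a r.
Proof.
move=> a0.
have [r ar] : psupp a !=set0.
  apply: contrapT => h; case/eqP: a0; apply: puiseux_eqP => r.
  by rewrite pcoef0; apply: contrapT => /eqP ?; apply: h; exists r.
have [|m am mP] := @pcoef_wo R a _ (fun _ => id); first by exists r.
exists (- m); split; last by rewrite opprK.
move=> s; rewrite opprK => sm; apply: contrapT => /eqP as0.
by have := mP _ as0; rewrite leNgt sm.
Qed.

Lemma veq_valuation a r : veq a r -> valuation a = r%:E.
Proof.
move=> ar; rewrite /valuation (negPf (veq_neq0 ar)); congr (_%:E).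
case: ar => ar a0; rewrite -[RHS]opprK; congr (- _).
apply/eqP; rewrite eq_le; apply/andP; split.
  apply: ge_inf => //; exists (- r) => x /= ax.
  by rewrite leNgt; apply/negP => xr; move/eqP: ax; apply; exact: ar.
apply: lb_le_inf; first by exists (- r).
by move=> x /= ax; rewrite leNgt; apply/negP => xr; move/eqP: ax; apply; exact: ar.
Qed.

Lemma valuation_veq a : a != 0 -> veq a (fine (valuation a)).
Proof. by move=> /veq_ex[r ar]; rewrite (veq_valuation ar). Qed.

Lemma veq1 : veq 1 0.
Proof.
split; last by rewrite oppr0 pcoef1 eqxx oner_eq0.
by move=> s; rewrite oppr0 => s0; rewrite pcoef1 lt_eqF.
Qed.

Lemma veqX a r n : veq a r -> veq (a ^+ n) (r *+ n).
Proof.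
move=> ar; elim: n => [|n ih]; first by rewrite expr0 mulr0n; exact: veq1.
by rewrite exprS mulrS; exact: veqM.
Qed.

Lemma veqV a r : veq a r -> veq a^-1 (- r).
Proof.
move=> ar; have a0 := veq_neq0 ar.
have [s as_] : exists s, veq a^-1 s by apply: veq_ex; rewrite invr_eq0.
suff -> : - r = s by [].
have := veqM ar as_; rewrite divff// => /veq_uniq /(_ veq1); lra.
Qed.

Lemma pcoef_nat n r : (n%:R : K) r = (n%:R : C) * (r == 0)%:R.
Proof.
elim: n => [|n ih]; first by rewrite mulr0n pcoef0 mul0r.
by rewrite -natr1 pcoefD ih pcoef1 -[in RHS]natr1 mulrDl mul1r.
Qed.

Lemma pcoef_int (z : int) r : (z%:~R : K) r = (z%:~R : C) * (r == 0)%:R.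
Proof.
case: z => n; first exact: pcoef_nat.
by rewrite NegzE !mulrNz pcoefN -!pmulrn pcoef_nat mulNr.
Qed.

Lemma vle_int (z : int) : vle z%:~R 0.
Proof. by move=> s; rewrite oppr0 => s0; rewrite pcoef_int lt_eqF ?mulr0. Qed.

Lemma veq_int (z : int) : z != 0 -> veq z%:~R 0.
Proof.
move=> z0; split; first exact: vle_int.
by rewrite oppr0 pcoef_int eqxx mulr1 intr_eq0.
Qed.

Lemma veq_monom (x : C) s : x != 0 -> veq (pmonom x s) (- s).
Proof.
move=> x0; split; last by rewrite opprK /= /monom eqxx.
by move=> r; rewrite opprK => rs /=; rewrite /monom lt_eqF.
Qed.

Lemma vle_monom (x : C) s : vle (pmonom x s) (- s).
Proof. by move=> r; rewrite opprK => rs /=; rewrite /monom lt_eqF. Qed.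

(** The leading coefficient of the largest summand survives in the sum. Every dominance argument
    below ends here. *)
Lemma no_dominant (I : eqType) (l : seq I) (F : I -> K) i r : uniq l ->
  i \in l -> veq (F i) r -> {in l, forall j, j != i -> vlt (F j) r} ->
  \sum_(j <- l) F j <> 0.
Proof.
move=> ul il Fi Fj; rewrite (bigD1_seq i)//=.
have : vlt (\sum_(j <- l | j != i) F j) r by apply: vlt_sum => j jl; exact: Fj.
by move=> /(veqD_lt Fi)/veq_neq0/eqP.
Qed.

End Valuation.

(** * Hensel's lemma *)

Section FixedPoint.
Variable R : realType.
Local Notation K := (puiseux R).
Local Notation C := (R[i]).
Implicit Types (a b y z : K) (c : {poly K}) (r s t : R).

Lemma abs_sum_le_small b s0 d : 0 < s0 -> 0 < d -> vle b (- s0) ->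
  exists2 e, 0 < e & forall t, 0 < t < e -> (abs_sum b t <= d%:E)%E.
Proof.
move=> s00 d0 bs.
(* [abs_sum_small] only provides the bound 1/2, so it is applied to b / (2d). *)
pose x : C := (2 * d)%:C%C.
have x0 : x != 0 by rewrite /x fmorph_eq0 mulf_neq0// gt_eqF.
pose b' := pmonom x^-1 0 * b.
have [|e e0 eP] := @abs_sum_small R b' s0 s00.
  move=> r rs; rewrite pcoef_monomM subr0 bs ?mulr0//; lra.
exists e => // t te; have t0 : 0 < t by case/andP: te.
have -> : b = pmonom x 0 * b'.
  apply: puiseux_eqP => r; rewrite !pcoef_monomM !subr0 mulrA divff// mul1r.
  by [].
apply: le_trans (abs_sum_cauchy _ _ _) _ => //.
  by apply: le_lt_trans (eP t te) _; rewrite ltry.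
rewrite abs_sum_monom powRr0 mulr1.
have -> : ComplexField.Normc.normc x = 2 * d.
  by rewrite /x /= expr0n /= addr0 sqrtr_sqr gtr0_norm// mulr_gt0.
apply: (@le_trans _ _ ((2 * d)%:E * 2^-1%:E)%E).
  apply: lee_pmul => //; last by apply: eP.
    by rewrite lee_fin mulr_ge0// ltW.
  exact: abs_sum_ge0.
by rewrite -EFinM lee_fin mulrAC divff// mul1r.
Qed.

Lemma abs_sum_coef_small c s0 d : 0 < s0 -> 0 < d ->
  (forall n, vle c`_n (- s0)) -> forall N, exists2 e, 0 < e &
    forall t n, 0 < t < e -> (n < N)%N -> (abs_sum c`_n t <= d%:E)%E.
Proof.
move=> s00 d0 cs; elim=> [|N [e e0 eP]]; first by exists 1.
have [f f0 fP] := abs_sum_le_small s00 d0 (cs N).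
exists (Num.min e f); first by rewrite lt_min e0.
move=> t n /andP[t0]; rewrite lt_min => /andP[te tf].
rewrite ltnS leq_eqVlt => /orP[/eqP->|nN]; first by apply: fP; rewrite t0.
by apply: eP; rewrite ?t0.
Qed.

Lemma abs_sum1 t : abs_sum (1 : K) t = 1%E.
Proof. by rewrite abs_sum_monom powRr0 mulr1 ComplexField.Normc.normc1. Qed.

Lemma abs_sumX_le1 y t n : 0 < t -> (abs_sum y t <= 1)%E ->
  (abs_sum (y ^+ n)%R t <= 1)%E.
Proof.
move=> t0 y1; elim: n => [|n ih]; first by rewrite expr0 abs_sum1.
rewrite exprS; apply: le_trans (abs_sum_cauchy _ _ _) _ => //.
  by apply: le_lt_trans ih _; rewrite ltry.
rewrite -[leRHS]mule1; apply: lee_pmul => //; exact: abs_sum_ge0.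
Qed.

Lemma abs_sum_horner c y t d : 0 < t -> (abs_sum y t <= 1)%E -> 0 <= d ->
  (forall n, (n < size c)%N -> (abs_sum c`_n t <= d%:E)%E) ->
  (abs_sum c.[y]%R t <= (d *+ size c)%:E)%E.
Proof.
move=> t0 y1 d0 cd; rewrite horner_coef.
suff : forall N, (N <= size c)%N ->
    (abs_sum (\sum_(i < N) c`_i * y ^+ i)%R t <= (d *+ N)%:E)%E by apply.
elim=> [_|N ih NS].
  by rewrite big_ord0 abs_sum_monom ComplexField.Normc.normc0 mul0r mulr0n.
rewrite big_ord_recr /= mulrSr EFinD.
apply: le_trans (abs_sumD _ _ _) _; apply: leeD; first by apply: ih; exact: ltnW.
have yN := abs_sumX_le1 N t0 y1.
apply: le_trans (abs_sum_cauchy _ _ _) _ => //.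
  by apply: le_lt_trans yN _; rewrite ltry.
rewrite -[leRHS]mule1; apply: lee_pmul => //; [exact: abs_sum_ge0..|].
exact: cd.
Qed.

Lemma vleX y n : vle y 0 -> vle (y ^+ n) 0.
Proof.
move=> y0; elim: n => [|n ih]; first by rewrite expr0; case: (veq1 R).
by rewrite exprS -[0]addr0; exact: vleM.
Qed.

Lemma vle_horner c y r : (forall n, vle c`_n r) -> vle y 0 -> vle c.[y] r.
Proof.
move=> cr y0; rewrite horner_coef; apply: vle_sum => i _.
by rewrite -[r]addr0; apply: vleM => //; exact: vleX.
Qed.

Lemma vle_hornerB c y z r s : (forall n, vle c`_n r) -> vle y 0 -> vle z 0 ->
  vle (y - z) s -> vle (c.[y] - c.[z]) (r + s).
Proof.
move=> cr y0 z0 yz; rewrite !horner_coef -sumrB; apply: vle_sum => i _.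
rewrite -mulrBr; apply: vleM => //; elim: (i : nat) => [|n ih].
  by rewrite !expr0 subrr; exact: vle0.
have -> : y ^+ n.+1 - z ^+ n.+1 = y * (y ^+ n - z ^+ n) + (y - z) * z ^+ n.
  by rewrite !exprS; ring.
apply: vleD; first by rewrite -[s]add0r; exact: vleM.
by rewrite -[s]addr0; apply: vleM => //; exact: vleX.
Qed.

(** Each iteration from 0 gains s0 in the exponent, so the coefficients of the iterates stabilize.
    Convergence of the limit is inherited: for small t all iterates have absolute sum at most 1, and
    finitely many coefficients of the limit are those of a single iterate. *)
Lemma puiseux_fixpoint c s0 : 0 < s0 -> (forall n, vle c`_n (- s0)) ->
  exists2 y, y = c.[y] & vle y (- s0).
Proof.
move=> s00 cs.
pose x n := iter n (horner c) 0.
have x_le n : vle (x n) (- s0).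
  elim: n => [|n ih]; first exact: vle0.
  by apply: vle_horner => //; apply: vle_le ih _; rewrite oppr_le0 ltW.
have vle0x n : vle (x n) 0 by apply: vle_le (x_le n) _; rewrite oppr_le0 ltW.
have xS n : vle (x n.+1 - x n) (- (n.+1%:R * s0)).
  elim: n => [|n ih]; first by rewrite mul1r subr0; exact: x_le.
  have -> : - (n.+2%:R * s0) = - s0 + - (n.+1%:R * s0).
    by rewrite -[n.+2%:R]natr1 mulrDl mul1r opprD addrC.
  exact: (vle_hornerB cs (vle0x n.+1) (vle0x n) ih).
have hst N M q : (N <= M)%N -> q < N%:R * s0 -> x M q = x N q.
  move=> NM qN; rewrite -(subnKC NM); elim: (M - N)%N => [|m ih]; first by rewrite addn0.
  rewrite addnS -ih -[x (N + m).+1](subrK (x (N + m)%N)) pcoefD xS ?add0r//.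
  rewrite opprK; apply: lt_le_trans qN _; rewrite ler_wpM2r ?(ltW s00)// ler_nat.
  by rewrite -addnS leq_addr.
(* From the index [N q] on, the coefficient at q no longer changes. *)
pose N (q : R) := Num.bound (`|q| / s0).
have NP q : q < (N q)%:R * s0.
  apply: le_lt_trans (ler_norm q) _; rewrite -ltr_pdivrMr//.
  by apply: archi_boundP; rewrite divr_ge0// ltW.
pose g q := x (N q) q.
have gE M q : q < M%:R * s0 -> g q = x M q.
  move=> qM; rewrite /g; have [NM|MN] := leqP (N q) M.
    by rewrite -(hst _ _ _ NM).
  by rewrite (hst _ _ _ (ltnW MN)).
have g_wo : well_ordered (psupp g).
  move=> U Ug [u Uu].
  (* Up to u the limit coincides with one iterate, whose support is well ordered. *)
  pose V := U `&` [set z | z <= u].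
  have [||m [Um mu] mP] := @pcoef_wo R (x (N u)) V.
  - move=> z [Uz /= zu]; have := Ug z Uz; rewrite /psupp /= (gE (N u))//.
    by apply: le_lt_trans zu (NP u).
  - by exists u; split => //=.
  exists m => // z Uz; have [zu|uz] := leP z u; first by apply: mP.
  by apply: le_trans (ltW uz).
have g_cvg : locally_convergent g.
  (* If the coefficients have absolute sum at most d, the polynomial maps the unit ball into itself,
     as d times the size is at most 1. The successor keeps d positive when c = 0. *)
  pose d : R := (size c).+1%:R^-1.
  have d0 : 0 < d by rewrite invr_gt0.
  have [e e0 eP] := abs_sum_coef_small s00 d0 cs (size c).
  exists e => // t te; have t0 : 0 < t by case/andP: te.
  have hb M : (abs_sum (x M) t <= 1)%E.
    elim: M => [|M ih].
      by rewrite abs_sum_monom ComplexField.Normc.normc0 mul0r.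
    apply: le_trans (abs_sum_horner t0 ih (ltW d0) (fun n => eP t n te)) _.
    rewrite lee_fin -(mulr_natl d) ler_pdivrMr// mul1r ler_nat.
    exact: leqnSn.
  apply: (@le_lt_trans _ _ 1%E); last by rewrite ltry.
  apply: ge_ereal_sup => _ [X [finX _] <-].
  have [M MP] : exists M, forall q, X q -> q < M%:R * s0.
    move/finite_seqP: finX => [l ->]; exists (\max_(q <- l) N q)%N => q /= ql.
    apply: lt_le_trans (NP q) _; rewrite ler_wpM2r ?(ltW s00)// ler_nat.
    exact: leq_bigmax_seq.
  apply: le_trans (hb M); apply: esum_ge; exists X => //.
  rewrite le_eqVlt; apply/orP; left; apply/eqP; apply: eq_fsbigr => q /set_mem Xq.
  by rewrite (gE M)// MP.
pose y := Puiseux g_wo g_cvg.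
have yx M : vle (y - x M) (- (M%:R * s0)).
  move=> q; rewrite opprK => qM; rewrite pcoefD pcoefN.
  by rewrite [y q](gE M)// subrr.
have y0 : vle y (- s0).
  by move=> q; rewrite opprK => qs; rewrite [y q](gE 1%N) ?mul1r//; apply: x_le; lra.
have vle0y : vle y 0 by apply: vle_le y0 _; rewrite oppr_le0 ltW.
exists y => //; apply: puiseux_eqP => q; pose M := N q.
have qM := NP q.
have h : (c.[y] - c.[x M]) q = 0.
  apply: (vle_hornerB cs vle0y (vle0x M) (yx M)).
  by rewrite opprD !opprK; lra.
move: h; rewrite pcoefD pcoefN => /eqP; rewrite subr_eq0 => /eqP ->.
rewrite [LHS](gE M)// -[c.[x M]]/(x M.+1) (hst M)//.
Qed.

End FixedPoint.

Section Hensel.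
Variable R : realType.
Local Notation K := (puiseux R).
Local Notation C := (R[i]).

Lemma vle_pcst (x : C) : vle (pmonom x 0 : K) 0.
Proof. by rewrite -[X in vle _ X]oppr0; exact: vle_monom. Qed.

Lemma puiseux_hensel (g : {poly K}) (w : C) : (forall n, vle g`_n 0) ->
  vlt g.[pmonom w 0] 0 -> veq g^`().[pmonom w 0] 0 ->
  exists2 y, g.[y] = 0 & vlt (y - pmonom w 0) 0.
Proof.
set x := pmonom w 0 => g0 gx dgx.
have x0 : vle x 0 by exact: vle_pcst.
have [gx0|gx0] := eqVneq g.[x] 0.
  by exists x => //; rewrite subrr; exact: vlt0.
have [s gxs] := veq_ex gx0.
have s0 : s < 0 by exact: veq_lt gxs gx.
(* After substituting x + tau y and dividing by tau g'(x), with tau of valuation -d, the linear term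
   cancels; the constant has valuation s + d = -d and degree n >= 2 has at most d - nd <= -d. This
   balance dictates half of s and leads to [puiseux_fixpoint]. *)
pose d := - s / 2; have d0 : 0 < d by rewrite /d; lra.
pose tau : K := pmonom 1 d.
have taud : veq tau (- d) by apply: veq_monom; exact: oner_neq0.
set u := g^`().[x] in dgx.
have tu : veq (tau * u)^-1 d.
  by rewrite -[d]opprK; apply: veqV; rewrite -[- d]addr0; exact: veqM.
have tu0 : tau * u != 0 by have /veq_neq0 := tu; rewrite invr_eq0.
have sg : (1 < size g)%N.
  rewrite ltnNge; apply/negP => /size1_polyC gE.
  by have := veq_neq0 dgx; rewrite /u gE derivC horner0 eqxx.
have N0 i : vle g^`N(i).[x] 0.
  apply: vle_horner => // n; rewrite coef_nderivn -mulr_natr.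
  by apply: (vleM_to (g0 _) (@vle_int R (Posz _))); rewrite addr0.
pose h : {poly K} := \poly_(i < size g) (g^`N(i).[x] * tau ^+ i).
pose c := 'X - (tau * u)^-1 *: h.
have [n|y yE yd] := puiseux_fixpoint d0 (c := c).
  rewrite coefB coefX coefZ coef_poly.
  case: n => [|[|n]].
  - rewrite (ltn_trans _ sg)// sub0r poly.nderivn0 expr0 mulr1; apply: vleN.
    have -> : - d = d + s by rewrite /d; lra.
    by apply: vleM; [case: tu|case: gxs].
  - rewrite sg poly.nderivn1 -/u expr1 [u * _]mulrC mulVf// subrr; exact: vle0.
  - rewrite sub0r; apply: vleN.
    case: ifP => _; last by rewrite mulr0; exact: vle0.
    apply: (@vle_le _ _ (d + (0 + (- d) *+ n.+2))).
      apply: vleM; first by case: tu.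
      by apply: vleM => //; case: (veqX n.+2 taud).
    rewrite add0r !mulrS -mulr_natr.
    have : 0 <= d * n%:R by rewrite mulr_ge0// ltW.
    rewrite mulNr; lra.
exists (x + tau * y); last first.
  rewrite [x + _]addrC addrK; apply: (@vle_lt _ _ (- d + - d)); last lra.
  by apply: vleM => //; case: taud.
rewrite nderiv_taylor; last exact: mulrC.
move: yE; rewrite /c hornerD hornerN hornerX hornerZ => /eqP.
rewrite -subr_eq0 opprB addrC subrK.
rewrite mulf_eq0 invr_eq0 (negPf tu0) /= horner_poly => /eqP hy.
by rewrite -[RHS]hy; apply: eq_bigr => i _; rewrite exprMn mulrA.
Qed.

End Hensel.

Section Lifting.
Variable R : realType.
Local Notation K := (puiseux R).
Local Notation C := (R[i]).

Lemma lead0M (a b : K) : vle a 0 -> vle b 0 -> (a * b) 0 = a 0 * b 0.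
Proof. by move=> a0 b0; have := leadM a0 b0; rewrite addr0 oppr0. Qed.

Lemma pcst0 (x : C) : (pmonom x 0 : K) 0 = x.
Proof. by rewrite /= /monom eqxx. Qed.

Lemma pcst_veq (x : C) : x != 0 -> veq (pmonom x 0 : K) 0.
Proof. by move=> x0; split; [exact: vle_pcst|rewrite oppr0 pcst0]. Qed.

Lemma pcstX (x : C) n : (pmonom x 0 : K) ^+ n = pmonom (x ^+ n) 0.
Proof.
elim: n => [|n ih]; first by rewrite !expr0.
apply: puiseux_eqP => r; rewrite !exprS ih pcoef_monomM subr0 /= /monom.
by case: ifP; rewrite ?mulr0.
Qed.

Lemma pcst0X (x : C) n : ((pmonom x 0 : K) ^+ n) 0 = x ^+ n.
Proof. by rewrite pcstX pcst0. Qed.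

(** The other variable is frozen at the constant w'. Simplicity of the root is expressed by the
    logarithmic derivative, which lowers no exponent, so that the two variables can be treated
    alike. *)
Lemma hensel_root (I : eqType) (l : seq I) (b : I -> K) (e f : I -> nat)
    (w w' : C) : w != 0 -> {in l, forall m, vle (b m) 0} ->
  \sum_(m <- l) b m 0 * (w' ^+ f m * w ^+ e m) = 0 ->
  \sum_(m <- l) b m 0 * (w' ^+ f m * w ^+ e m) * (e m)%:R != 0 ->
  exists2 y, veq y 0 & \sum_(m <- l) b m * (pmonom w' 0 ^+ f m * y ^+ e m) = 0.
Proof.
move=> w0 b0 h0 h1.
pose g : {poly K} := \sum_(m <- l) (b m * pmonom w' 0 ^+ f m) *: 'X^(e m).
have gE y : g.[y] = \sum_(m <- l) b m * (pmonom w' 0 ^+ f m * y ^+ e m).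
  rewrite horner_sum; apply: eq_bigr => m _.
  by rewrite hornerZ hornerXn mulrA.
have dgE y : y * g^`().[y] =
    \sum_(m <- l) b m * (pmonom w' 0 ^+ f m * y ^+ e m) * (e m)%:R.
  rewrite (raddf_sum (deriv (R:=K))) horner_sum mulr_sumr; apply: eq_bigr => m _.
  rewrite /= derivZ derivXn hornerZ hornerMn hornerXn.
  case: (e m) => [|n]; first by rewrite mulr0n !mulr0.
  by rewrite exprS -[X in _ * (_ * X) = _]mulr_natr /=; ring.
have bf0 m : m \in l -> vle (b m * pmonom w' 0 ^+ f m) 0.
  by move=> ml; apply: (vleM_to (b0 m ml) (vleX _ (vle_pcst w'))); rewrite addr0.
have term0 m x : m \in l -> vle x 0 ->
    vle (b m * (pmonom w' 0 ^+ f m * x ^+ e m)) 0.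
  by move=> ml x0; rewrite mulrA; apply: (vleM_to (bf0 m ml) (vleX _ x0)); rewrite addr0.
have lead m : m \in l -> (b m * (pmonom w' 0 ^+ f m * pmonom w 0 ^+ e m)) 0 =
    b m 0 * (w' ^+ f m * w ^+ e m).
  move=> ml; rewrite mulrA lead0M//; last by [exact: bf0|exact/vleX/vle_pcst].
    by rewrite lead0M ?pcst0X -?mulrA//; [exact: b0|exact/vleX/vle_pcst].
  exact: bf0.
have [n|||y gy yw] := @puiseux_hensel R g w.
- rewrite coef_sum; apply: vle_sum => m ml; rewrite coefZ coefXn.
  apply: (vleM_to (bf0 m ml) (s := 0)); last by rewrite addr0.
  exact: (@vle_int R (Posz _)).
- rewrite gE; apply: vle_vltP; first by apply: vle_sum => m ml; apply: term0 => //; exact: vle_pcst.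
  rewrite oppr0 pcoef_sum -[RHS]h0 big_seq [RHS]big_seq.
  by apply: eq_bigr => m ml; exact: lead.
- suff h : veq (pmonom w 0 * g^`().[pmonom w 0]) 0.
    have := veqM (veqV (pcst_veq w0)) h.
    by rewrite mulrA mulVf ?mul1r ?oppr0 ?addr0//; exact: veq_neq0 (pcst_veq w0).
  rewrite dgE; split.
    apply: vle_sum => m ml; apply: (@vleM_to _ _ _ 0 0); rewrite ?addr0//.
      by apply: term0 => //; exact: vle_pcst.
    exact: (@vle_int R (Posz _)).
  rewrite oppr0 pcoef_sum; move: h1; congr (_ != _); rewrite big_seq [RHS]big_seq.
  apply: eq_bigr => m ml; rewrite lead0M ?lead//; first by rewrite pcoef_nat eqxx mulr1.
    by apply: term0 => //; exact: vle_pcst.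
  exact: (@vle_int R (Posz _)).
exists y; last by rewrite -gE.
by rewrite -(subrK (pmonom w 0) y) addrC; apply: veqD_lt => //; exact: pcst_veq.
Qed.

End Lifting.

(** * Lattice polygons and tropical polynomials *)

Section LatticeHulls.
Variable R : realType.
Implicit Types (D B : set (R * R)) (x y : R * R) (z a b c : int * int).

Lemma sub_convex_hull D : D `<=` convex_hull D.
Proof. by move=> x Dx B [_]; apply. Qed.

Lemma convex_hull_min D B : convex_set B -> D `<=` B -> convex_hull D `<=` B.
Proof. by move=> cB DB x; apply; split. Qed.

Lemma convex_hullS D B : D `<=` B -> convex_hull D `<=` convex_hull B.
Proof. by move=> DB x hx A [cA BA]; apply: hx; split => //; exact: subset_trans BA. Qed.

Lemma convex_halfplane (a b c : R) :
  convex_set [set x : R * R | 0 <= a * x.1 + b * x.2 + c].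
Proof.
move=> x y l /set_mem /= hx /set_mem /= hy; apply/mem_set => /=.
rewrite /GRing.scale /= /unstable.onem.
have l1 : 0 <= 1 - l%:num by rewrite subr_ge0.
rewrite [leRHS](_ : _ = l%:num * (a * x.1 + b * x.2 + c) +
  (1 - l%:num) * (a * y.1 + b * y.2 + c)); last by ring.
by rewrite addr_ge0// mulr_ge0.
Qed.

Lemma convex_hull_halfplane D (a b c : R) x :
  D `<=` [set x : R * R | 0 <= a * x.1 + b * x.2 + c] ->
  convex_hull D x -> 0 <= a * x.1 + b * x.2 + c.
Proof. by move=> h; apply: (convex_hull_min (@convex_halfplane a b c) h). Qed.

Lemma convex_hull_line D (a b c : R) x :
  D `<=` [set x : R * R | a * x.1 + b * x.2 + c = 0] ->
  convex_hull D x -> a * x.1 + b * x.2 + c = 0.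
Proof.
move=> h hx; apply/eqP; rewrite eq_le; apply/andP; split.
  have := @convex_hull_halfplane D (- a) (- b) (- c) x.
  suff : D `<=` [set x | 0 <= - a * x.1 + - b * x.2 - c].
    by move=> h1 /(_ h1 hx); lra.
  by move=> y /h /=; lra.
by apply: convex_hull_halfplane hx => y /h /= ->.
Qed.

Definition idet a b c : int :=
  (b.1 - a.1) * (c.2 - a.2) - (b.2 - a.2) * (c.1 - a.1).

Lemma det2_idet a b c :
  det2 (lattice_pt R b - lattice_pt R a) (lattice_pt R c - lattice_pt R a) =
  (idet a b c)%:~R.
Proof. by rewrite /det2 /idet /= !rmorphB !rmorphM /= !rmorphB. Qed.

(** As the determinant is 1 or -1, the barycentric coordinates of a lattice point are integers;
    being nonnegative of sum 1, they are those of a corner. *)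
Lemma unimodular_lattice_hull a b c z : `|idet a b c| = 1 ->
  convex_hull [set lattice_pt R a; lattice_pt R b; lattice_pt R c]
    (lattice_pt R z) -> [\/ z = a, z = b | z = c].
Proof.
move=> D1; set S := [set _; _; _] => hz.
pose D := idet a b c.
have DD : D * D = 1.
  by have := D1; rewrite -/D; case: (lerP 0 D) => _ h; nia.
(* Cramer's rule for the coordinates along b - a and c - a, where D is its own inverse. *)
pose l1 := D * idet a z c; pose l2 := D * idet a b z.
have toR (u v w : int) :
    (forall x, S x -> 0 <= u%:~R * x.1 + v%:~R * x.2 + w%:~R) ->
    0 <= u * z.1 + v * z.2 + w.
  move=> /convex_hull_halfplane /(_ hz) /=.
  by rewrite -!intrM -!intrD ler0z.
have inS (u v w : int) : 0 <= u * a.1 + v * a.2 + w ->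
    0 <= u * b.1 + v * b.2 + w -> 0 <= u * c.1 + v * c.2 + w ->
    0 <= u * z.1 + v * z.2 + w.
  move=> ha hb hc; apply: toR => x [[|]|] -> /=; by rewrite -!intrM -!intrD ler0z.
have l1E (x : int * int) : D * idet a x c = D * (c.2 - a.2) * x.1 + D * (a.1 - c.1) * x.2 +
    D * (a.2 * (c.1 - a.1) - a.1 * (c.2 - a.2)).
  by rewrite /idet; ring.
have l2E (x : int * int) : D * idet a b x = D * (a.2 - b.2) * x.1 + D * (b.1 - a.1) * x.2 +
    D * ((b.2 - a.2) * a.1 - (b.1 - a.1) * a.2).
  by rewrite /idet; ring.
have l1_ge0 : 0 <= l1.
  rewrite /l1 l1E; apply: inS; rewrite -l1E.
  - by rewrite (_ : idet a a c = 0) ?mulr0// /idet; ring.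
  - by rewrite -/D DD.
  - by rewrite (_ : idet a c c = 0) ?mulr0// /idet; ring.
have l2_ge0 : 0 <= l2.
  rewrite /l2 l2E; apply: inS; rewrite -l2E.
  - by rewrite (_ : idet a b a = 0) ?mulr0// /idet; ring.
  - by rewrite (_ : idet a b b = 0) ?mulr0// /idet; ring.
  - by rewrite -/D DD.
have l12_le1 : 0 <= 1 - l1 - l2.
  have E (x : int * int) : 1 - D * idet a x c - D * idet a b x =
    (- (D * (c.2 - a.2)) - D * (a.2 - b.2)) * x.1 +
    (- (D * (a.1 - c.1)) - D * (b.1 - a.1)) * x.2 +
    (1 - D * (a.2 * (c.1 - a.1) - a.1 * (c.2 - a.2))
       - D * ((b.2 - a.2) * a.1 - (b.1 - a.1) * a.2)).
    by rewrite l1E l2E; ring.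
  rewrite /l1 /l2 E; apply: inS; rewrite -E.
  - by rewrite (_ : idet a a c = 0) 1?(_ : idet a b a = 0) ?mulr0 ?subr0// /idet; ring.
  - by rewrite -/D DD (_ : idet a b b = 0) ?mulr0 ?subrr ?subr0// /idet; ring.
  - by rewrite -/D DD (_ : idet a c c = 0) ?mulr0 ?subrr ?subr0// /idet; ring.
have z1 : z.1 - a.1 = l1 * (b.1 - a.1) + l2 * (c.1 - a.1).
  rewrite -[LHS]mul1r -DD /l1 /l2 {1}/D /idet; ring.
have z2 : z.2 - a.2 = l1 * (b.2 - a.2) + l2 * (c.2 - a.2).
  rewrite -[LHS]mul1r -DD /l1 /l2 {1}/D /idet; ring.
clearbody l1 l2; have [l10|l10] := eqVneq l1 0.
  have [l20|l20] := eqVneq l2 0.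
    constructor 1; case: z a z1 z2 {l1E l2E toR inS hz S D1 D DD} => z1 z2 [a1 a2] /=.
    by rewrite l10 l20 !mul0r addr0 => /eqP; rewrite subr_eq0 => /eqP-> /eqP; rewrite subr_eq0 => /eqP->.
  have l21 : l2 = 1 by lia.
  constructor 3; move: z1 z2; rewrite l10 l21 !mul0r !mul1r !add0r => /addIr z1 /addIr z2.
  by rewrite [z]surjective_pairing z1 z2 -surjective_pairing.
have l11 : l1 = 1 by lia.
have l20 : l2 = 0 by lia.
constructor 2; move: z1 z2; rewrite l20 l11 !mul0r !mul1r !addr0 => /addIr z1 /addIr z2.
by rewrite [z]surjective_pairing z1 z2 -surjective_pairing.
Qed.

End LatticeHulls.

(** * Maximal monomials of a non-singular tropical polynomial *)

Section TropicalPolynomials.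
Variable R : realType.
Local Notation exponent := (multinom 2).
Local Notation i0 := (@ord0 1).
Local Notation i1 := (@ord_max 1).
Implicit Types (F : tropical_poly R) (x u : R * R) (m n : exponent) (r s : R).

Definition zexp m : int * int := ((m i0)%:Z, (m i1)%:Z).

Lemma zexp_inj : injective zexp.
Proof.
move=> m n [h0 h1]; apply/mnmP => i.
case: i => [[|[|//]] hi].
  by rewrite (_ : Ordinal hi = i0)//; exact: val_inj.
by rewrite (_ : Ordinal hi = i1)//; exact: val_inj.
Qed.

Definition edet m0 m1 m2 : int := idet (zexp m0) (zexp m1) (zexp m2).

Lemma edet_neq m0 m1 m2 : edet m0 m1 m2 != 0 -> [/\ m0 != m1, m0 != m2 & m1 != m2].
Proof.
rewrite /edet /idet => h; split; apply: contra_neq h => ->; ring.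
Qed.

Lemma edet_perm3 m0 m1 m2 : edet m0 m1 m2 = - edet m0 m2 m1.
Proof. by rewrite /edet /idet; ring. Qed.

Lemma edet_rot m0 m1 m2 : edet m0 m1 m2 = edet m1 m2 m0.
Proof. by rewrite /edet /idet; ring. Qed.

Definition slope u m : R := (m i0)%:R * u.1 + (m i1)%:R * u.2.

Lemma monomial_value_move F m x s u :
  monomial_value F m (x + s *: u) = monomial_value F m x + s * slope u m.
Proof. by rewrite /monomial_value /slope /= /GRing.scale /=; ring. Qed.

(** The three exponents make the dual cell at x two-dimensional, hence a primitive triangle. Its
    only lattice points are its corners, so the three exponents are these corners and leave no room
    for a fourth maximal one. *)
Lemma label3 F x m0 m1 m2 : nonsingular F ->
  maximizers F x m0 -> maximizers F x m1 -> maximizers F x m2 ->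
  edet m0 m1 m2 != 0 ->
  `|edet m0 m1 m2| = 1 /\
  forall m, maximizers F x m -> [\/ m = m0, m = m1 | m = m2].
Proof.
move=> nsF h0 h1 h2 d0.
pose G := Face (ex_intro (fun y => maximizers F y = maximizers F x) x erefl).
have inG m : maximizers F x m -> dual_cell G (lattice_pt R (zexp m)).
  by move=> mx; apply: sub_convex_hull; exists m.
have [|a [b [c [GE abc]]]] := nsF G.
  exists (lattice_pt R (zexp m0)), (lattice_pt R (zexp m1)), (lattice_pt R (zexp m2)).
  by split; [exact: inG..|rewrite det2_idet intr_eq0].
have {}abc : `|idet a b c| = 1.
  move: abc; rewrite det2_idet -intr_norm => h.
  by apply: (@intr_inj R); rewrite /=; lra.
have lab m : maximizers F x m -> [\/ zexp m = a, zexp m = b | zexp m = c].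
  by move=> /inG; rewrite GE => /(unimodular_lattice_hull abc).
have [n01 n02 n12] := edet_neq d0.
have dE (s t w : int * int) : idet s t w = idet t w s /\ idet s t w = - idet s w t.
  by rewrite /idet; split; ring.
have [E1 E2] := dE a b c; have [E3 E4] := dE b c a; have [_ E5] := dE c a b.
(* Equal corners contradict distinctness; each of the six remaining bijections changes the
   determinant at most by a sign. *)
case: (lab _ h0) => a0; case: (lab _ h1) => a1; case: (lab _ h2) => a2;
  try (by move: n01; rewrite -(inj_eq zexp_inj) a0 a1 eqxx);
  try (by move: n02; rewrite -(inj_eq zexp_inj) a0 a2 eqxx);
  try (by move: n12; rewrite -(inj_eq zexp_inj) a1 a2 eqxx);
  (split; [rewrite /edet a0 a1 a2;
     first [done | by rewrite -E1 | by rewrite -E3 -E1 |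
       by rewrite -[LHS]normrN -E2 | by rewrite -[LHS]normrN -E4 -E1
       | by rewrite -[LHS]normrN -E5 -E3 -E1]
  | move=> m /lab[] E;
     first [ by constructor 1; apply: zexp_inj; rewrite E a0
           | by constructor 2; apply: zexp_inj; rewrite E a1
           | by constructor 3; apply: zexp_inj; rewrite E a2 ]]).
Qed.

Lemma seq_argmin (T : eqType) (l : seq T) (Q : pred T) (f : T -> R) : has Q l ->
  exists2 m : T, m \in l /\ Q m & forall n : T, n \in l -> Q n -> f m <= f n.
Proof.
elim: l => //= a l ih /orP[Qa|/ih[m [ml Qm] mP]].
  have [/ih[m [ml Qm] mP]|nQ] := boolP (has Q l); last first.
    exists a; first by rewrite mem_head.
    move=> n; rewrite inE => /orP[/eqP->//|nl Qn].
    by case/negP: nQ; apply/hasP; exists n.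
  have [am|ma] := leP (f a) (f m).
    exists a; first by rewrite mem_head.
    move=> n; rewrite inE => /orP[/eqP->//|nl Qn].
    by apply: le_trans am _; exact: mP.
  exists m; first by rewrite inE ml orbT.
  by move=> n; rewrite inE => /orP[/eqP-> _|nl Qn]; [exact: ltW|exact: mP].
have [/negP nQ|Qa] := boolP (~~ Q a).
  exists m; first by rewrite inE ml orbT.
  by move=> n; rewrite inE => /orP[/eqP-> /nQ//|nl Qn]; exact: mP.
move: Qa; rewrite negbK => Qa; have [am|ma] := leP (f a) (f m).
  exists a; first by rewrite mem_head.
  move=> n; rewrite inE => /orP[/eqP->//|nl Qn].
  by apply: le_trans am _; exact: mP.
exists m; first by rewrite inE ml orbT.
by move=> n; rewrite inE => /orP[/eqP-> _|nl Qn]; [exact: ltW|exact: mP].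
Qed.

Lemma exists_maximizer F x n : n \in exps F -> exists m, maximizers F x m.
Proof.
move=> nF; have [|m [mF _] mP] :=
  @seq_argmin _ (exps F) predT (fun m => - monomial_value F m x).
  by apply/hasP; exists n.
by exists m; split => // m' m'F; rewrite -lerN2; exact: mP.
Qed.

Lemma maximizers_eq F x m n : maximizers F x m -> maximizers F x n ->
  monomial_value F m x = monomial_value F n x.
Proof. by move=> [mF mP] [nF nP]; apply/eqP; rewrite eq_le mP// nP. Qed.

Lemma maximizers_lt F x m n : maximizers F x m -> n \in exps F ->
  ~ maximizers F x n -> monomial_value F n x < monomial_value F m x.
Proof.
move=> [mF mP] nF nx; rewrite lt_neqAle mP// andbT; apply/eqP => E.
by apply: nx; split => // m' /mP; rewrite E.
Qed.

(* Moving from x along u, the first monomial of larger slope to catch up with m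
   does so at time s. *)
Lemma slide F x u m : maximizers F x m ->
  (exists2 n, n \in exps F & slope u m < slope u n) ->
  exists s n, [/\ 0 <= s, slope u m < slope u n, maximizers F (x + s *: u) n,
    (forall r m', 0 <= r <= s -> maximizers F x m' -> slope u m' = slope u m ->
       maximizers F (x + r *: u) m') &
    (forall r n', r < s -> slope u m < slope u n' -> ~ maximizers F (x + r *: u) n') /\
    (forall r, s < r -> ~ maximizers F (x + r *: u) m)].
Proof.
move=> [mF mP] [n0 n0F mn0].
pose f n := (monomial_value F m x - monomial_value F n x) / (slope u n - slope u m).
have [|n [nF mn] nP] := @seq_argmin _ (exps F) (fun n => slope u m < slope u n) f.
  by apply/hasP; exists n0.
have fE n' r : slope u m < slope u n' ->
    (monomial_value F n' (x + r *: u) <= monomial_value F m (x + r *: u)) =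
    (r <= f n').
  move=> mn'; rewrite !monomial_value_move /f ler_pdivlMr ?subr_gt0//.
  by apply/idP/idP; lra.
have max_m r : 0 <= r <= f n -> maximizers F (x + r *: u) m.
  move=> /andP[r0 rf]; split => // m' m'F; have [h|h] := leP (slope u m') (slope u m).
    by rewrite !monomial_value_move; apply: lerD; [exact: mP|exact: ler_wpM2l].
  by rewrite fE//; apply: le_trans rf _; exact: nP.
have f0 : 0 <= f n by rewrite divr_ge0 ?subr_ge0 ?mP// ltW.
have fn : monomial_value F n (x + f n *: u) = monomial_value F m (x + f n *: u).
  rewrite !monomial_value_move /f.
  have : slope u n - slope u m != 0 by rewrite subr_eq0 gt_eqF.
  by move=> h; field.
exists (f n), n; split => //.
- split => // m' m'F; rewrite fn.
  by case: (max_m (f n)) => [|_]; [rewrite f0 lexx|exact].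
- move=> r m' rf [m'F m'P] sm; split => // n' n'F.
  have -> : monomial_value F m' (x + r *: u) = monomial_value F m (x + r *: u).
    rewrite !monomial_value_move sm; congr (_ + _).
    by apply/eqP; rewrite eq_le mP// m'P.
  by case: (max_m r rf) => _; exact.
split=> [r n' rf mn' [n'F /(_ m mF)]|r fr [_ /(_ n nF)]].
  have rn' : r < f n' by apply: lt_le_trans rf _; exact: nP.
  rewrite !monomial_value_move; move: rn'.
  by rewrite /f ltr_pdivlMr ?subr_gt0//; lra.
by rewrite fE//; lra.
Qed.

Lemma unique_after F x u m : maximizers F x m ->
  (forall n, maximizers F x n -> n != m -> slope u n < slope u m) ->
  exists2 e, 0 < e & forall r n, 0 < r < e -> maximizers F (x + r *: u) n -> n = m.
Proof.
move=> mx nm.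
suff [e e0 eP] : exists2 e, 0 < e & forall r, 0 < r < e -> {in exps F, forall n,
    n != m -> monomial_value F n (x + r *: u) < monomial_value F m (x + r *: u)}.
  exists e => // r n re [nF nP]; apply/eqP/negPn/negP => nem.
  by have := eP r re n nF nem; rewrite ltNge nP//; case: mx.
have : {subset exps F <= exps F} by [].
elim: {1 3}(exps F) => [_|n l ih nF]; first by exists 1.
have [|e e0 eP] := ih; first by move=> n' n'l; apply: nF; rewrite inE n'l orbT.
have [h|h] := pselect (maximizers F x n).
  exists e => // r re n'; rewrite inE => /orP[/eqP->|]; last exact: eP.
  move=> /(nm _ h) sl; rewrite !monomial_value_move (maximizers_eq h mx).
  by rewrite ltrD2l ltr_pM2l//; case/andP: re.
have {}h := maximizers_lt mx (nF n (mem_head _ _)) h.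
pose d := monomial_value F m x - monomial_value F n x.
pose c := `|slope u n - slope u m| + 1.
have c0 : 0 < c by rewrite ltr_wpDl.
have d0 : 0 < d by rewrite subr_gt0.
exists (Num.min e (d / c)); first by rewrite lt_min e0 divr_gt0.
move=> r /andP[r0]; rewrite lt_min => /andP[re rd] n'.
rewrite inE => /orP[/eqP->|n'l] n'm; last by apply: eP => //; rewrite r0.
rewrite !monomial_value_move -subr_gt0.
have := rd; rewrite ltr_pdivlMr// /d /c.
have := ler_wpM2l (ltW r0) (ler_norm (slope u n - slope u m)).
by nra.
Qed.

(** If the maximal exponents at x are collinear, x lies inside an edge. Sliding along this edge, in
    the direction in which a monomial off the line catches up, keeps them maximal until a vertex is
    reached, where [label3] applies. *)
Lemma pair_label F x m m' : nonsingular F ->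
  maximizers F x m -> maximizers F x m' ->
  (exists2 n, n \in exps F & edet m m' n != 0) ->
  exists2 n, n \in exps F /\ `|edet m m' n| = 1 &
    forall m'', maximizers F x m'' -> [\/ m'' = m, m'' = m' | m'' = n].
Proof.
move=> nsF mx m'x [n nF mm'n].
have [[n1 [n1x n1d]]|nd] := pselect (exists n1, maximizers F x n1 /\ edet m m' n1 != 0).
  have [d1 lab] := label3 nsF mx m'x n1x n1d.
  by exists n1 => //; split=> //; case: n1x.
have col m'' : maximizers F x m'' -> edet m m' m'' = 0.
  by move=> h; apply: contrapT => /eqP ?; apply: nd; exists m''.
pose e : R := Num.sg ((edet m m' n)%:~R).
pose z (k : exponent) : R * R := ((k i0)%:R, (k i1)%:R).
(* Along u all monomials on the line through m and m' change at the same rate; the sign e makes n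
   grow faster. *)
pose u : R * R := (- e * ((z m').2 - (z m).2), e * ((z m').1 - (z m).1)).
have su k : slope u k - slope u m = e * (edet m m' k)%:~R.
  by rewrite /slope /u /edet /idet /zexp /z /= !rmorphB !rmorphM /= !rmorphB /=; ring.
have [|s [n1 [s0 sn1 n1x keep _]]] := @slide F x u m mx.
  exists n => //; by rewrite -subr_gt0 su /e -normrEsg normr_gt0 intr_eq0.
have e0 : e != 0 by rewrite sgr_eq0 intr_eq0.
have sl k : edet m m' k = 0 -> slope u k = slope u m.
  by move=> h; apply/eqP; rewrite -subr_eq0 su h mulr0.
have ss : 0 <= s <= s by rewrite s0 lexx.
have mm : edet m m' m = 0 by rewrite /edet /idet; ring.
have mm' : edet m m' m' = 0 by rewrite /edet /idet; ring.
have mx' := keep s m ss mx (sl _ mm).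
have m'x' := keep s m' ss m'x (sl _ mm').
have d1 : edet m m' n1 != 0.
  by apply: contraTneq sn1 => /sl ->; rewrite ltxx.
have [d11 lab] := label3 nsF mx' m'x' n1x d1.
exists n1; first by split=> //; case: n1x.
by move=> m'' h; apply: lab; apply: keep => //; exact/sl/col.
Qed.

End TropicalPolynomials.

Lemma sum_three (T : eqType) (V : zmodType) (l : seq T) (f : T -> V) m0 m1 m2 :
  uniq l -> m0 \in l -> m1 \in l -> m0 != m1 -> m0 != m2 -> m1 != m2 ->
  {in l, forall m, m != m0 -> m != m1 -> m != m2 -> f m = 0} ->
  \sum_(m <- l) f m = f m0 + f m1 + (if m2 \in l then f m2 else 0).
Proof.
move=> ul m0l m1l n01 n02 n12 f0.
rewrite (big_rem m0)//= (big_rem m1)/=; last by rewrite mem_rem_uniq// inE eq_sym n01.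
rewrite addrA; congr (_ + _); case: ifPn => m2l.
  rewrite (big_rem m2)/=; last first.
    by rewrite mem_rem_uniq ?rem_uniq// inE eq_sym n12 mem_rem_uniq// inE eq_sym n02.
  rewrite big_seq big1 ?addr0// => m.
  rewrite mem_rem_uniq ?rem_uniq// inE mem_rem_uniq ?rem_uniq// inE mem_rem_uniq// inE.
  by move=> /andP[? /andP[? /andP[? ?]]]; exact: f0.
rewrite big_seq big1// => m.
rewrite mem_rem_uniq ?rem_uniq// inE mem_rem_uniq// inE.
move=> /andP[? /andP[? ml]]; apply: f0 => //.
by apply: contraNneq m2l => <-.
Qed.

Lemma expfz_monomial (L : fieldType) (w z : L) (a b c d : nat) :
  w != 0 -> z != 0 ->
  w ^+ a * z ^+ b = w ^+ c * z ^+ d * (w ^ (a%:Z - c%:Z) * z ^ (b%:Z - d%:Z)).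
Proof.
move=> w0 z0; rewrite mulrACA !exprnP -!expfzDr//.
by rewrite (addrC (Posz c)) (addrC (Posz d)) !subrK.
Qed.

(** * Points of Trop(X) above a tropical curve *)

Section TropicalCurvePoints.
Variable R : realType.
Local Notation K := (puiseux R).
Local Notation C := (R[i]).
Local Notation exponent := (multinom 2).
Local Notation i0 := (@ord0 1).
Local Notation i1 := (@ord_max 1).
Implicit Types (P : mpoly 2 K) (q : K * K) (x : R * R) (m n : exponent).

Definition term P q m : K := mcoeff m P * (q.1 ^+ m i0 * q.2 ^+ m i1).

Lemma prod_affine_pt q m : \prod_(i < 2) affine_pt q i ^+ m i = q.1 ^+ m i0 * q.2 ^+ m i1.
Proof.
rewrite big_ord_recl big_ord1 /affine_pt /=; congr (_ * _ ^+ m _).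
exact: val_inj.
Qed.

Lemma meval_terms P q : meval (affine_pt q) P = \sum_(m <- msupp P) term P q m.
Proof. by rewrite mevalE; apply: eq_bigr => m _; rewrite prod_affine_pt. Qed.

Lemma term_veq P q m : q.1 != 0 -> q.2 != 0 -> m \in msupp P ->
  veq (term P q m) (monomial_value (tropicalize P) m (Val q)).
Proof.
move=> q1 q2 mP; rewrite /term /monomial_value /= -addrA.
apply: veqM; first by apply: valuation_veq; rewrite -mcoeff_msupp.
by rewrite !mulr_natl; apply: veqM; apply: veqX; exact: valuation_veq.
Qed.

Lemma Trop_two P x m : Trop (curve P) x -> maximizers (tropicalize P) x m ->
  exists2 n, maximizers (tropicalize P) x n & n != m.
Proof.
move=> [q [q1 q2]]; rewrite meval_terms => S0 <- mx; apply: contrapT => h.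
have mP : m \in msupp P by case: mx.
apply: (no_dominant (msupp_uniq P) mP (term_veq q1 q2 mP)) S0 => n nP nm.
have [nl _] := term_veq q1 q2 nP; apply: vle_lt nl _.
by apply: maximizers_lt mx nP _ => nx; apply: h; exists n.
Qed.

(** The matrix of exponents has an integral inverse, which gives w as monomials in y and z. *)
Lemma unimodular_torus (L : fieldType) (a1 a2 b1 b2 : int) (y z : L) : `|a1 * b2 - a2 * b1| = 1 ->
  y != 0 -> z != 0 -> exists w : L * L,
    [/\ w.1 != 0, w.2 != 0, w.1 ^ a1 * w.2 ^ a2 = y & w.1 ^ b1 * w.2 ^ b2 = z].
Proof.
move=> D1 y0 z0; set D := a1 * b2 - a2 * b1 in D1.
have DD : D * D = 1 by case: (lerP 0 D) D1 => _ h; nia.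
exists (y ^ (D * b2) * z ^ (- (D * a2)), y ^ (- (D * b1)) * z ^ (D * a1)) => /=.
have u (c : L) e : c != 0 -> c ^ e != 0 by move=> c0; exact: expfz_neq0.
split; rewrite ?mulf_neq0 ?u//.
- rewrite !expfzMl.
  rewrite !exprz_exp mulrACA -!expfzDr//.
  have -> : D * b2 * a1 + - (D * b1) * a2 = 1 by rewrite -DD {3}/D; ring.
  have -> : - (D * a2) * a1 + D * a1 * a2 = 0 by ring.
  by rewrite expr1z expr0z mulr1.
- rewrite !expfzMl.
  rewrite !exprz_exp mulrACA -!expfzDr//.
  have -> : D * b2 * b1 + - (D * b1) * b2 = 0 by ring.
  have -> : - (D * a2) * b1 + D * a1 * b2 = 1 by rewrite -DD {3}/D; ring.
  by rewrite expr1z expr0z mul1r.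
Qed.

(** The case c2 = 0 occurs inside an edge: y is then determined and z is free. *)
Lemma trinomial_root (c0 c1 c2 : C) : c0 != 0 -> c1 != 0 ->
  exists y z : C, [/\ y != 0, z != 0 & c0 + c1 * y + c2 * z = 0].
Proof.
move=> c00 c10; have [->|c20] := eqVneq c2 0.
  exists (- c0 / c1), 1; rewrite mulf_neq0 ?oppr_eq0 ?invr_eq0 ?oner_neq0//.
  by split => //; rewrite mul0r addr0 mulrC divfK// subrr.
have [y [y0 hy]] : exists y : C, y != 0 /\ c0 + c1 * y != 0.
  have [h|h] := eqVneq (c0 + c1) 0; last by exists 1; rewrite mulr1 oner_neq0.
  exists 2; rewrite pnatr_eq0; split => //.
  by rewrite mulr_natr mulr2n addrA h add0r.
exists y, (- (c0 + c1 * y) / c2); split=> //.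
  by rewrite mulf_neq0 ?oppr_eq0 ?invr_eq0.
by rewrite [c2 * _]mulrC divfK// subrr.
Qed.

(** The reduction of P at x involves m0, m1 and possibly m2. By unimodularity it becomes c0 + c1 y +
    c2 z in suitable coordinates of the torus; this has a root there and is smooth at it, so one of
    the two variables can be corrected by Hensel's lemma. *)
Lemma tropical_lift P x m0 m1 m2 :
  let F := tropicalize P in
  maximizers F x m0 -> maximizers F x m1 -> `|edet m0 m1 m2| = 1 ->
  (forall m, maximizers F x m -> [\/ m = m0, m = m1 | m = m2]) ->
  Trop (curve P) x.
Proof.
move=> F h0 h1 d1 lab.
pose t1 : K := pmonom 1 (- x.1); pose t2 : K := pmonom 1 (- x.2).
have t1x : veq t1 x.1 by rewrite -[x.1]opprK; apply: veq_monom; rewrite oner_neq0.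
have t2x : veq t2 x.2 by rewrite -[x.2]opprK; apply: veq_monom; rewrite oner_neq0.
(* The factor [tM] moves the maximum to 0, so that the reduction consists of the coefficients at
   exponent 0. *)
pose M := monomial_value F m0 x; pose tM : K := pmonom 1 M.
have tMx : veq tM (- M) by apply: veq_monom; rewrite oner_neq0.
pose b m := tM * term P (t1, t2) m.
have bv m : m \in msupp P -> veq (b m) (monomial_value F m x - M).
  move=> mP; rewrite addrC; apply: veqM => //.
  have := @term_veq P (t1, t2) m (veq_neq0 t1x) (veq_neq0 t2x) mP.
  suff -> : Val (t1, t2) = x by [].
  by rewrite /Val /= (veq_valuation t1x) (veq_valuation t2x) /=; case: (x).
have b0 : {in msupp P, forall m, vle (b m) 0}.
  move=> m mP; have [bl _] := bv m mP; apply: vle_le bl _.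
  by rewrite subr_le0; case: h0 => _; exact.
have bmax m : maximizers F x m -> b m 0 != 0.
  move=> mx; have [_] := bv m mx.1.
  by rewrite /M (maximizers_eq h0 mx) subrr oppr0.
have bnmax m : m \in msupp P -> ~ maximizers F x m -> b m 0 = 0.
  move=> mP nmx; have [bl _] := bv m mP; apply: bl.
  by rewrite oppr_gt0 subr_lt0; apply: maximizers_lt.
have [n01 n02 n12] : [/\ m0 != m1, m0 != m2 & m1 != m2].
  by apply: edet_neq; rewrite -normr_eq0 d1 oner_neq0.
pose c2 : C := if m2 \in msupp P then b m2 0 else 0.
have sumE (G : exponent -> C) : \sum_(m <- msupp P) b m 0 * G m =
    b m0 0 * G m0 + b m1 0 * G m1 + c2 * G m2.
  rewrite (sum_three (msupp_uniq P) h0.1 h1.1 n01 n02 n12).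
    by congr (_ + _); rewrite /c2; case: ifP; rewrite ?mul0r.
  move=> m mP /eqP mm0 /eqP mm1 /eqP mm2.
  by rewrite bnmax ?mul0r// => /lab[].
have [y [z [y0 z0 yz]]] := trinomial_root c2 (bmax _ h0) (bmax _ h1).
pose a1 := (m1 i0)%:Z - (m0 i0)%:Z; pose a2 := (m1 i1)%:Z - (m0 i1)%:Z.
pose b1 := (m2 i0)%:Z - (m0 i0)%:Z; pose b2 := (m2 i1)%:Z - (m0 i1)%:Z.
have D1 : `|a1 * b2 - a2 * b1| = 1 by rewrite -d1.
have [w [w1 w2 wy wz]] := unimodular_torus D1 y0 z0.
pose mon m : C := w.1 ^+ m i0 * w.2 ^+ m i1.
have monE m : mon m = mon m0 *
    (w.1 ^ ((m i0)%:Z - (m0 i0)%:Z) * w.2 ^ ((m i1)%:Z - (m0 i1)%:Z)).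
  exact: expfz_monomial.
have mon0 : mon m0 != 0 by rewrite mulf_neq0// expf_neq0.
have mon1 : mon m1 = mon m0 * y by rewrite monE wy.
have mon2 : mon m2 = mon m0 * z by rewrite monE wz.
have S0 : \sum_(m <- msupp P) b m 0 * mon m = 0.
  rewrite sumE mon1 mon2 -[RHS](mulr0 (mon m0)) -yz; ring.
pose T1 := b m1 0 * mon m1; pose T2 := c2 * mon m2.
have T10 : T1 != 0 by rewrite mulf_neq0 ?bmax// mon1 mulf_neq0.
have derE (f : exponent -> nat) : \sum_(m <- msupp P) b m 0 * mon m * (f m)%:R =
    T1 * ((f m1)%:Z - (f m0)%:Z)%:~R + T2 * ((f m2)%:Z - (f m0)%:Z)%:~R.
  under eq_bigr do rewrite -mulrA.
  have -> : T1 * ((f m1)%:Z - (f m0)%:Z)%:~R + T2 * ((f m2)%:Z - (f m0)%:Z)%:~R =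
      - (T1 + T2) * (f m0)%:R + T1 * (f m1)%:R + T2 * (f m2)%:R.
    by rewrite !rmorphB /= -!pmulrn; ring.
  have mA (c : C) m (k : C) : c * (mon m * k) = c * mon m * k by exact: mulrA.
  rewrite sumE /T1 /T2 !mA; congr (_ * _ + _ + _).
  by apply/eqP; rewrite -addr_eq0; move: S0; rewrite sumE addrA => ->.
have liftP (e1 e2 : K) : veq e1 0 -> veq e2 0 ->
    \sum_(m <- msupp P) b m * (e1 ^+ m i0 * e2 ^+ m i1) = 0 -> Trop (curve P) x.
  move=> e10 e20 h.
  have q1 : veq (t1 * e1) x.1 by apply: veqM_to t1x e10 _; rewrite addr0.
  have q2 : veq (t2 * e2) x.2 by apply: veqM_to t2x e20 _; rewrite addr0.
  exists (t1 * e1, t2 * e2).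
    split; [exact: veq_neq0 q1|exact: veq_neq0 q2|].
    rewrite meval_terms; apply: (@mulfI _ tM); first exact: veq_neq0 tMx.
    rewrite mulr0 -[RHS]h mulr_sumr; apply: eq_bigr => m _.
    by rewrite /b /term /= !exprMn; ring.
  by rewrite /Val /= (veq_valuation q1) (veq_valuation q2) /=; case: (x).
have [der1|der1] := eqVneq (\sum_(m <- msupp P) b m 0 * mon m * (m i0)%:R) 0; last first.
  have [||||y1 y10 hy1] := @hensel_root R _ (msupp P) b (fun m => m i0) (fun m => m i1) w.1 w.2.
  - by [].
  - by [].
  - by rewrite -[RHS]S0; apply: eq_bigr => m _; rewrite /mon [w.1 ^+ _ * _]mulrC.
  - by under eq_bigr do rewrite [w.2 ^+ _ * _]mulrC.
  apply: (liftP y1 (pmonom w.2 0)) => //; first exact: pcst_veq.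
  by rewrite -[RHS]hy1; apply: eq_bigr => m _; rewrite [y1 ^+ _ * _]mulrC.
have [der2|der2] := eqVneq (\sum_(m <- msupp P) b m 0 * mon m * (m i1)%:R) 0; last first.
  have [||||y1 y10 hy1] := @hensel_root R _ (msupp P) b (fun m => m i1) (fun m => m i0) w.2 w.1 => //.
  by apply: (liftP (pmonom w.1 0) y1) => //; exact: pcst_veq.
(* If both logarithmic derivatives vanished, eliminating T2 would leave T1 times the determinant,
   which is nonzero. *)
exfalso; move: der1 der2; rewrite !derE -/a1 -/a2 -/b1 -/b2 => der1 der2.
have : T1 * (a1 * b2 - a2 * b1)%:~R = 0.
  have -> : T1 * (a1 * b2 - a2 * b1)%:~R =
    b2%:~R * (T1 * a1%:~R + T2 * b1%:~R) - b1%:~R * (T1 * a2%:~R + T2 * b2%:~R).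
    by rewrite rmorphB !rmorphM /=; ring.
  by rewrite der1 der2 !mulr0 subrr.
apply/eqP; rewrite mulf_neq0// intr_eq0 -normr_eq0 D1//.
Qed.

End TropicalCurvePoints.

(** * Relations at an inflection point *)

Section Homogeneous.
Implicit Types k i j : 'I_3.

(* The components of a vector of sum 0 whose components 1 and 2 are a and b. *)
Definition homog (V : zmodType) (a b : V) k : V :=
  match val k with 0%N => - (a + b) | 1%N => a | _ => b end.

Lemma homog_sum (V : zmodType) (a b : V) k i j : uniq [:: k; i; j] ->
  homog a b k + homog a b i + homog a b j = 0.
Proof.
case: k => [[|[|[|//]]] hk]; case: i => [[|[|[|//]]] hi]//;
  case: j => [[|[|[|//]]] hj]// _; rewrite /homog /=.
- by rewrite -addrA addNr.
- by rewrite -addrA [b + a]addrC addNr.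
- by rewrite opprD addrA subrr add0r addNr.
- by rewrite subrr.
- by rewrite opprD addrCA subrr addr0 addNr.
- by rewrite [b + a]addrC subrr.
Qed.

(** The cross product of two vectors of sum 0 is a multiple of (1, 1, 1), so all minors agree up to
    sign. *)
Lemma homog_cross (S : comPzRingType) (a b c d : S) k i : k != i ->
  homog a b k * homog c d i - homog a b i * homog c d k = a * d - b * c \/
  homog a b k * homog c d i - homog a b i * homog c d k = - (a * d - b * c).
Proof.
case: k => [[|[|[|//]]] hk]; case: i => [[|[|[|//]]] hi]// _; rewrite /homog /=;
  by [left; ring|right; ring].
Qed.

(** Both sides are minus the product of the three components. *)
Lemma homog_prod (S : comPzRingType) (a b : S) k i : k != i ->
  homog a b k * homog a b i * (homog a b k + homog a b i) = a * b * (a + b).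
Proof.
by case: k => [[|[|[|//]]] hk]; case: i => [[|[|[|//]]] hi]// _; rewrite /homog /=; ring.
Qed.

Lemma ord3_pick k : exists i j, uniq [:: k; i; j].
Proof.
case: k => [[|[|[|//]]] hk].
- by exists (inord 1), (inord 2); rewrite /= !inE -!val_eqE /= !inordK.
- by exists (inord 2), ord0; rewrite /= !inE -!val_eqE /= !inordK.
- by exists ord0, (inord 1); rewrite /= !inE -!val_eqE /= !inordK.
Qed.

Lemma ord3_cases k i j l : uniq [:: k; i; j] -> [\/ l = k, l = i | l = j].
Proof.
move=> u.
suff : (l == k) || ((l == i) || (l == j)).
  by case/or3P => /eqP ->; [constructor 1|constructor 2|constructor 3].
by move: u; case: k => [[|[|[|//]]] hk]; case: i => [[|[|[|//]]] hi]//;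
  case: j => [[|[|[|//]]] hj]//; case: l => [[|[|[|//]]] hl].
Qed.

End Homogeneous.

Section Rays.
Local Notation exponent := (multinom 2).
Local Notation i0 := (@ord0 1).
Local Notation i1 := (@ord_max 1).
Implicit Types (m n : exponent) (k i j : 'I_3).

(* The 0-th variable is the one that homogenizes; the k-th ray of a tropical line
   points towards small values of the k-th homogeneous variable. *)
Definition hc k m : int := homog (m i0)%:Z (m i1)%:Z k.

Definition ray_dir (R : realType) k : R * R :=
  match val k with 0%N => (1, 1) | 1%N => (-1, 0) | _ => (0, -1) end.

Lemma slope_ray (R : realType) k m : slope (ray_dir R k) m = - (hc k m)%:~R.
Proof.
case: k => [[|[|[|//]]] hk]; rewrite /slope /hc /homog /ray_dir /=.
- by rewrite !mulr1 !rmorphN !rmorphD /= opprK.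
- by rewrite mulrN1 mulr0 addr0.
- by rewrite mulrN1 mulr0 add0r.
Qed.

(** Any two of the three homogeneous exponents are unimodular coordinates on the lattice. *)
Lemma edet_hc k i m0 m1 m2 : k != i ->
  `|(hc k m1 - hc k m0) * (hc i m2 - hc i m0) -
    (hc i m1 - hc i m0) * (hc k m2 - hc k m0)| = `|edet m0 m1 m2|.
Proof.
move=> ki; have E l m : hc l m - hc l m0 =
    homog ((m i0)%:Z - (m0 i0)%:Z) ((m i1)%:Z - (m0 i1)%:Z) l.
  by case: l => [[|[|[|//]]] hl]; rewrite /hc /homog /=; ring.
rewrite !E /edet /idet /=.
by have [->|->] := homog_cross ((m1 i0)%:Z - (m0 i0)%:Z) ((m1 i1)%:Z - (m0 i1)%:Z)
  ((m2 i0)%:Z - (m0 i0)%:Z) ((m2 i1)%:Z - (m0 i1)%:Z) ki; rewrite ?normrN.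
Qed.

Lemma hc_inj k i m n : k != i -> hc k m = hc k n -> hc i m = hc i n -> m = n.
Proof.
move=> ki hk hi; apply: zexp_inj; move: ki hk hi.
case: k => [[|[|[|//]]] hk]; case: i => [[|[|[|//]]] hi]// _;
  rewrite /hc /homog /zexp /= => h1 h2; congr (_, _); lia.
Qed.

End Rays.

Section InflectionRelations.
Variable L : fieldType.
Local Notation exponent := (multinom 2).
Local Notation i0 := (@ord0 1).
Local Notation i1 := (@ord_max 1).
Implicit Types (k i j : 'I_3) (m b : exponent).

Lemma hc_homog k m : (hc k m)%:~R = homog (m i0)%:R (m i1)%:R k :> L.
Proof.
by case: k => [[|[|[|//]]] hk]; rewrite /hc /homog /= ?rmorphN ?rmorphD.
Qed.

Variables (l : seq exponent) (t : exponent -> L) (X1 X2 : L).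
Hypothesis t_sum : \sum_(m <- l) t m = 0.
Hypothesis t_X1 : \sum_(m <- l) t m * (m i0)%:R = X1.
Hypothesis t_X2 : \sum_(m <- l) t m * (m i1)%:R = X2.
Hypothesis t_second :
  \sum_(m <- l) t m * ((m i0)%:R * X2 - (m i1)%:R * X1) ^+ 2 = X1 * X2 * (X1 + X2).
Let X := homog X1 X2.

Lemma sum_hc k : \sum_(m <- l) t m * (hc k m)%:~R = X k.
Proof.
under eq_bigr do rewrite hc_homog.
case: k => [[|[|[|//]]] hk]; rewrite /X /homog /= ?t_X1 ?t_X2//.
under eq_bigr do rewrite mulrN mulrDr.
by rewrite sumrN big_split /= t_X1 t_X2.
Qed.

Let h k b m : L := (hc k m - hc k b)%:~R.

Lemma sum_shift k b : \sum_(m <- l) t m * h k b m = X k.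
Proof.
rewrite /h; under eq_bigr do rewrite rmorphB mulrBr.
by rewrite sumrB -mulr_suml t_sum mul0r subr0 sum_hc.
Qed.

Lemma first_relation k i b : X i != 0 ->
  \sum_(m <- l) t m * (h k b m - h i b m * (X k / X i)) = 0.
Proof.
move=> Xi; under eq_bigr => m _ do rewrite mulrBr (mulrA (t m)).
by rewrite sumrB -mulr_suml !sum_shift mulrC divfK// subrr.
Qed.

(** With D(m) = h X_i - g X_k, the Hessian relation reads sum t_m D(m)^2 = X_k X_i (X_k + X_i). As
    the sums of t_m and of t_m D(m) vanish, D may be shifted by D(b); the terms linear in h and g,
    whose sums are X_k and X_i, then absorb the right-hand side. *)
Lemma second_relation k i b : k != i -> X i != 0 ->
  \sum_(m <- l) t m * (h k b m * (h k b m - 1) - 2 * h k b m * h i b m * (X k / X i)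
     + h i b m * (h i b m - 1) * (X k / X i) ^+ 2) = 0.
Proof.
move=> ki Xi; apply: (@mulfI _ (X i ^+ 2)); first by rewrite expf_neq0.
rewrite mulr0 mulr_sumr.
pose D m := (hc k m)%:~R * X i - (hc i m)%:~R * X k.
have sD : \sum_(m <- l) t m * D m = 0.
  rewrite /D; under eq_bigr => m _ do rewrite mulrBr !(mulrA (t m)).
  by rewrite sumrB -!mulr_suml !sum_hc mulrC subrr.
have sDD : \sum_(m <- l) t m * D m ^+ 2 = X k * X i * (X k + X i).
  rewrite homog_prod//.
  rewrite -t_second; apply: eq_bigr => m _; congr (_ * _).
  rewrite /D !hc_homog /X.
  by have [->|->] := homog_cross (m i0)%:R (m i1)%:R X1 X2 ki; rewrite ?sqrrN.
have E m : X i ^+ 2 * (t m * (h k b m * (h k b m - 1) -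
    2 * h k b m * h i b m * (X k / X i) + h i b m * (h i b m - 1) * (X k / X i) ^+ 2)) =
  t m * D m ^+ 2 - t m * D m * (2 * D b) + t m * D b ^+ 2 -
  t m * h k b m * X i ^+ 2 - t m * h i b m * X k ^+ 2.
  by rewrite /D /h !rmorphB /=; field.
under eq_bigr do rewrite E.
rewrite !sumrB big_split /= sumrB -!mulr_suml sD sDD t_sum !sum_shift; ring.
Qed.

(** If all exponents lie on a line, the linear relations force h = g rho. The quadratic terms of the
    second relation then cancel, and it becomes -(1 + rho) X_k = 0. *)
Lemma collinear_absurd k i b (a a' : L) : k != i -> X k != 0 -> X i != 0 ->
  1 + X k / X i != 0 -> a != 0 ->
  {in l, forall m, a * h i b m = a' * h k b m} -> False.
Proof.
move=> ki Xk Xi Xki a0 col.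
have aX : a * X i = a' * X k.
  rewrite -(sum_shift i b) -(sum_shift k b) !mulr_sumr big_seq [RHS]big_seq.
  by apply: eq_bigr => m ml; rewrite mulrCA col// mulrCA.
have hg m : m \in l -> h k b m = h i b m * (X k / X i).
  move=> ml; have a'0 : a' != 0.
    by apply: contra_neq Xi => a'0; apply: (mulfI a0); rewrite aX a'0 mul0r mulr0.
  apply: (mulfI a'0); rewrite -col//.
  rewrite [RHS](_ : _ = h i b m * (a' * X k) / X i); last by ring.
  by rewrite -aX mulrA mulfK// mulrC.
have := second_relation b ki Xi; rewrite big_seq.
under eq_bigr => m ml.
  have -> : h k b m * (h k b m - 1) - 2 * h k b m * h i b m * (X k / X i)
     + h i b m * (h i b m - 1) * (X k / X i) ^+ 2 = - (1 + X k / X i) * h k b m.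
    by rewrite (hg m ml); ring.
  rewrite mulrCA; over.
rewrite -big_seq -mulr_sumr sum_shift => /eqP.
by rewrite mulf_eq0 oppr_eq0 (negPf Xki) (negPf Xk).
Qed.

End InflectionRelations.

(** * The Hessian in logarithmic coordinates *)

Section Monomials.
Variables (n : nat) (L : comNzRingType).
Implicit Types (m : multinom n) (v : 'I_n -> L) (i j : 'I_n).

(** Multiplying by the coordinate makes the derivative diagonal on monomials, without lowering
    exponents. *)
Lemma meval_mderivX v i m :
  v i * meval v (mderiv i (mpolyX L m)) = (m i)%:R * \prod_k v k ^+ m k.
Proof.
rewrite mderivX mevalZ mevalX mulrCA.
case mi: (m i) => [|e]; first by rewrite !mul0r.
congr (_ * _); rewrite [in RHS](bigD1 i)//= (bigD1 i)//= mulrA.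
congr (_ * _); first by rewrite mnmBE mnm1E eqxx mi subn1 /= -exprS.
by apply: eq_bigr => k ki; rewrite mnmBE mnm1E eq_sym (negPf ki) subn0.
Qed.

Lemma meval_mderiv2X v i j m :
  v i * (v j * meval v (mderiv i (mderiv j (mpolyX L m)))) =
  (m j)%:R * ((m i)%:R - (i == j)%:R) * \prod_k v k ^+ m k.
Proof.
rewrite mderivX mderivZ mevalZ.
rewrite [v j * _]mulrCA [LHS]mulrCA -[RHS]mulrA.
rewrite [v i * _]mulrCA meval_mderivX.
case mj: (m j) => [|e]; first by rewrite !mul0r.
congr (_ * _); rewrite [LHS]mulrCA mnmBE mnm1E.
rewrite [X in _ * X](_ : _ = \prod_k v k ^+ m k); last first.
  rewrite [in RHS](bigD1 j)//= (bigD1 j)//= mulrA.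
  congr (_ * _); first by rewrite mnmBE mnm1E eqxx mj subn1 /= -exprS.
  by apply: eq_bigr => k kj; rewrite mnmBE mnm1E eq_sym (negPf kj) subn0.
congr (_ * _); rewrite eq_sym; have [->|_] := eqVneq i j.
  by rewrite mj subn1 /= -[e.+1%:R]natr1 addrK.
by rewrite subn0 subr0.
Qed.

End Monomials.

Lemma det_mx3 (L : comNzRingType) (f : nat -> nat -> L) :
  \det (\matrix_(i < 3, j < 3) f i j) =
    f 0 0 * (f 1 1 * f 2 2 - f 1 2 * f 2 1) -
    f 0 1 * (f 1 0 * f 2 2 - f 1 2 * f 2 0) +
    f 0 2 * (f 1 0 * f 2 1 - f 1 1 * f 2 0).
Proof.
rewrite (expand_det_row _ ord0) !big_ord_recl big_ord0 addr0 /cofactor.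
rewrite !(expand_det_row _ (@ord0 1)) !big_ord_recl !big_ord0 /cofactor !det_mx11.
by rewrite !mxE /= /bump /=; ring.
Qed.

(* In coordinates scaled by the point, Euler's relations express the last row and
   column of the Hessian matrix through the first two. *)
Lemma hessian_identity (L : comNzRingType) (q1 q2 d a b c x y : L)
    (f00 f01 f02 f10 f11 f12 f20 f21 f22 : L) :
  q1 * (q1 * f00) = a - x -> q1 * (q2 * f01) = b -> q1 * f02 = d * x - a - b ->
  q2 * (q1 * f10) = b -> q2 * (q2 * f11) = c - y -> q2 * f12 = d * y - b - c ->
  q1 * f20 = d * x - a - b -> q2 * f21 = d * y - b - c ->
  f22 = (1 - 2 * d) * (x + y) + a + 2 * b + c ->
  f00 * (f11 * f22 - f12 * f21) - f01 * (f10 * f22 - f12 * f20) +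
    f02 * (f10 * f21 - f11 * f20) = 0 ->
  (d - 1) ^+ 2 * ((a - x) * y ^+ 2 - 2 * b * x * y + (c - y) * x ^+ 2) = 0.
Proof.
move=> h00 h01 h02 h10 h11 h12 h20 h21 h22 D0.
apply/eqP; rewrite -oppr_eq0; apply/eqP.
transitivity ((q1 * (q1 * f00)) * ((q2 * (q2 * f11)) * f22 - (q2 * f12) * (q2 * f21)) -
    (q1 * (q2 * f01)) * ((q2 * (q1 * f10)) * f22 - (q2 * f12) * (q1 * f20)) +
    (q1 * f02) * ((q2 * (q1 * f10)) * (q2 * f21) - (q2 * (q2 * f11)) * (q1 * f20))).
  by rewrite h00 h01 h02 h10 h11 h12 h20 h21 h22; ring.
by rewrite -[RHS](mulr0 (q1 ^+ 2 * q2 ^+ 2)) -D0; ring.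
Qed.

Section InflectionPoint.
Variable R : realType.
Local Notation K := (puiseux R).
Local Notation exponent := (multinom 2).
Local Notation i0 := (@ord0 1).
Local Notation i1 := (@ord_max 1).
Variables (P : mpoly 2 K) (q : K * K).
Let t m := term P q m.

Lemma meval_mderiv i : affine_pt q i * meval (affine_pt q) (mderiv i P) =
  \sum_(m <- msupp P) t m * (m i)%:R.
Proof.
rewrite {1}/mderiv raddf_sum mulr_sumr; apply: eq_bigr => m _ /=.
rewrite [(m i)%:R * _]mulrC -scalerA -mderivX mevalZ mulrCA meval_mderivX prod_affine_pt.
by rewrite /t /term [(m i)%:R * _]mulrC mulrA.
Qed.

Definition tangent_X1 := q.1 * meval (affine_pt q) (mderiv i0 P).
Definition tangent_X2 := q.2 * meval (affine_pt q) (mderiv i1 P).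

Lemma tangent_X1E : \sum_(m <- msupp P) t m * (m i0)%:R = tangent_X1.
Proof. by rewrite -meval_mderiv. Qed.

Lemma tangent_X2E : \sum_(m <- msupp P) t m * (m i1)%:R = tangent_X2.
Proof. by rewrite -meval_mderiv. Qed.

Lemma meval_homogenization :
  meval (projective_pt q) (homogenization P) = \sum_(m <- msupp P) t m.
Proof.
rewrite /homogenization raddf_sum /=; apply: eq_bigr => m _.
rewrite mevalZ mevalX; congr (_ * _).
rewrite !big_ord_recr big_ord0 /= mul1r /projective_pt /= expr1n mulr1.
by [].
Qed.

Let d := (mpoly.msize P).-1.
Let ev (n : nat) m : K :=
  match n with 0 => (m i0)%:R | 1 => (m i1)%:R | _ => d%:R - (m i0)%:R - (m i1)%:R end.

Lemma degree_le m : m \in msupp P -> (m i0 + m i1 <= d)%N.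
Proof.
move=> mP; have := msize_mdeg_lt mP.
rewrite mdegE big_ord_recl big_ord1 /d.
have -> : lift ord0 ord0 = i1 by apply: val_inj.
by case: (mpoly.msize P).
Qed.

(** The exponent of the homogenizing variable is a truncated subtraction; [degree_le] turns it into
    the true d - m_0 - m_1. *)
Lemma hessian_entry (i j : nat) : (i < 3)%N -> (j < 3)%N ->
  projective_pt q (inord i) * (projective_pt q (inord j) * meval (projective_pt q)
    (mderiv (inord i) (mderiv (inord j) (homogenization P)))) =
  \sum_(m <- msupp P) t m * (ev j m * (ev i m - (i == j)%:R)).
Proof.
move=> i3 j3; rewrite /homogenization.
rewrite [mderiv (inord j) _]raddf_sum [mderiv (inord i) _]raddf_sum raddf_sum.
rewrite !mulr_sumr big_seq [RHS]big_seq; apply: eq_bigr => m mP /=.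
rewrite !mderivZ mevalZ [projective_pt q (inord j) * _]mulrCA [LHS]mulrCA.
rewrite (meval_mderiv2X (projective_pt q) (inord i) (inord j)) /t /term.
set mh := Multinom _.
have eE n : (n < 3)%N -> (mh (inord n))%:R = ev n m.
  have dm := degree_le mP.
  case: n => [|[|[|//]]] _; rewrite /mh /fun_of_multinom /tnth /= inordK//=.
  by rewrite -/d natrB// natrD opprD addrA.
have -> : \prod_(k < 3) projective_pt q k ^+ mh k = q.1 ^+ m i0 * q.2 ^+ m i1.
  rewrite !big_ord_recr big_ord0 /= mul1r /projective_pt /= expr1n mulr1.
  by [].
rewrite !eE// -[inord i == inord j]val_eqE /= !inordK//.
by rewrite -[RHS]mulrA; congr (_ * _); exact: mulrC.
Qed.

(** Eliminating the homogenizing variable by Euler's relations produces the factor (d - 1)^2, which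
    can be cancelled in characteristic 0 because d is not 1. *)
Lemma inflection_second : q.1 != 0 -> q.2 != 0 -> d != 1%N ->
  inflection_point P q ->
  \sum_(m <- msupp P) t m * ((m i0)%:R * tangent_X2 - (m i1)%:R * tangent_X1) ^+ 2 =
  tangent_X1 * tangent_X2 * (tangent_X1 + tangent_X2).
Proof.
move=> q1 q2 d1 [_ _]; rewrite meval_homogenization => S0.
rewrite /hessian -det_map_mx.
pose f (i j : nat) := meval (projective_pt q)
  (mderiv (inord i) (mderiv (inord j) (homogenization P))).
have -> : map_mx (meval (projective_pt q)) (\matrix_(i, j)
    mderiv i (mderiv j (homogenization P))) = \matrix_(i < 3, j < 3) f i j.
  by apply/matrixP => i j; rewrite !mxE /f !inord_val.
rewrite det_mx3 => D0.
pose a := \sum_(m <- msupp P) t m * ((m i0)%:R * (m i0)%:R).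
pose b := \sum_(m <- msupp P) t m * ((m i0)%:R * (m i1)%:R).
pose c := \sum_(m <- msupp P) t m * ((m i1)%:R * (m i1)%:R).
set X1 := tangent_X1; set X2 := tangent_X2.
(* Any quadratic polynomial in the exponents sums to a combination of the moments [X1], [X2], [a],
   [b], [c]; its constant term drops out since the terms of P sum to 0. *)
have lin (x x1 x2 x3 x4 x5 : K) (F : exponent -> K) :
    (forall m, F m = x + x1 * (m i0)%:R + x2 * (m i1)%:R + x3 * ((m i0)%:R * (m i0)%:R)
      + x4 * ((m i0)%:R * (m i1)%:R) + x5 * ((m i1)%:R * (m i1)%:R)) ->
    \sum_(m <- msupp P) t m * F m = x1 * X1 + x2 * X2 + x3 * a + x4 * b + x5 * c.
  move=> FE; under eq_bigr do rewrite FE !mulrDr.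
  rewrite !big_split /= -mulr_suml S0 mul0r add0r.
  rewrite /X1 /X2 -tangent_X1E -tangent_X2E /a /b /c !mulr_sumr.
  by congr (_ + _ + _ + _ + _); apply: eq_bigr => m _; rewrite mulrCA.
have p0 : projective_pt q (inord 0) = q.1 by rewrite /projective_pt inordK.
have p1 : projective_pt q (inord 1) = q.2 by rewrite /projective_pt inordK.
have p2 : projective_pt q (inord 2) = 1 by rewrite /projective_pt inordK.
have f00 : q.1 * (q.1 * f 0%N 0%N) = a - X1.
  rewrite -p0 hessian_entry// (lin 0 (-1) 0 1 0 0); first by ring.
  by move=> m; rewrite /ev /=; ring.
have f01 : q.1 * (q.2 * f 0%N 1%N) = b.
  rewrite -p0 -p1 hessian_entry// (lin 0 0 0 0 1 0); first by ring.
  by move=> m; rewrite /ev /=; ring.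
have f10 : q.2 * (q.1 * f 1%N 0%N) = b.
  rewrite -p0 -p1 hessian_entry// (lin 0 0 0 0 1 0); first by ring.
  by move=> m; rewrite /ev /=; ring.
have f11 : q.2 * (q.2 * f 1%N 1%N) = c - X2.
  have := @hessian_entry 1 1 isT isT; rewrite p1 => ->.
  rewrite (lin 0 0 (-1) 0 0 1); first by ring.
  by move=> m; rewrite /ev /=; ring.
have f02 : q.1 * f 0%N 2%N = d%:R * X1 - a - b.
  rewrite -[f _ _]mul1r -{1}p2 -p0 hessian_entry// (lin 0 d%:R 0 (-1) (-1) 0); first by ring.
  by move=> m; rewrite /ev /=; ring.
have f20 : q.1 * f 2%N 0%N = d%:R * X1 - a - b.
  rewrite -[LHS]mul1r -{1}p2 -p0 hessian_entry// (lin 0 d%:R 0 (-1) (-1) 0); first by ring.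
  by move=> m; rewrite /ev /=; ring.
have f12 : q.2 * f 1%N 2%N = d%:R * X2 - b - c.
  rewrite -[f _ _]mul1r -{1}p2 -p1 hessian_entry// (lin 0 0 d%:R 0 (-1) (-1)); first by ring.
  by move=> m; rewrite /ev /=; ring.
have f21 : q.2 * f 2%N 1%N = d%:R * X2 - b - c.
  rewrite -[LHS]mul1r -{1}p2 -p1 hessian_entry// (lin 0 0 d%:R 0 (-1) (-1)); first by ring.
  by move=> m; rewrite /ev /=; ring.
have f22 : f 2%N 2%N = (1 - 2 * d%:R) * (X1 + X2) + a + 2 * b + c.
  rewrite -[LHS]mul1r -[LHS]mul1r -{1 2}p2 hessian_entry//.
  rewrite (lin (d%:R * (d%:R - 1)) (1 - 2 * d%:R) (1 - 2 * d%:R) 1 2 1); first by ring.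
  by move=> m; rewrite /ev /=; ring.
have key := hessian_identity f00 f01 f02 f10 f11 f12 f20 f21 f22 D0.
have d10 : (d%:R - 1 : K) ^+ 2 != 0.
  have -> : (d%:R - 1 : K) = (d%:Z - 1)%:~R by rewrite rmorphB.
  by rewrite expf_neq0// (veq_neq0 (veq_int R _))// subr_eq0.
move/eqP: key; rewrite mulf_eq0 (negPf d10) /= => /eqP key.
rewrite (lin 0 0 0 (X2 ^+ 2) (- 2 * X1 * X2) (X1 ^+ 2)); last by move=> m; ring.
by apply/eqP; rewrite -subr_eq0 -[X in _ == X]key; apply/eqP; ring.
Qed.

End InflectionPoint.

(** * Edges in the directions of a tropical line *)

Section PlaneGeometry.
Variable R : realType.
Implicit Types (D : set (R * R)) (x y v : R * R) (k : 'I_3) (s r : R).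

Lemma convex_hull_not_two_dimensional D (a b c : R) : (a, b) != (0, 0) ->
  D `<=` [set x : R * R | a * x.1 + b * x.2 + c = 0] ->
  ~ two_dimensional (convex_hull D).
Proof.
move=> ab0 /convex_hull_line Dl [x [y [z [/Dl hx /Dl hy /Dl hz]]]].
move/negP; apply; rewrite /det2 /=.
have e1 : a * (y.1 - x.1) + b * (y.2 - x.2) = 0 by lra.
have e2 : a * (z.1 - x.1) + b * (z.2 - x.2) = 0 by lra.
move: (y.1 - x.1) (y.2 - x.2) (z.1 - x.1) (z.2 - x.2) e1 e2 => y1 y2 z1 z2 e1 e2.
have ha : a * (y1 * z2 - y2 * z1) = 0.
  rewrite [LHS](_ : _ = (a * y1 + b * y2) * z2 - (a * z1 + b * z2) * y2); last by ring.
  by rewrite e1 e2 !mul0r subrr.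
have hb : b * (y1 * z2 - y2 * z1) = 0.
  rewrite [LHS](_ : _ = (a * z1 + b * z2) * y1 - (a * y1 + b * y2) * z1); last by ring.
  by rewrite e1 e2 !mul0r subrr.
move/eqP: ha; rewrite mulf_eq0 => /orP[/eqP a0|//].
move/eqP: hb; rewrite mulf_eq0 => /orP[/eqP b0|//].
by move: ab0; rewrite a0 b0 eqxx.
Qed.

Definition ray_dirz k : int * int :=
  match val k with 0%N => (1, 1) | 1%N => (-1, 0) | _ => (0, -1) end.

Lemma lattice_ray_dirz k : lattice_pt R (ray_dirz k) = ray_dir R k.
Proof. by case: k => [[|[|[|//]]] hk]; rewrite /lattice_pt /=. Qed.

Lemma coprime_ray_dirz k : coprimez (ray_dirz k).1 (ray_dirz k).2.
Proof. by case: k => [[|[|[|//]]] hk]. Qed.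

Lemma enorm_ray_neq0 k : enorm (ray_dir R k) != 0.
Proof.
rewrite /enorm gt_eqF// sqrtr_gt0.
by case: k => [[|[|[|//]]] hk]; rewrite /ray_dir /=; lra.
Qed.

Lemma enormZ s x : enorm (s *: x) = `|s| * enorm x.
Proof.
rewrite /enorm /= /GRing.scale /= -sqrtr_sqr -sqrtrM ?sqr_ge0//.
by congr Num.sqrt; ring.
Qed.

(** Such a vector is the ray direction or its opposite. The choice made by [direction] is therefore
    harmless once only its norm is used. *)
Lemma enorm_parallel_ray k (u : int * int) : coprimez u.1 u.2 ->
  det2 (ray_dir R k) (lattice_pt R u) = 0 ->
  enorm (lattice_pt R u) = enorm (ray_dir R k).
Proof.
case: u => a b /= cab.
case: k => [[|[|[|//]]] hk]; rewrite /det2 /ray_dir /lattice_pt /enorm /=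
  ?mul1r ?mulN1r ?mul0r ?subr0 ?sub0r.
- move/eqP; rewrite subr_eq0 eqr_int => /eqP ba; move: cab; rewrite ba.
  rewrite /coprimez /gcdz gcdnn => /eqP [a1].
  have -> : (a%:~R : R) ^+ 2 = 1.
    have [->|->] : a = 1 \/ a = -1 by lia.
      by rewrite expr1n.
    by rewrite rmorphN /= sqrrN expr1n.
  by rewrite expr1n.
- move/eqP; rewrite oppr_eq0 intr_eq0 => /eqP b0; move: cab; rewrite b0.
  rewrite /coprimez /gcdz gcdn0 => /eqP [a1].
  have -> : (a%:~R : R) ^+ 2 = 1.
    have [->|->] : a = 1 \/ a = -1 by lia.
      by rewrite expr1n.
    by rewrite rmorphN /= sqrrN expr1n.
  by rewrite sqrrN expr1n.
- rewrite opprK => /eqP; rewrite intr_eq0 => /eqP a0; move: cab; rewrite a0.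
  rewrite /coprimez /gcdz gcd0n => /eqP [b1].
  have -> : (b%:~R : R) ^+ 2 = 1.
    have [->|->] : b = 1 \/ b = -1 by lia.
      by rewrite expr1n.
    by rewrite rmorphN /= sqrrN expr1n.
  by rewrite sqrrN expr1n.
Qed.

Lemma ray_pt v s k :
  v + s *: ray_dir R k = (v.1 + s * (ray_dir R k).1, v.2 + s * (ray_dir R k).2).
Proof. by []. Qed.

Lemma ray_inj k v s r : v + s *: ray_dir R k = v + r *: ray_dir R k -> s = r.
Proof.
rewrite !ray_pt => -[h1 h2]; move: h1 h2.
by case: k => [[|[|[|//]]] hk]; rewrite /ray_dir /=; lra.
Qed.

End PlaneGeometry.

Section Slopes.
Variable R : realType.
Implicit Types a b s r h : R.

Lemma intr_lt1 (i j : int) : i < j -> i%:~R + 1 <= j%:~R :> R.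
Proof. by move=> ij; rewrite -[1]/(1%:~R) -intrD ler_int; lia. Qed.

Lemma steeper_later a b s r h h' : a - s * h <= b - s * h' ->
  b - r * h' <= a - r * h -> 0 < s -> s < r -> h' + 1 <= h -> False.
Proof. by move=> *; nra. Qed.

Lemma steeper_before a b s h h' : a - s * h <= b - s * h' -> b <= a ->
  0 < s -> h + 1 <= h' -> False.
Proof. by move=> *; nra. Qed.

Lemma steeper_reverse a s h h' : a - s * h' <= a - s * h -> s < 0 ->
  h + 1 <= h' -> False.
Proof. by move=> *; nra. Qed.

Lemma slope_convex a b s r h h' : 0 <= s -> s <= r -> b <= a ->
  b - r * h' <= a - r * h -> b - s * h' <= a - s * h.
Proof. by move=> s0 sr ab; have [|] := leP h h' => *; nra. Qed.

End Slopes.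

(** * The edge dual to a side of a unimodular triangle *)

Section Edges.
Variable R : realType.
Local Notation exponent := (multinom 2).
Variables (F : tropical_poly R) (v : R * R) (k : 'I_3) (m m' n : exponent).
Hypotheses (vm : maximizers F v m) (vm' : maximizers F v m') (vn : maximizers F v n).
Hypotheses (kmm' : hc k m = hc k m') (kmn : hc k m < hc k n).
Hypothesis mm'n : `|edet m m' n| = 1.
Hypothesis lab : forall m0, maximizers F v m0 -> [\/ m0 = m, m0 = m' | m0 = n].

Let x (s : R) : R * R := v + s *: ray_dir R k.
Implicit Types (s r : R) (y : R * R).

Lemma value_ray m0 s :
  monomial_value F m0 (x s) = monomial_value F m0 v - s * (hc k m0)%:~R.
Proof. by rewrite monomial_value_move slope_ray mulrN. Qed.

Lemma edge_along s : maximizers F (x s) m -> maximizers F (x s) m'.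
Proof.
move=> [mF mP]; split; first by case: vm'.
move=> n' /mP; rewrite !value_ray (maximizers_eq vm vm') kmm'.
by rewrite (maximizers_eq vm' vm).
Qed.

(** With a smaller k-th exponent than m, the monomial would exceed m at the parameter r; with a
    larger one, at v. With the same one it is maximal at v too, and it is not n. *)
Lemma edge_interior s r : 0 < s -> s < r -> maximizers F (x r) m ->
  forall m0, maximizers F (x s) m0 -> m0 = m \/ m0 = m'.
Proof.
move=> s0 sr [mF mP] m0 [m0F m0P].
have h1 := m0P m mF; have h2 := mP m0 m0F.
have h3 : monomial_value F m0 v <= monomial_value F m v by case: vm => _; exact.
move: h1 h2; rewrite !value_ray => h1 h2.
have [lt|gt|eq] := ltgtP (hc k m0) (hc k m).
- by case: (steeper_later h1 h2 s0 sr (intr_lt1 R lt)).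
- by case: (steeper_before h1 h3 s0 (intr_lt1 R gt)).
have vm0 : maximizers F v m0.
  split=> // n' n'F; apply: (@le_trans _ _ (monomial_value F m v)).
    by case: vm => _; exact.
  by move: h1; rewrite eq; lra.
case: (lab vm0); [by left|by right|] => m0n.
by move: kmn; rewrite -m0n eq ltxx.
Qed.

(** Since m and m' differ but share the k-th exponent, they agree exactly on the line through v
    along the ray. Behind v the monomial n exceeds them, which leaves s >= 0. *)
Lemma edge_pointP y : maximizers F y m -> maximizers F y m' ->
  exists2 s, 0 <= s & y = x s.
Proof.
move=> ym ym'.
have e0 := maximizers_eq vm vm'; have e1 := maximizers_eq ym ym'.
have [s ys] : exists s : R, y = x s.
  have nmm' : m <> m'.
    have [/eqP h _ _] : [/\ m != m', m != n & m' != n] by apply: edet_neq; rewrite -normr_eq0 mm'n.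
    by [].
  have ninj i : k != i -> (hc i m)%:~R - (hc i m')%:~R != 0 :> R.
    by move=> ki; rewrite subr_eq0 eqr_int; apply/eqP => h; apply: nmm'; exact: (hc_inj ki).
  have kE : (hc k m)%:~R = (hc k m')%:~R :> R by rewrite kmm'.
  suff : exists s : R, y = (v.1 + s * (ray_dir R k).1, v.2 + s * (ray_dir R k).2) by [].
  move: e0 e1 ninj kE; rewrite /monomial_value.
  case: y {ym ym'} => y1 y2; case: (v) => v1 v2 /=.
  case: k => [[|[|[|//]]] hk]; rewrite /ray_dir /hc /homog /=.
  + move=> e0 e1 /(_ (inord 1)); rewrite -val_eqE /= inordK//= => /(_ isT).
    move=> nz; rewrite !rmorphN !rmorphD /= => /oppr_inj kE.
    exists (y1 - v1); congr (_, _); first by ring.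
    apply/eqP; rewrite -subr_eq0.
    have : (((m ord0)%:Z)%:~R - ((m' ord0)%:Z)%:~R : R) * (y2 - (v2 + (y1 - v1) * 1)) = 0.
      move: kE e0 e1; rewrite -!pmulrn => kE e0 e1.
      have -> : (m ord0)%:R = (m' ord0)%:R + (m' ord_max)%:R - (m ord_max)%:R :> R by lra.
      have : (m ord0)%:R = (m' ord0)%:R + (m' ord_max)%:R - (m ord_max)%:R :> R by lra.
      by move=> h; rewrite h in e0 e1; lra.
    by move/eqP; rewrite mulf_eq0 (negPf nz).
  + move=> e0 e1 /(_ (inord 2)); rewrite -val_eqE /= inordK//= => /(_ isT).
    move=> nz kE.
    exists (v1 - y1); congr (_, _); first by ring.
    apply/eqP; rewrite -subr_eq0.
    have : (((m ord_max)%:Z)%:~R - ((m' ord_max)%:Z)%:~R : R) * (y2 - (v2 + (v1 - y1) * 0)) = 0.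
      move: kE e0 e1; rewrite -!pmulrn => kE e0 e1.
      by rewrite kE in e0 e1; lra.
    by move/eqP; rewrite mulf_eq0 (negPf nz).
  + move=> e0 e1 /(_ (inord 1)); rewrite -val_eqE /= inordK//= => /(_ isT).
    move=> nz kE.
    exists (v2 - y2); congr (_, _); last by ring.
    apply/eqP; rewrite -subr_eq0.
    have : (((m ord0)%:Z)%:~R - ((m' ord0)%:Z)%:~R : R) * (y1 - (v1 + (v2 - y2) * 0)) = 0.
      move: kE e0 e1; rewrite -!pmulrn => kE e0 e1.
      by rewrite kE in e0 e1; lra.
    by move/eqP; rewrite mulf_eq0 (negPf nz).
exists s => //; move: ym => [_ /(_ n vn.1)]; rewrite ys !value_ray (maximizers_eq vm vn).
move=> h; rewrite leNgt; apply/negP => s0.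
exact: steeper_reverse h s0 (intr_lt1 R kmn).
Qed.

End Edges.

Section EdgeFaces.
Variable R : realType.
Local Notation exponent := (multinom 2).
Implicit Types (F : tropical_poly R) (v y : R * R) (k : 'I_3) (m n : exponent) (s r : R).

(* The triangle m m' n is dual to the vertex v, and its side m m' to an edge that
   leaves v along the k-th ray. *)
Record edge_at F v k m m' n : Prop := EdgeAt {
  ea_m : maximizers F v m;
  ea_m' : maximizers F v m';
  ea_n : maximizers F v n;
  ea_eq : hc k m = hc k m';
  ea_lt : hc k m < hc k n;
  ea_det : `|edet m m' n| = 1;
  ea_lab : forall m0, maximizers F v m0 -> [\/ m0 = m, m0 = m' | m0 = n] }.

Variables (F : tropical_poly R) (v : R * R) (k : 'I_3) (m m' n : exponent).
Hypothesis E : edge_at F v k m m' n.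
Let x (s : R) : R * R := v + s *: ray_dir R k.

Lemma edge_convex s r : 0 <= s <= r -> maximizers F (x r) m -> maximizers F (x s) m.
Proof.
move=> /andP[s0 sr] [mF mP]; split => // m0 m0F.
have := mP m0 m0F; have := (ea_m E).2 m0 m0F; rewrite !value_ray.
exact: slope_convex.
Qed.

Lemma edge_label s r : 0 < s -> s < r -> maximizers F (x r) m ->
  maximizers F (x s) = [set m; m'].
Proof.
move=> s0 sr xr; have xs : maximizers F (x s) m.
  by apply: edge_convex xr; rewrite (ltW s0) (ltW sr).
apply/seteqP; split => m0.
  by move=> /(edge_interior (ea_m E) (ea_lt E) (ea_lab E) s0 sr xr).
move=> [->//|->]; exact: edge_along (ea_m E) (ea_m' E) (ea_eq E) _ xs.
Qed.

Section Face.
Variables (r0 : R) (e : face F).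
Hypotheses (r00 : 0 < r0) (xr0 : maximizers F (x r0) m).
Hypothesis eE : face_label e = [set m; m'].

Lemma edge_faceP y : face_set e y <-> exists s, [/\ 0 <= s, y = x s & maximizers F (x s) m].
Proof.
rewrite /face_set /= eE; split => [h|[s [s0 -> xs]]].
  have ym : maximizers F y m by apply: h; left.
  have ym' : maximizers F y m' by apply: h; right.
  have [s s0 ys] := edge_pointP (ea_m E) (ea_m' E) (ea_n E) (ea_eq E) (ea_lt E) (ea_det E) ym ym'.
  by exists s; rewrite -[x s]ys.
move=> m0 [->//|->]; exact: edge_along (ea_m E) (ea_m' E) (ea_eq E) _ xs.
Qed.

Let zm := zexp m.
Let zm' := zexp m'.

Lemma edge_dual : dual_cell e = convex_hull [set lattice_pt R zm; lattice_pt R zm'].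
Proof.
rewrite /dual_cell eE; congr convex_hull; apply/seteqP; split => y.
  by move=> [m0 [->|->] <-]; [left|right].
by move=> [->|->]; [exists m; [left|]|exists m'; [right|]].
Qed.

Lemma edge_line : [set lattice_pt R zm; lattice_pt R zm'] `<=`
  [set y : R * R | (zm'.2 - zm.2)%:~R * y.1 + (zm.1 - zm'.1)%:~R * y.2 +
     (zm.2 * zm'.1 - zm.1 * zm'.2)%:~R = 0].
Proof. by move=> y [->|->]; rewrite /lattice_pt /= -!intrM -!intrD; apply/eqP; rewrite intr_eq0; apply/eqP; ring. Qed.

Lemma edge_ends_neq : zm != zm'.
Proof.
have [h _ _] : [/\ m != m', m != n & m' != n] by apply: edet_neq; rewrite -normr_eq0 (ea_det E).
by rewrite (inj_eq zexp_inj).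
Qed.

Lemma edge_is_edge : is_edge e.
Proof.
rewrite /is_edge edge_dual; split.
  apply: convex_hull_not_two_dimensional edge_line.
  rewrite xpair_eqE !intr_eq0 !subr_eq0; apply: contra edge_ends_neq.
  by move=> /andP[/eqP h2 /eqP h1]; rewrite [zm]surjective_pairing [zm']surjective_pairing h1 h2.
exists (lattice_pt R zm), (lattice_pt R zm').
split; [by apply: sub_convex_hull; left|by apply: sub_convex_hull; right|].
rewrite /lattice_pt xpair_eqE !eqr_int -xpair_eqE -!surjective_pairing.
exact: edge_ends_neq.
Qed.

(** The dual segment is a side of a unimodular triangle, whose only lattice points are its corners.
    This is what makes the weight 1. *)
Lemma edge_lattice : [set z : int * int | dual_cell e (lattice_pt R z)] = [set zm; zm'].
Proof.
rewrite edge_dual; apply/seteqP; split => z /=; last first.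
  by move=> [->|->]; apply: sub_convex_hull; [left|right].
move=> hz.
have [->|->|zn] : [\/ z = zm, z = zm' | z = zexp n].
- apply: (@unimodular_lattice_hull R); first exact: ea_det E.
  by apply: convex_hullS hz => y [->|->]; left; [left|right].
- by left.
- by right.
exfalso; have := convex_hull_line edge_line hz.
rewrite zn /lattice_pt /= -!intrM -!intrD => /eqP; rewrite intr_eq0 => /eqP h.
have : edet m m' n = 0 by apply: oppr_inj; rewrite oppr0 -[RHS]h /edet /idet /zm /zm' /=; ring.
by move=> h0; have := ea_det E; rewrite h0 normr0.
Qed.

Lemma edge_weight : weight e = 1%N.
Proof.
rewrite /weight edge_lattice fset_setU ?fset_set1//.
by rewrite cardfs2 edge_ends_neq.
Qed.

Lemma edge_direction : enorm (lattice_pt R (direction e)) = enorm (ray_dir R k).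
Proof.
have fv : face_set e v.
  by apply/edge_faceP; exists 0; rewrite /x scale0r addr0; split => //; exact: ea_m E.
have fx : face_set e (x r0) by apply/edge_faceP; exists r0; rewrite ltW.
rewrite /direction; case: xgetP => [u _ [cu [y [y' [ey ey' yy' d0]]]]|/(_ (ray_dirz k))]; last first.
  case; split; first exact: coprime_ray_dirz.
  exists v, (x r0); split => //.
    apply/eqP => h; have : x 0 = x r0 by rewrite -h /x scale0r addr0.
    by move=> /ray_inj h0; move: r00; rewrite -h0 ltxx.
  by rewrite lattice_ray_dirz /x [v + _]addrC addrK /det2 /=; rewrite /GRing.scale /=; ring.
apply: enorm_parallel_ray => //.
move: ey ey' yy' d0 => /edge_faceP[s [_ -> _]] /edge_faceP[s' [_ -> _]] ss'.
have -> : x s' - x s = (s' - s) *: ray_dir R k.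
  by rewrite /x opprD addrACA subrr add0r scalerBl.
have s's : s' - s != 0 by apply: contra_neq ss' => /subr0_eq ->.
move=> h; apply: (mulfI s's); rewrite mulr0 -h /det2 /=.
by rewrite /GRing.scale /=; ring.
Qed.

Lemma edge_distE s s' : edge_dist e (x s) (x s') = `|s' - s|.
Proof.
rewrite /edge_dist edge_weight mul1r edge_direction.
have -> : x s' - x s = (s' - s) *: ray_dir R k.
  by rewrite /x opprD addrACA subrr add0r scalerBl.
by rewrite enormZ mulfK// enorm_ray_neq0.
Qed.

Lemma edge_dist_vertex s : 0 <= s -> edge_dist e v (x s) = s.
Proof.
move=> s0; have := edge_distE 0 s; rewrite {1}/x scale0r addr0 => ->.
by rewrite subr0 ger0_norm.
Qed.

End Face.
End EdgeFaces.

Section EdgeSummary.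
Variable R : realType.
Local Notation exponent := (multinom 2).
Implicit Types (F : tropical_poly R) (v y : R * R) (k : 'I_3) (m n : exponent) (s r : R).

Definition arm v k (J : set R) : set (R * R) := [set v + s *: ray_dir R k | s in J].

Definition half_line : set R := [set s | 0 <= s].

Lemma norm_ray_gt0 k : 0 < `|ray_dir R k|.
Proof.
rewrite normr_gt0; case: k => [[|[|[|//]]] hk]; rewrite /ray_dir xpair_eqE /=.
- by rewrite oner_eq0.
- by rewrite oppr_eq0 oner_eq0.
- by rewrite oppr_eq0 oner_eq0 andbF.
Qed.

Lemma half_line_unbounded v k : ~ bounded_set (arm v k half_line).
Proof.
case=> M [_ hM].
have u0 := norm_ray_gt0 k; set u := ray_dir R k in u0 *.
pose N := `|M| + 1.
have MN : M < N by rewrite /N; apply: le_lt_trans (ler_norm M) _; rewrite ltrDl.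
pose s := (N + `|v| + 1) / `|u|.
have N0 : 0 <= N by rewrite addr_ge0.
have s0 : 0 <= s by rewrite divr_ge0// !addr_ge0.
have h2 : `|v + s *: u| <= N by apply: (hM N MN); exists s.
have := lerB_normD (s *: u) v; rewrite [s *: u + v]addrC normrZ ger0_norm//.
rewrite divfK ?gt_eqF// => h1; have := le_trans h1 h2; lra.
Qed.

Lemma segmentE v y :
  segment v y = [set (1 - s) *: v + s *: y | s in [set s | 0 <= s <= 1]].
Proof. by rewrite /segment set_itvE. Qed.

Lemma segment_bounded v y : bounded_set (segment v y).
Proof.
exists (`|v| + `|y|); split; first exact: num_real.
move=> M vyM z; rewrite segmentE => -[s /= /andP[s0 s1] <-].
apply: le_trans (ltW vyM); apply: le_trans (ler_normD _ _) _.
rewrite !normrZ !ger0_norm ?subr_ge0//; apply: lerD.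
  by rewrite ler_piMl// gerBl.
by rewrite ler_piMl.
Qed.

Lemma arm_segment v k l : 0 < l ->
  arm v k [set s | 0 <= s <= l] = segment v (v + l *: ray_dir R k).
Proof.
move=> l0; rewrite segmentE; apply/seteqP; split => y.
  move=> [s /andP[s0 sl] <-]; exists (s / l).
    by rewrite /= divr_ge0 ?(ltW l0)// ler_pdivrMr// mul1r.
  by rewrite scalerDr addrA -scalerDl subrK scale1r scalerA divfK ?gt_eqF.
move=> [s /andP[s0 s1] <-]; exists (s * l).
  by rewrite /= mulr_ge0 ?(ltW l0)//= ler_piMl// ltW.
by rewrite scalerDr addrA -scalerDl subrK scale1r scalerA.
Qed.

Lemma segment_left v y : segment v y v.
Proof. by rewrite segmentE; exists 0; rewrite /= ?lexx ?ler01// subr0 scale1r scale0r addr0. Qed.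

Lemma segment_right v y : segment v y y.
Proof. by rewrite segmentE; exists 1; rewrite /= ?lexx ?ler01// subrr scale0r scale1r add0r. Qed.

(** [edge_length] chooses end points of the edge arbitrarily; every choice has to give l. *)
Lemma line_segment_ends v k (l : R) y y' : 0 < l ->
  segment v (v + l *: ray_dir R k) = segment y y' ->
  exists s s' : R, [/\ y = v + s *: ray_dir R k, y' = v + s' *: ray_dir R k & `|s' - s| = l].
Proof.
move=> l0; rewrite -arm_segment// => h.
have [s sl ys] : arm v k [set s | 0 <= s <= l] y by rewrite h; exact: segment_left.
have [s' sl' ys'] : arm v k [set s | 0 <= s <= l] y' by rewrite h; exact: segment_right.
exists s, s'; split => //; move: sl sl' => /= /andP[s0 sl] /andP[s0' sl'].
have inv r : 0 <= r <= l -> exists2 c, 0 <= c <= 1 & r = (1 - c) * s + c * s'.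
  move=> rl; have : arm v k [set s | 0 <= s <= l] (v + r *: ray_dir R k) by exists r.
  rewrite h segmentE => -[c c01 hc]; exists c => //.
  apply: (@ray_inj R k v); rewrite -hc -ys -ys' !scalerDr !scalerA addrACA -scalerDl subrK scale1r.
  by rewrite -scalerDl.
have [|c c01 hc] := inv 0; first by rewrite lexx ltW.
have [|d d01 hd] := inv l; first by rewrite lexx ltW.
move: c01 d01 => /andP[c0 c1] /andP[d0 d1].
have [ss|ss] := leP s s'.
- rewrite ger0_norm ?subr_ge0//.
  have : s <= 0 by nra.
  have : l <= s' by nra.
  by lra.
- rewrite ltr0_norm ?subr_lt0//.
  have : s' <= 0 by nra.
  have : l <= s by nra.
  by lra.
Qed.

Lemma edge_unbounded F v k m m' n : edge_at F v k m m' n ->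
  (forall s, 0 <= s -> maximizers F (v + s *: ray_dir R k) m) ->
  exists2 e : face F, unbounded_edge e & face_set e = arm v k half_line.
Proof.
move=> E unb.
(* A face is given by its label at a relatively interior point, here at parameter 1. *)
have lab1 : maximizers F (v + 1 *: ray_dir R k) = [set m; m'].
  by apply: (edge_label E (r := 2)) => //; [rewrite ltr1n|exact: unb].
pose e := Face (ex_intro (fun y => maximizers F y = [set m; m']) _ lab1).
have eE : face_label e = [set m; m'] by [].
have fE : face_set e = arm v k half_line.
  apply/seteqP; split => y; first by move=> /(edge_faceP E eE)[s [s0 -> _]]; exists s.
  by move=> [s s0 <-]; apply/(edge_faceP E eE); exists s; split => //; exact: unb.
exists e => //; split; last by rewrite fE; exact: half_line_unbounded.
exact: (edge_is_edge E eE).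
Qed.

Lemma edge_bounded F v k m m' n l : edge_at F v k m m' n -> 0 < l ->
  (forall s, 0 <= s -> maximizers F (v + s *: ray_dir R k) m <-> s <= l) ->
  exists e : face F, [/\ bounded_edge e, face_set e = arm v k [set s | 0 <= s <= l],
    edge_length e = l &
    forall s, 0 <= s -> edge_dist e v (v + s *: ray_dir R k) = s].
Proof.
move=> E l0 lP.
have xl : maximizers F (v + l *: ray_dir R k) m by apply/lP => //; exact: ltW.
have lab1 : maximizers F (v + (l / 2) *: ray_dir R k) = [set m; m'].
  by apply: (edge_label E (r := l)) => //; lra.
pose e := Face (ex_intro (fun y => maximizers F y = [set m; m']) _ lab1).
have eE : face_label e = [set m; m'] by [].
have fE : face_set e = arm v k [set s | 0 <= s <= l].
  apply/seteqP; split => y.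
    move=> /(edge_faceP E eE)[s [s0 -> xs]]; exists s => //=.
    by rewrite s0; apply/lP.
  move=> [s /andP[s0 sl] <-]; apply/(edge_faceP E eE); exists s; split => //.
  exact/lP.
have dE := edge_distE E l0 xl eE.
exists e; split => //.
- split; first exact: (edge_is_edge E eE).
  by rewrite fE arm_segment//; exact: segment_bounded.
- rewrite /edge_length; case: xgetP => [d _ [y [y' [h ->]]]|/(_ l)].
    move: h; rewrite fE arm_segment// => /(line_segment_ends l0)[s [s' [-> -> <-]]].
    exact: dE.
  case; exists v, (v + l *: ray_dir R k); split; first by rewrite fE arm_segment.
  by rewrite (edge_dist_vertex E l0 xl eE)// ltW.
- by move=> s; exact: (edge_dist_vertex E l0 xl eE).
Qed.

(** The edge ends where the first monomial b of smaller k-th exponent catches up. The determinant of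
    m, m', b is, up to sign, a product of two integers and equals 1 or -1, so b is just one step
    lower. Beyond the end b has the largest slope and is alone, so the curve leaves the ray. *)
Lemma edge_far_end F v k m m' n : nonsingular F -> edge_at F v k m m' n ->
  (exists2 b, b \in exps F & hc k b < hc k m) ->
  exists l b, [/\ 0 < l,
    (forall s, 0 <= s -> maximizers F (v + s *: ray_dir R k) m <-> s <= l),
    [/\ maximizers F (v + l *: ray_dir R k) b, hc k b = hc k m - 1 & `|edet m m' b| = 1],
    (forall m0, maximizers F (v + l *: ray_dir R k) m0 -> [\/ m0 = m, m0 = m' | m0 = b]) &
    exists2 e, 0 < e & forall s, l < s < l + e -> forall m0,
      maximizers F (v + s *: ray_dir R k) m0 -> m0 = b].
Proof.
move=> nsF E [b0 b0F b0m].
have [|l [b [l0 sl lb keep [before after]]]] := slide (u := ray_dir R k) (ea_m E).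
  by exists b0 => //; rewrite !slope_ray ltrN2 ltr_int.
move: sl; rewrite !slope_ray ltrN2 ltr_int => bm.
have l_gt0 : 0 < l.
  rewrite lt_neqAle l0 andbT; apply/eqP => l00.
  have : maximizers F v b by move: lb; rewrite -l00 scale0r addr0.
  move=> /(ea_lab E)[] h; move: bm; rewrite h ?ltxx//.
    by rewrite (ea_eq E) ltxx.
  by move=> /(lt_trans (ea_lt E)); rewrite ltxx.
have lP s : 0 <= s -> maximizers F (v + s *: ray_dir R k) m <-> s <= l.
  move=> s0; split=> [h|sl]; last by apply: keep => //; [rewrite s0|exact: ea_m E].
  by rewrite leNgt; apply/negP => /after.
have lm : maximizers F (v + l *: ray_dir R k) m by apply/lP.
have lm' := edge_along (ea_m E) (ea_m' E) (ea_eq E) lm.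
have [i [j uij]] := ord3_pick k.
have ki : k != i by move: uij; rewrite /= !inE; case: eqP.
have mm' : m != m'.
  by have [] : [/\ m != m', m != n & m' != n] by apply: edet_neq; rewrite -normr_eq0 (ea_det E).
have dE m0 : `|edet m m' m0| = `|(hc i m' - hc i m) * (hc k m0 - hc k m)|.
  by rewrite -(edet_hc _ _ _ ki) (ea_eq E) subrr mul0r sub0r normrN.
have d0 : edet m m' b != 0.
  rewrite -normr_eq0 dE normr_eq0 mulf_eq0 !subr_eq0 negb_or [hc k b == _]lt_eqF// andbT.
  by apply: contra_neq mm' => h; apply: (hc_inj ki) => //; exact: ea_eq E.
have [d1 lab] := label3 nsF lm lm' lb d0.
have bE : hc k b = hc k m - 1.
  move: d1; rewrite dE normrM [X in _ * X]ltr0_norm ?subr_lt0// opprB.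
  move: `|_| (normr_ge0 (hc i m' - hc i m)) bm => a; clear => a0 bm h.
  have a1 : 1 <= a by nia.
  by nia.
exists l, b; split => //.
have [|e e0 eP] := unique_after (u := ray_dir R k) lb.
  move=> m0 /lab[->|->|->]; rewrite ?eqxx// !slope_ray ltrN2 ltr_int//.
  by rewrite -(ea_eq E).
exists e => // s /andP[ls sle] m0; have -> : v + s *: ray_dir R k =
    v + l *: ray_dir R k + (s - l) *: ray_dir R k.
  by rewrite -addrA -scalerDl (addrC l) subrK.
by apply: eP; lra.
Qed.

End EdgeSummary.

Arguments half_line {R}.

(** * Components of subsets of a tropical line *)

Section ComponentOfArms.
Variable R : realType.
Implicit Types (v y : R * R) (k i : 'I_3) (s l : R) (J : 'I_3 -> set R).

Definition ray_coord v k y : R :=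
  match val k with 0%N => y.1 - v.1 | 1%N => v.1 - y.1 | _ => v.2 - y.2 end.

Lemma ray_coordE v k s : ray_coord v k (v + s *: ray_dir R k) = s.
Proof.
rewrite ray_pt; case: k => [[|[|[|//]]] hk]; rewrite /ray_coord /ray_dir /=; ring.
Qed.

Lemma ray_coord_le0 v k i s : 0 <= s -> i != k -> ray_coord v i (v + s *: ray_dir R k) <= 0.
Proof.
rewrite ray_pt; case: k => [[|[|[|//]]] hk]; case: i => [[|[|[|//]]] hi] => s0 //= _;
  rewrite /ray_coord /ray_dir /=; lra.
Qed.

Lemma ray_coord_continuous v k : continuous (ray_coord v k).
Proof.
by case: k => [[|[|[|//]]] hk] y; rewrite /ray_coord /=; apply: cvgB;
  first [exact: cvg_cst|exact: cvg_fst|exact: cvg_snd].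
Qed.

Lemma connected_arm v k (J : set R) : is_interval J -> connected (arm v k J).
Proof.
move=> /connected_intervalP cJ; apply: connected_continuous_connected => //.
apply: continuous_subspaceT => s; apply: cvgD; first exact: cvg_cst.
by apply: cvgZr_tmp; exact: cvg_id.
Qed.

(* Near v + l u_k the set A is cut off along the ray beyond the parameter l. *)
Definition arm_spec (A : set (R * R)) v k (J : set R) :=
  (J = half_line /\ forall s, 0 <= s -> A (v + s *: ray_dir R k)) \/
  exists l, [/\ 0 <= l, J = [set s | 0 <= s <= l],
    forall s, 0 <= s <= l -> A (v + s *: ray_dir R k) &
    exists2 e, 0 < e & forall s, l < s < l + e -> ~ A (v + s *: ray_dir R k)].

(** The open and the closed set differ only inside the gap of A beyond l. Both contain the
    nonpositive parameters, which are the k-th coordinates of points on the other rays. *)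
Lemma arm_separation (A : set (R * R)) v k (J : set R) : arm_spec A v k J ->
  exists OZ : set R * set R, [/\ open OZ.1, closed OZ.2,
    forall s, s <= 0 \/ J s -> OZ.1 s /\ OZ.2 s &
    forall s, 0 <= s -> A (v + s *: ray_dir R k) -> OZ.1 s \/ OZ.2 s -> J s].
Proof.
case=> [[-> h]|[l [l0 -> h [e e0 he]]]].
  by exists (setT, setT); split => //; first [exact: openT|exact: closedT].
exists ([set s | s < l + e], [set s | s <= l]); split => /=.
- exact: open_lt.
- exact: closed_le.
- by move=> s [s0|/andP[s0 sl]]; split => /=; lra.
move=> s s0 As [sle|->]; last by rewrite s0.
by rewrite s0 leNgt; apply/negP => ls; apply: (he s) => //; rewrite ls.
Qed.

(** The union of the arms is connected through v, and it is open and closed in A, being cut out by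
    the open set U and also by the closed set Z. *)
Lemma connected_component_arms (A : set (R * R)) v J p :
  (forall y, A y -> exists k s, 0 <= s /\ y = v + s *: ray_dir R k) ->
  (forall k, arm_spec A v k (J k)) ->
  (\bigcup_k arm v k (J k)) p ->
  connected_component A p = \bigcup_k arm v k (J k).
Proof.
move=> Arays AJ Jp; set S := \bigcup_k _ in Jp *.
have Jge0 k s : J k s -> 0 <= s.
  by case: (AJ k) => [[-> _]|[l [_ -> _ _]]] //= /andP[].
have J0 k : J k 0.
  by case: (AJ k) => [[-> _]|[l [l0 -> _ _]]] /=; rewrite /half_line /= ?lexx.
have JA k s : J k s -> A (v + s *: ray_dir R k).
  by case: (AJ k) => [[-> h]|[l [_ -> h _]]] /=; exact: h.
have Jint k : is_interval (J k).
  case: (AJ k) => [[-> _]|[l [_ -> _ _]]] a b /= ha hb c /andP[ac cb].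
    exact: le_trans ac.
  by move: ha hb => /andP[a0 al] /andP[b0 bl]; apply/andP; split; lra.
have SA : S `<=` A by move=> _ [k _ [s Js <-]]; exact: JA.
have [OZ OZP] := choice (fun k => arm_separation (AJ k)).
pose U y := forall k, (OZ k).1 (ray_coord v k y).
pose Z y := forall k, (OZ k).2 (ray_coord v k y).
pose k1 : 'I_3 := inord 1; pose k2 : 'I_3 := inord 2.
have u3 : uniq [:: ord0; k1; k2] by rewrite /= !inE -!val_eqE /= !inordK.
have all3 (Q : 'I_3 -> Prop) : (forall k, Q k) <-> (Q ord0 /\ Q k1) /\ Q k2.
  by split => [h|[[h0 h1] h2] k]; [do !split|case: (ord3_cases k u3) => ->].
have oU : open U.
  have -> : U = (ray_coord v ord0 @^-1` (OZ ord0).1 `&` ray_coord v k1 @^-1` (OZ k1).1)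
      `&` ray_coord v k2 @^-1` (OZ k2).1.
    by apply/seteqP; split => y; rewrite /U all3.
  by apply: openI; [apply: openI|]; apply: open_comp => [y _|];
    [exact: ray_coord_continuous|case: (OZP ord0)|
     exact: ray_coord_continuous|case: (OZP k1)|exact: ray_coord_continuous|case: (OZP k2)].
have cZ : closed Z.
  have -> : Z = (ray_coord v ord0 @^-1` (OZ ord0).2 `&` ray_coord v k1 @^-1` (OZ k1).2)
      `&` ray_coord v k2 @^-1` (OZ k2).2.
    by apply/seteqP; split => y; rewrite /Z all3.
  by apply: closedI; [apply: closedI|]; apply: closed_comp => [y _|];
    [exact: ray_coord_continuous|case: (OZP ord0)|
     exact: ray_coord_continuous|case: (OZP k1)|exact: ray_coord_continuous|case: (OZP k2)].
have SUZ y : S y -> U y /\ Z y.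
  move=> [k _ [s Js <-]]; have s0 := Jge0 _ _ Js.
  suff h i : (OZ i).1 (ray_coord v i (v + s *: ray_dir R k)) /\
             (OZ i).2 (ray_coord v i (v + s *: ray_dir R k)).
    by split => i; case: (h i).
  have [_ _ OZi _] := OZP i; apply: OZi; have [->|ik] := eqVneq i k.
    by right; rewrite ray_coordE.
  by left; exact: ray_coord_le0.
have AUZ y : A y -> U y \/ Z y -> S y.
  move=> Ay UZy; have [k [s [s0 yE]]] := Arays y Ay.
  exists k => //; exists s => //; have [_ _ _ OZk] := OZP k; apply: OZk => //.
    by rewrite -yE.
  by case: UZy => /(_ k); rewrite yE ray_coordE; [left|right].
have SC : S `<=` connected_component A p.
  apply: connected_component_max => //; apply: bigcup_connected.
    by exists v => k _; exists 0; rewrite // scale0r addr0.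
  by move=> k _; exact: connected_arm.
apply/seteqP; split => //.
have compA := @connected_component_sub _ A p.
have := @component_connected _ A p (connected_component A p `&` S).
move=> h; suff <- : connected_component A p `&` S = connected_component A p by move=> y [].
apply: h.
- by exists p; split => //; exact: SC.
- exists U => //; apply/seteqP; split => y [cy hy]; split => //; first by case: (SUZ y hy).
  by apply: AUZ; [exact: compA|left].
- exists Z => //; apply/seteqP; split => y [cy hy]; split => //; first by case: (SUZ y hy).
  by apply: AUZ; [exact: compA|right].
Qed.

End ComponentOfArms.

(** * Dominance arguments *)

Section Coefficients.
Variable R : realType.
Local Notation K := (puiseux R).
Implicit Types (s r : R) (h g : int) (rho : K).

(* The coefficients of the first and second order conditions at a point of a line,
   for a monomial of exponents h and g in two homogeneous coordinates of ratio
   rho. *)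
Definition coef1 rho h g : K := h%:~R - g%:~R * rho.

Definition coef2 rho h g : K :=
  h%:~R * (h%:~R - 1) - 2 * h%:~R * g%:~R * rho + g%:~R * (g%:~R - 1) * rho ^+ 2.

(** This turns the constant h (h - 1) into h (h + 1): now h = -1 is suppressed instead of h = 1. It
    serves to let a monomial with h = 1 or (h, g) = (0, 1) dominate. *)
Definition coef3 rho h g : K := coef2 rho h g + 2 * coef1 rho h g.

Lemma coef2E rho h g : coef2 rho h g = (h * (h - 1))%:~R - (2 * h * g)%:~R * rho +
  (g * (g - 1))%:~R * (rho * rho).
Proof. by rewrite /coef2 !rmorphM !rmorphB /=; ring. Qed.

Lemma coef3E rho h g : coef3 rho h g = (h * (h + 1))%:~R - (2 * g * (h + 1))%:~R * rho +
  (g * (g - 1))%:~R * (rho * rho).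
Proof. by rewrite /coef3 /coef1 coef2E !rmorphM !rmorphB !rmorphD /=; ring. Qed.

Variables (rho : K) (s : R).
Hypotheses (rhos : veq rho (- s)) (s0 : 0 <= s).

Let s_le : - s <= 0. Proof. by rewrite oppr_le0. Qed.
Let s2_le : - (2 * s) <= - s. Proof. by have := s0; lra. Qed.

Lemma vle_rho (z : int) : vle (z%:~R * rho) (- s).
Proof. by apply: (vleM_to (@vle_int R z) rhos.1); rewrite add0r. Qed.

Lemma vle_rho2 (z : int) : vle (z%:~R * (rho * rho)) (- (2 * s)).
Proof.
apply: (vleM_to (@vle_int R z) (vleM rhos.1 rhos.1)); lra.
Qed.

Lemma veq_rho (z : int) : z != 0 -> veq (z%:~R * rho) (- s).
Proof. by move=> z0; apply: (veqM_to (veq_int R z0) rhos); rewrite add0r. Qed.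

Lemma veq_rho2 (z : int) : z != 0 -> veq (z%:~R * (rho * rho)) (- (2 * s)).
Proof. by move=> z0; apply: (veqM_to (veq_int R z0) (veqM rhos rhos)); lra. Qed.

Lemma vle_poly (a b c : int) : vle (a%:~R - b%:~R * rho + c%:~R * (rho * rho)) 0.
Proof.
apply: vleD; first apply: vleB; first exact: vle_int.
  exact: vle_le (vle_rho b) s_le.
exact: vle_le (vle_rho2 c) (le_trans s2_le s_le).
Qed.

Lemma vle_poly1 (b c : int) : vle (0%:~R - b%:~R * rho + c%:~R * (rho * rho)) (- s).
Proof.
rewrite sub0r; apply: vleD; first by apply: vleN; exact: vle_rho.
exact: vle_le (vle_rho2 c) s2_le.
Qed.

Lemma vle_poly2 (c : int) : vle (0%:~R - 0%:~R * rho + c%:~R * (rho * rho)) (- (2 * s)).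
Proof. by rewrite mul0r subrr add0r; exact: vle_rho2. Qed.

Lemma veq_poly (a b c : int) : 0 < s -> a != 0 ->
  veq (a%:~R - b%:~R * rho + c%:~R * (rho * rho)) 0.
Proof.
move=> s_gt0 a0; rewrite -addrA; apply: veqD_lt; first exact: veq_int.
apply: vltD; first by apply: vltN; apply: vle_lt (vle_rho b) _; lra.
by apply: vle_lt (vle_rho2 c) _; lra.
Qed.

Lemma veq_poly1 (b c : int) : 0 < s -> b != 0 ->
  veq (0%:~R - b%:~R * rho + c%:~R * (rho * rho)) (- s).
Proof.
move=> s_gt0 b0; rewrite sub0r; apply: veqD_lt; first by apply: veqN; exact: veq_rho.
by apply: vle_lt (vle_rho2 c) _; lra.
Qed.

Lemma veq_poly2 (c : int) : c != 0 ->
  veq (0%:~R - 0%:~R * rho + c%:~R * (rho * rho)) (- (2 * s)).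
Proof. by move=> c0; rewrite mul0r subrr add0r; exact: veq_rho2. Qed.

Lemma coef1_le h g : vle (coef1 rho h g) 0.
Proof.
apply: vleB; first exact: vle_int.
exact: vle_le (vle_rho g) s_le.
Qed.

Lemma coef1_le1 h g : h = 0 -> vle (coef1 rho h g) (- s).
Proof. by move=> ->; rewrite /coef1 sub0r; apply: vleN; exact: vle_rho. Qed.

Lemma coef1_eq h g : 0 < s -> h != 0 -> veq (coef1 rho h g) 0.
Proof.
move=> s_gt0 h0; apply: veqD_lt; first exact: veq_int.
by apply: vltN; apply: vle_lt (vle_rho g) _; lra.
Qed.

Lemma coef2_le h g : vle (coef2 rho h g) 0.
Proof. by rewrite coef2E; exact: vle_poly. Qed.

Lemma coef2_h1 h g : h = 1 -> vle (coef2 rho h g) (- s).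
Proof. by move=> ->; rewrite coef2E subrr mulr0; exact: vle_poly1. Qed.

Lemma coef2_h0 h g : h = 0 -> vle (coef2 rho h g) (- (2 * s)).
Proof. by move=> ->; rewrite coef2E mul0r mulr0 mul0r; exact: vle_poly2. Qed.

Lemma coef2_base h g : h = 0 -> g = 0 \/ g = 1 -> coef2 rho h g = 0.
Proof.
move=> -> [] ->; rewrite coef2E !(mul0r, mulr0, subrr, addr0)//.
Qed.

Lemma coef2_eq h g : 0 < s -> h != 0 -> h != 1 -> veq (coef2 rho h g) 0.
Proof.
move=> s_gt0 h0 h1; rewrite coef2E; apply: veq_poly => //.
by rewrite mulf_neq0// subr_eq0.
Qed.

Lemma coef2_eq1 h g : 0 < s -> h = 1 -> g != 0 -> veq (coef2 rho h g) (- s).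
Proof. by move=> s_gt0 -> g0; rewrite coef2E subrr mulr0; apply: veq_poly1 => //; rewrite mulr1 mulf_neq0. Qed.

Lemma coef2_eq0 h g : h = 0 -> g != 0 -> g != 1 -> veq (coef2 rho h g) (- (2 * s)).
Proof.
move=> -> g0 g1; rewrite coef2E mul0r mulr0 mul0r; apply: veq_poly2.
by rewrite mulf_neq0// subr_eq0.
Qed.

Lemma coef3_le h g : vle (coef3 rho h g) 0.
Proof. by rewrite coef3E; exact: vle_poly. Qed.

Lemma coef3_h0 h g : h = 0 -> vle (coef3 rho h g) (- s).
Proof. by move=> ->; rewrite coef3E mul0r; exact: vle_poly1. Qed.

Lemma coef3_hN1 h g : h = -1 -> vle (coef3 rho h g) (- (2 * s)).
Proof. by move=> ->; rewrite coef3E addNr !mulr0; exact: vle_poly2. Qed.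

Lemma coef3_h1 h g : 0 < s -> h = 1 -> veq (coef3 rho h g) 0.
Proof. by move=> s_gt0 ->; rewrite coef3E; exact: veq_poly. Qed.

Lemma coef3_base0 : coef3 rho 0 0 = 0.
Proof. by rewrite coef3E !(mul0r, mulr0, subrr, addr0). Qed.

Lemma coef3_base1 : 0 < s -> veq (coef3 rho 0 1) (- s).
Proof. by move=> s_gt0; rewrite coef3E mul0r; apply: veq_poly1. Qed.

End Coefficients.

(** * The edge of the curve through an inflection point inside a ray *)

Section Configurations.
Variable R : realType.
Local Notation K := (puiseux R).
Local Notation exponent := (multinom 2).
Implicit Types (F : tropical_poly R) (p v : R * R) (k i j : 'I_3)
  (m n b : exponent) (s r : R) (t : exponent -> K) (X : 'I_3 -> K).

(* The monomials t m of the curve and X k of its tangent line, evaluated at the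
   inflection point of valuation p. *)
Record inflection_config F p t X : Prop := InflectionConfig {
  ic_uniq : uniq (exps F);
  ic_nonsingular : nonsingular F;
  ic_term : {in exps F, forall m, veq (t m) (monomial_value F m p)};
  ic_max : exists m, maximizers F p m;
  ic_two : forall m, maximizers F p m -> exists2 n, maximizers F p n & n != m;
  ic_plane : forall m m', m \in exps F -> m' \in exps F -> m != m' ->
    exists2 n, n \in exps F & edet m m' n != 0;
  ic_first : forall k i b, k != i -> \sum_(m <- exps F)
    t m * coef1 (X k / X i) (hc k m - hc k b) (hc i m - hc i b) = 0;
  ic_second : forall k i b, k != i -> \sum_(m <- exps F)
    t m * coef2 (X k / X i) (hc k m - hc k b) (hc i m - hc i b) = 0 }.

Section Dominance.
Variables (F : tropical_poly R) (p : R * R) (t : exponent -> K) (X : 'I_3 -> K).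
Hypothesis ic : inflection_config F p t X.

Lemma dominant_absurd (c : exponent -> K) m d :
  \sum_(n <- exps F) t n * c n = 0 -> m \in exps F -> veq (c m) d ->
  (forall n, n \in exps F -> n != m -> c n = 0 \/
     exists2 e, vle (c n) e & monomial_value F n p + e < monomial_value F m p + d) ->
  False.
Proof.
move=> S0 mF cm h.
apply: (no_dominant (ic_uniq ic) mF (veqM (ic_term ic mF) cm) _ S0) => n nF nm.
case: (h n nF nm) => [->|[e ce lt]]; first by rewrite mulr0; exact: vlt0.
exact: vltM_to (ic_term ic nF).1 ce lt.
Qed.

Lemma combined_relation (c d : exponent -> K) (x : K) :
  \sum_(n <- exps F) t n * c n = 0 -> \sum_(n <- exps F) t n * d n = 0 ->
  \sum_(n <- exps F) t n * (c n + x * d n) = 0.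
Proof.
move=> c0 d0; transitivity (\sum_(n <- exps F) t n * c n + x * \sum_(n <- exps F) t n * d n).
  by rewrite mulr_sumr -big_split; apply: eq_bigr => n _; rewrite mulrDr [t n * (x * _)]mulrCA.
by rewrite c0 d0 mulr0 addr0.
Qed.

Lemma ic_third k i b : k != i -> \sum_(m <- exps F)
    t m * coef3 (X k / X i) (hc k m - hc k b) (hc i m - hc i b) = 0.
Proof.
move=> ki; exact: (combined_relation _ (ic_second ic b ki) (ic_first ic b ki)).
Qed.

Section Interior.
Variables (k i : 'I_3) (s : R).
Hypotheses (ki : k != i) (rhos : veq (X k / X i) (- s)) (s_gt0 : 0 < s).
Let s_ge0 := ltW s_gt0.

(** Normalized at m0, the first order condition has coefficients of valuation at most -s at m0 and
    m1, and 0 at m2, which dominates. *)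
Lemma two_against_one m0 m1 m2 :
  maximizers F p m0 -> maximizers F p m1 -> maximizers F p m2 ->
  (forall m, maximizers F p m -> [\/ m = m0, m = m1 | m = m2]) ->
  hc k m0 = hc k m1 -> hc k m2 != hc k m0 -> False.
Proof.
move=> h0 h1 h2 lab e01 e2.
have d2 : veq (coef1 (X k / X i) (hc k m2 - hc k m0) (hc i m2 - hc i m0)) 0.
  by apply: (coef1_eq rhos) => //; rewrite subr_eq0.
apply: (dominant_absurd (ic_first ic m0 ki) h2.1 d2) => n nF n2; right.
have [nx|nx] := pselect (maximizers F p n); last first.
  exists 0; first exact: (coef1_le rhos s_ge0).
  by rewrite ltrD2r; exact: maximizers_lt.
exists (- s); last first.
  by rewrite (maximizers_eq nx h2) ltrD2l oppr_lt0.
apply: (coef1_le1 rhos); case: (lab n nx) => [->|->|nm2].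
- by rewrite subrr.
- by rewrite e01 subrr.
- by rewrite nm2 eqxx in n2.
Qed.

Lemma no_triple m0 m1 m2 :
  maximizers F p m0 -> maximizers F p m1 -> maximizers F p m2 ->
  (forall m, maximizers F p m -> [\/ m = m0, m = m1 | m = m2]) ->
  edet m0 m1 m2 != 0 -> False.
Proof.
move=> h0 h1 h2 lab d0.
have lab' m : maximizers F p m -> [\/ m = m1, m = m2 | m = m0].
  by move=> /lab[]; [constructor 3|constructor 1|constructor 2].
have lab'' m : maximizers F p m -> [\/ m = m2, m = m0 | m = m1].
  by move=> /lab[]; [constructor 2|constructor 3|constructor 1].
have [e01|n01] := eqVneq (hc k m0) (hc k m1).
  have [e2|] := eqVneq (hc k m2) (hc k m0); last exact: (two_against_one h0 h1 h2 lab).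
  move/eqP: d0; apply; apply/eqP; rewrite -normr_eq0 -(edet_hc _ _ _ ki).
  by rewrite e2 -e01 subrr mul0r mulr0 subrr normr0.
have [e12|n12] := eqVneq (hc k m1) (hc k m2).
  exact: (two_against_one h1 h2 h0 lab' e12 n01).
have [e20|n20] := eqVneq (hc k m2) (hc k m0).
  exact: (two_against_one h2 h0 h1 lab'' e20 n12).
have [rho rhoE] : exists rho, rho = X k / X i by exists (X k / X i).
have rs : veq rho (- s) by rewrite rhoE.
(* With h normalized at m0, this multiple of the first order condition turns the constant h (h - 1)
   into h (h - h(m1)), which vanishes at m0 and m1 but not at m2. *)
pose c n := coef2 rho (hc k n - hc k m0) (hc i n - hc i m0) +
  (1 - (hc k m1 - hc k m0)%:~R) * coef1 rho (hc k n - hc k m0) (hc i n - hc i m0).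
have S0 : \sum_(n <- exps F) t n * c n = 0.
  rewrite /c rhoE; exact: (combined_relation _ (ic_second ic m0 ki) (ic_first ic m0 ki)).
have cE n : exists z1 z2 : int, c n =
    ((hc k n - hc k m0) * (hc k n - hc k m1))%:~R - z1%:~R * rho + z2%:~R * (rho * rho).
  exists (2 * (hc k n - hc k m0) * (hc i n - hc i m0) +
     (1 - (hc k m1 - hc k m0)) * (hc i n - hc i m0)),
     ((hc i n - hc i m0) * (hc i n - hc i m0 - 1)).
  by rewrite /c coef2E /coef1 !rmorphM !rmorphD !rmorphM !rmorphB /=; ring.
have c2 : veq (c m2) 0.
  have [z1 [z2 ->]] := cE m2; apply: (veq_poly rs) => //.
  by rewrite mulf_neq0// subr_eq0// eq_sym.
apply: (dominant_absurd S0 h2.1 c2) => n nF n2; right.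
have [nx|nx] := pselect (maximizers F p n); last first.
  exists 0; first by have [z1 [z2 ->]] := cE n; exact: (vle_poly rs s_ge0).
  by rewrite ltrD2r; exact: maximizers_lt.
exists (- s); last first.
  by rewrite (maximizers_eq nx h2) ltrD2l oppr_lt0.
have [z1 [z2 ->]] := cE n.
have -> : (hc k n - hc k m0) * (hc k n - hc k m1) = 0.
  case: (lab n nx) => [->|->|nm2]; rewrite ?subrr ?mul0r ?mulr0//.
  by rewrite nm2 eqxx in n2.
exact: (vle_poly1 rs s_ge0).
Qed.

(* Away from the vertex of the line, the inflection point lies in the relative
   interior of an edge of the curve that follows the ray. *)
Lemma interior_label : exists m m', [/\ maximizers F p m, maximizers F p m',
  hc k m = hc k m', hc i m' = hc i m + 1 &
  forall n, maximizers F p n -> n = m \/ n = m'].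
Proof.
have [m mx] := ic_max ic; have [m' m'x m'm] := ic_two ic mx.
have mm' : m != m' by rewrite eq_sym.
have [n [nF d1] lab] := pair_label (ic_nonsingular ic) mx m'x (ic_plane ic mx.1 m'x.1 mm').
have [nx|nx] := pselect (maximizers F p n).
  by case: (no_triple mx m'x nx lab); rewrite -normr_eq0 d1.
have {}lab m'' : maximizers F p m'' -> m'' = m \/ m'' = m'.
  by move=> h; case: (lab _ h) => [->|->|e]; [left|right|move: h; rewrite e].
(* Otherwise m' would dominate the first order condition normalized at m, where m itself has
   coefficient 0. *)
have e : hc k m = hc k m'.
  apply: contrapT => /eqP e.
  have d2 : veq (coef1 (X k / X i) (hc k m' - hc k m) (hc i m' - hc i m)) 0.
    by apply: (coef1_eq rhos) => //; rewrite subr_eq0 eq_sym.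
  apply: (dominant_absurd (ic_first ic m ki) m'x.1 d2) => b bF bm'.
  have [bx|bx] := pselect (maximizers F p b); last first.
    right; exists 0; first exact: (coef1_le rhos s_ge0).
    by rewrite ltrD2r; exact: maximizers_lt.
  left; case: (lab b bx) => [->|bm]; last by rewrite bm eqxx in bm'.
  by rewrite !subrr /coef1 mul0r subrr.
have : `|hc i m' - hc i m| = 1.
  have := edet_hc m m' n ki; rewrite d1 e subrr mul0r sub0r normrN normrM.
  move: `|hc i m' - hc i m| `|hc k n - hc k m'| (normr_ge0 (hc i m' - hc i m)) (normr_ge0 (hc k n - hc k m')).
  by clear => x y x0 y0 h; have : 1 <= y by [nia]; nia.
move=> d; have [d'|d'] : hc i m' = hc i m + 1 \/ hc i m = hc i m' + 1 by lia.
  by exists m, m'.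
exists m', m; split => //.
by move=> n' /lab[]; [right|left].
Qed.

End Interior.
End Dominance.
End Configurations.

Section EdgeThroughInflection.
Variable R : realType.
Local Notation K := (puiseux R).
Local Notation exponent := (multinom 2).
Implicit Types (F : tropical_poly R) (p v : R * R) (k i j : 'I_3)
  (m n b : exponent) (s r l : R) (t : exponent -> K) (X : 'I_3 -> K).

(** Here e = 1 follows the ray and e = -1 runs against it. In that direction either the edge never
    ends, or it ends after l with one new monomial, one step away in the k-th exponent. *)
Lemma side_of_edge F p k m m' (e : int) : nonsingular F -> e = 1 \/ e = -1 ->
  maximizers F p m -> maximizers F p m' -> m != m' -> hc k m = hc k m' ->
  (forall n, maximizers F p n -> n = m \/ n = m') ->
  (forall n, n \in exps F -> 0 <= e * (hc k n - hc k m)) \/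
  exists l b, [/\ 0 < l, b \in exps F, e * (hc k b - hc k m) = -1,
    monomial_value F b p - monomial_value F m p = - l &
    [/\ (forall n, n \in exps F -> n != b -> e * (hc k n - hc k m) < 0 ->
          monomial_value F n p - monomial_value F m p < - l),
        (forall n, n = m \/ n = m' \/ n = b ->
          maximizers F (p + l *: (e%:~R *: ray_dir R k)) n),
        (forall n, maximizers F (p + l *: (e%:~R *: ray_dir R k)) n ->
          [\/ n = m, n = m' | n = b]) & `|edet m m' b| = 1]].
Proof.
move=> nsF e1 mx m'x mm' kmm' lab.
have [h|h] := pselect (forall n, n \in exps F -> 0 <= e * (hc k n - hc k m)); first by left.
right; set u := e%:~R *: ray_dir R k.
have su n : slope u n = - (e * hc k n)%:~R.
  rewrite /u /slope /= /GRing.scale /= intrM -mulrN -(slope_ray R k n) /slope; ring.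
have slt n n' : (slope u n < slope u n') = (e * (hc k n' - hc k n) < 0).
  by rewrite !su ltrN2 ltr_int mulrBr subr_lt0.
have [|l [b [l0 sb lb keep [before _]]]] := slide (u := u) mx.
  apply: contrapT => h'; apply: h => n nF; rewrite leNgt -slt; apply/negP => h2.
  by apply: h'; exists n.
have lP : 0 <= l <= l by rewrite l0 lexx.
have lm : maximizers F (p + l *: u) m by apply: keep.
have lm' : maximizers F (p + l *: u) m' by apply: keep => //; rewrite !su kmm'.
have l_gt0 : 0 < l.
  rewrite lt_neqAle l0 andbT; apply/eqP => l00.
  have : maximizers F p b by move: lb; rewrite -l00 scale0r addr0.
  move=> /lab[] hb; move: sb; rewrite slt hb ?kmm' subrr mulr0 ltxx//.
have [i [j uij]] := ord3_pick k.
have ki : k != i by move: uij; rewrite /= !inE; case: eqP.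
have dE m0 : `|edet m m' m0| = `|(hc i m' - hc i m) * (hc k m0 - hc k m)|.
  by rewrite -(edet_hc _ _ _ ki) kmm' subrr mul0r sub0r normrN.
have bm : hc k b - hc k m != 0.
  by apply: contraTneq sb => hb; rewrite slt hb mulr0 ltxx.
have d0 : edet m m' b != 0.
  rewrite -normr_eq0 dE normr_eq0 mulf_neq0// subr_eq0.
  by apply: contra_neq mm' => hi; apply: (hc_inj ki).
have [d1 lab'] := label3 nsF lm lm' lb d0.
have hb : e * (hc k b - hc k m) = -1.
  move: d1 sb; rewrite slt dE normrM.
  move: `|hc i m' - hc i m| (normr_ge0 (hc i m' - hc i m)) (hc k b - hc k m) bm => a a0 c c0 h1 h2.
  have a1 : 1 <= a by nia.
  by case: e1 h2 => -> h2; nia.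
exists l, b; split => //; first by case: lb.
- have := maximizers_eq lb lm; rewrite !monomial_value_move !su.
  have -> : e * hc k b = e * hc k m - 1 by rewrite -hb; ring.
  by rewrite intrB; lra.
split => //; last by move=> n [->|[->|->]].
move=> n nF nb hn.
have hnR : (e * (hc k n - hc k m))%:~R <= -1 :> R.
  by apply: (le_trans (_ : _ <= (-1)%:~R)); rewrite ?ler_int//; lia.
have : monomial_value F n (p + l *: u) < monomial_value F m (p + l *: u).
  apply: maximizers_lt => // /lab'[] hn'; move: hn; rewrite ?hn' ?kmm' ?subrr ?mulr0 ?ltxx//.
  by rewrite hn' eqxx in nb.
rewrite !monomial_value_move !su.
move: hnR; rewrite mulrBr intrB.
move: (monomial_value _ _ _) (monomial_value _ _ _) (_%:~R) (_%:~R) => x y a c.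
by move: l_gt0; clear => l0 h1 h2; nra.
Qed.

(* The summand of the left end b dominates the second order condition. *)
Lemma left_end_dominates F p t X k i s l r m m' b :
  inflection_config F p t X -> k != i -> veq (X k / X i) (- s) -> 0 < s ->
  maximizers F p m -> maximizers F p m' ->
  (forall n, maximizers F p n -> n = m \/ n = m') ->
  hc k m = hc k m' -> hc i m' = hc i m + 1 ->
  b \in exps F -> hc k b - hc k m = -1 ->
  monomial_value F b p - monomial_value F m p = - l ->
  (forall n, n \in exps F -> n != b -> hc k n - hc k m < 0 ->
     monomial_value F n p - monomial_value F m p < - l) ->
  (forall n, n \in exps F -> 0 < hc k n - hc k m ->
     monomial_value F n p - monomial_value F m p <= - r) ->
  l < r -> r <= s -> False.
Proof.
move=> ic ki rhos s0 mx m'x lab kmm' imm' bF hb bl left_lt right_le lr rs.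
have s_ge0 := ltW s0.
have cb : veq (coef2 (X k / X i) (hc k b - hc k m) (hc i b - hc i m)) 0.
  by apply: (coef2_eq rhos) => //; rewrite hb.
apply: (dominant_absurd ic (ic_second ic m ki) bF cb) => n nF nb.
have [hn|hn|hn] := ltgtP (hc k n - hc k m) 0.
- right; exists 0; first exact: (coef2_le rhos s_ge0).
  by have := left_lt n nF nb hn; lra.
- right; have dn := right_le n nF hn.
  have [h1|h1] := eqVneq (hc k n - hc k m) 1.
    by exists (- s); [exact: (coef2_h1 rhos s_ge0)|lra].
  by exists 0; [exact: (coef2_le rhos s_ge0)|lra].
have [nx|nx] := pselect (maximizers F p n).
  left; apply: coef2_base => //; case: (lab n nx) => ->; first by left; rewrite subrr.
  by right; rewrite imm' addrC addKr.
right; exists (- (2 * s)); first exact: (coef2_h0 rhos).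
by have := maximizers_lt mx nF nx; lra.
Qed.

(* Otherwise the curve and the line separate before the vertex of the line, and
   the summand of the other end a is dominant. *)
Lemma right_end_dominates F p t X k i s l m m' a :
  inflection_config F p t X -> k != i -> veq (X k / X i) (- s) -> 0 < s ->
  maximizers F p m -> maximizers F p m' ->
  (forall n, maximizers F p n -> n = m \/ n = m') ->
  hc k m = hc k m' -> hc i m' = hc i m + 1 ->
  a \in exps F -> hc k a - hc k m = 1 ->
  monomial_value F a p - monomial_value F m p = - l ->
  (forall n, n \in exps F -> n != a -> 0 < hc k n - hc k m ->
     monomial_value F n p - monomial_value F m p < - l) ->
  (forall n, n \in exps F -> hc k n - hc k m = -1 ->
     monomial_value F n p - monomial_value F m p <= - l) ->
  (forall n, n \in exps F -> hc k n - hc k m < -1 ->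
     monomial_value F n p - monomial_value F m p < - l) ->
  l < s -> False.
Proof.
move=> ic ki rhos s0 mx m'x lab kmm' imm' aF ha al right_lt left1 left2 ls.
have s_ge0 := ltW s0.
have ca : veq (coef3 (X k / X i) (hc k a - hc k m) (hc i a - hc i m)) 0.
  by apply: (coef3_h1 rhos) => //; rewrite ha.
apply: (dominant_absurd ic (ic_third ic m ki) aF ca) => n nF na; right.
have [hn|hn|hn] := ltgtP (hc k n - hc k m) 0.
- have [h1|h1] := eqVneq (hc k n - hc k m) (-1).
    by exists (- (2 * s)); [exact: (coef3_hN1 rhos)|have := left1 n nF h1; lra].
  exists 0; first exact: (coef3_le rhos s_ge0).
  by have : hc k n - hc k m < -1 by [lia]; move=> /(left2 n nF); lra.
- exists 0; first exact: (coef3_le rhos s_ge0).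
  by have := right_lt n nF na hn; lra.
exists (- s); first exact: (coef3_h0 rhos s_ge0).
by have := mx.2 n nF; lra.
Qed.

(* If the edge of the curve passes through the vertex of the line, the summand of
   m' is dominant. *)
Lemma through_vertex_dominates F p t X k i s m m' :
  inflection_config F p t X -> k != i -> veq (X k / X i) (- s) -> 0 < s ->
  maximizers F p m -> maximizers F p m' ->
  (forall n, maximizers F p n -> n = m \/ n = m') ->
  hc k m = hc k m' -> hc i m' = hc i m + 1 ->
  (forall n, n \in exps F -> 0 < hc k n - hc k m ->
     monomial_value F n p - monomial_value F m p < - s) ->
  (forall n, n \in exps F -> hc k n - hc k m = -1 ->
     monomial_value F n p - monomial_value F m p <= - s) ->
  (forall n, n \in exps F -> hc k n - hc k m < -1 ->
     monomial_value F n p - monomial_value F m p < - s) ->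
  False.
Proof.
move=> ic ki rhos s0 mx m'x lab kmm' imm' right_lt left1 left2.
have s_ge0 := ltW s0.
have cm' : veq (coef3 (X k / X i) (hc k m' - hc k m) (hc i m' - hc i m)) (- s).
  by rewrite -kmm' subrr imm' addrC addKr; exact: (coef3_base1 rhos).
have mm' := maximizers_eq mx m'x.
apply: (dominant_absurd ic (ic_third ic m ki) m'x.1 cm') => n nF nm'.
have [hn|hn|hn] := ltgtP (hc k n - hc k m) 0.
- right; have [h1|h1] := eqVneq (hc k n - hc k m) (-1).
    by exists (- (2 * s)); [exact: (coef3_hN1 rhos)|have := left1 n nF h1; lra].
  exists 0; first exact: (coef3_le rhos s_ge0).
  by have : hc k n - hc k m < -1 by [lia]; move=> /(left2 n nF); lra.
- right; exists 0; first exact: (coef3_le rhos s_ge0).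
  by have := right_lt n nF hn; lra.
have [nx|nx] := pselect (maximizers F p n).
  left; case: (lab n nx) => [->|nm]; first by rewrite !subrr coef3_base0.
  by rewrite nm eqxx in nm'.
right; exists (- s); first exact: (coef3_h0 rhos s_ge0).
by have := maximizers_lt mx nF nx; lra.
Qed.

(** Let l be the distance from p to the end of the edge in the direction of v. If l < s, the
    monomial at that end dominates; if l > s or there is no end, m' does. The bounds needed on the
    other side come from [left_end_dominates]. Hence l = s. *)
Lemma vertex_of_line F v p t X k i s : inflection_config F p t X -> k != i ->
  veq (X k / X i) (- s) -> 0 < s -> p = v + s *: ray_dir R k ->
  exists m m' n, [/\ edge_at F v k m m' n, maximizers F p m, maximizers F p m',
    (forall n, maximizers F p n -> n = m \/ n = m') & hc i m' = hc i m + 1].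
Proof.
move=> ic ki rhos s0 pv.
have [m [m' [mx m'x kmm' imm' lab]]] := interior_label ic ki rhos s0.
have mm' : m != m' by apply: contra_eq_neq imm' => ->; apply/eqP; lia.
have nsF := ic_nonsingular ic.
have left_side := side_of_edge nsF (or_introl erefl : (1 : int) = 1 \/ 1 = -1) mx m'x mm' kmm' lab.
have right_side := side_of_edge nsF (or_intror erefl : (-1 : int) = 1 \/ -1 = -1) mx m'x mm' kmm' lab.
have vE : p + s *: ((-1)%:~R *: ray_dir R k) = v.
  by rewrite pv -addrA scaleN1r scalerN subrr addr0.
(* The bounds on the left-hand monomials that hold unless b comes before r. *)
have left_bounds r : 0 < r -> r <= s ->
    (forall n, n \in exps F -> 0 < hc k n - hc k m ->
       monomial_value F n p - monomial_value F m p <= - r) ->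
    (forall n, n \in exps F -> hc k n - hc k m = -1 ->
       monomial_value F n p - monomial_value F m p <= - r) /\
    (forall n, n \in exps F -> hc k n - hc k m < -1 ->
       monomial_value F n p - monomial_value F m p < - r).
  move=> r0 rs right_le.
  case: left_side => [h|[l [b [l0 bF]]]].
    by split=> n nF hn; have := h n nF; rewrite mul1r; lia.
  rewrite mul1r => hb bl [left_lt _ _ _].
  have rl : r <= l.
    rewrite leNgt; apply/negP => lr.
    apply: (left_end_dominates ic ki rhos s0 mx m'x lab kmm' imm' bF hb bl _ right_le lr rs).
    by move=> n nF nb hn; apply: left_lt; rewrite ?mul1r.
  split=> n nF; have [->|nb] := eqVneq n b => hn; rewrite ?bl; try lra.
  - by have := left_lt n nF nb; rewrite mul1r hn => /(_ isT); lra.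
  - by move: hn; rewrite hb ltxx.
  - have := left_lt n nF nb; rewrite mul1r => /(_ (lt_trans hn _)).
    by rewrite ltrN10 => /(_ isT); lra.
case: right_side => [h|[l [a [l0 aF ha al [right_lt mxl labl d1]]]]].
  have nopos n : n \in exps F -> 0 < hc k n - hc k m -> False.
    by move=> nF; have := h n nF; lia.
  have [|left1 left2] := left_bounds s s0 (lexx _).
    by move=> n nF /(nopos n nF).
  by case: (through_vertex_dominates ic ki rhos s0 mx m'x lab kmm' imm' _ left1 left2) => n nF /(nopos n nF).
have {}ha : hc k a - hc k m = 1 by lia.
have {}right_lt n : n \in exps F -> n != a -> 0 < hc k n - hc k m ->
    monomial_value F n p - monomial_value F m p < - l.
  by move=> nF na hn; apply: right_lt => //; lia.
have right_le n : n \in exps F -> 0 < hc k n - hc k m ->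
    monomial_value F n p - monomial_value F m p <= - l.
  move=> nF hn; have [->|na] := eqVneq n a; first by rewrite al.
  by apply: ltW; exact: right_lt.
have [ls|sl|ls] := ltgtP l s.
- have [left1 left2] := left_bounds l l0 (ltW ls) right_le.
  by case: (right_end_dominates ic ki rhos s0 mx m'x lab kmm' imm' aF ha al right_lt left1 left2 ls).
- have right_lt' n : n \in exps F -> 0 < hc k n - hc k m ->
      monomial_value F n p - monomial_value F m p < - s.
    by move=> nF hn; have := right_le n nF hn; lra.
  have [|left1 left2] := left_bounds s s0 (lexx _).
    by move=> n nF hn; apply: ltW; exact: right_lt'.
  by case: (through_vertex_dominates ic ki rhos s0 mx m'x lab kmm' imm' right_lt' left1 left2).
exists m, m', a; split => //; move: mxl labl; rewrite ls vE => mxl labl.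
split => //; [by apply: mxl; left|by apply: mxl; right; left|by apply: mxl; right; right|lia].
Qed.

End EdgeThroughInflection.

(** * A single edge of the curve along the line *)

Section OneEdge.
Variable R : realType.
Local Notation K := (puiseux R).
Local Notation exponent := (multinom 2).
Implicit Types (F : tropical_poly R) (p v : R * R) (k i j : 'I_3)
  (m n b : exponent) (s r l : R) (t : exponent -> K) (X : 'I_3 -> K).

Lemma edge_at_height F v k i m m' n : edge_at F v k m m' n -> k != i ->
  hc i m' = hc i m + 1 -> hc k n = hc k m + 1.
Proof.
move=> E ki imm'; have := edet_hc m m' n ki; have := ea_lt E.
by rewrite (ea_det E) imm' (ea_eq E) subrr mul0r sub0r normrN addrC addKr mul1r; lia.
Qed.

(** The loss of 2s comes from the coefficient for h = 0, half from the coefficient and half from the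
    ray for h = 1, and from the ray for h >= 2. Strictness comes from not being maximal, at p in the
    first case and at v in the others. *)
Lemma one_edge_bounds F v p t X k i s m m' n0 n : inflection_config F p t X ->
  k != i -> veq (X k / X i) (- s) -> 0 < s -> p = v + s *: ray_dir R k ->
  edge_at F v k m m' n0 -> maximizers F p m ->
  (forall n, maximizers F p n -> n = m \/ n = m') -> hc i m' = hc i m + 1 ->
  n \in exps F -> n != n0 -> hc k m <= hc k n ->
  coef2 (X k / X i) (hc k n - hc k m) (hc i n - hc i m) = 0 \/
  exists2 e, vle (coef2 (X k / X i) (hc k n - hc k m) (hc i n - hc i m)) e &
    monomial_value F n p + e < monomial_value F m p - 2 * s.
Proof.
move=> ic ki rhos s0 pv E mx lab imm' nF nn0 kn; have s_ge0 := ltW s0.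
have [hn0|hn0] := eqVneq (hc k n - hc k m) 0.
  have [nx|nx] := pselect (maximizers F p n); last first.
    right; exists (- (2 * s)); first exact: (coef2_h0 rhos).
    by have := maximizers_lt mx nF nx; lra.
  left; apply: coef2_base => //; case: (lab n nx) => ->; first by left; rewrite subrr.
  by right; rewrite imm' addrC addKr.
have vn : ~ maximizers F v n.
  move=> /(ea_lab E)[] hn; move: hn0; rewrite ?hn -?(ea_eq E) ?subrr ?eqxx//.
  by rewrite hn eqxx in nn0.
have := maximizers_lt (ea_m E) nF vn => lt.
right; have [h1|h1] := eqVneq (hc k n - hc k m) 1.
  exists (- s); first exact: (coef2_h1 rhos s_ge0).
  have kn1 : (hc k n)%:~R = (hc k m)%:~R + 1 :> R.
    by rewrite -[1]/(1%:~R) -intrD; congr (_%:~R); lia.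
  by rewrite pv !value_ray kn1; lra.
exists 0; first exact: (coef2_le rhos s_ge0).
have kn2 : (hc k m)%:~R + 2 <= (hc k n)%:~R :> R.
  by rewrite -[2]/(2%:~R) -intrD ler_int; lia.
rewrite pv !value_ray; move: kn2 s0 lt; move: (monomial_value _ _ _) (monomial_value _ _ _).
by move: (_%:~R) (_%:~R); clear => a b c d h1 h2 h3; nra.
Qed.

(** Two summands remain: n0, which is s + s below the maximum at p, and the far end b, which is l -
    s below. Neither may be alone, so l - s = 2s. The hypothesis on [hc i n0] gives the coefficient
    of n0, where h = 1, valuation exactly -s. *)
Lemma one_edge_length F v p t X k i s m m' n0 l b : inflection_config F p t X ->
  k != i -> veq (X k / X i) (- s) -> 0 < s -> p = v + s *: ray_dir R k ->
  edge_at F v k m m' n0 -> maximizers F p m ->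
  (forall n, maximizers F p n -> n = m \/ n = m') -> hc i m' = hc i m + 1 ->
  hc i n0 != hc i m -> s <= l ->
  maximizers F (v + l *: ray_dir R k) m ->
  maximizers F (v + l *: ray_dir R k) b -> hc k b = hc k m - 1 ->
  (forall n, maximizers F (v + l *: ray_dir R k) n -> [\/ n = m, n = m' | n = b]) ->
  l = 3 * s.
Proof.
move=> ic ki rhos s0 pv E mx lab imm' a0 sl lm lb hb labl.
have bounds := one_edge_bounds ic ki rhos s0 pv E mx lab imm'.
have s_ge0 := ltW s0; have n0F := (ea_n E).1.
have hn0 := edge_at_height E ki imm'.
have hn0R : (hc k n0)%:~R = (hc k m)%:~R + 1 :> R by rewrite hn0 intrD.
have hbR : (hc k b)%:~R = (hc k m)%:~R - 1 :> R by rewrite hb intrB.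
have cn0 : veq (coef2 (X k / X i) (hc k n0 - hc k m) (hc i n0 - hc i m)) (- s).
  by apply: (coef2_eq1 rhos) => //; [rewrite hn0 addrC addKr|rewrite subr_eq0].
have cb : veq (coef2 (X k / X i) (hc k b - hc k m) (hc i b - hc i m)) 0.
  by apply: (coef2_eq rhos) => //; rewrite hb addrC addKr.
have pn0 : monomial_value F n0 p = monomial_value F m p - s.
  by rewrite pv !value_ray (maximizers_eq (ea_n E) (ea_m E)) hn0R; lra.
have pb : monomial_value F b p = monomial_value F m p - (l - s).
  by have := maximizers_eq lb lm; rewrite pv !value_ray hbR; lra.
have left_lt n : n \in exps F -> n != b -> hc k n < hc k m ->
    monomial_value F n p < monomial_value F m p - (l - s).
  move=> nF nb hn.
  have : monomial_value F n (v + l *: ray_dir R k) < monomial_value F m (v + l *: ray_dir R k).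
    apply: maximizers_lt => // /labl[] e; move: hn; rewrite ?e ?(ea_eq E) ?ltxx//.
    by rewrite e eqxx in nb.
  have hnR : (hc k n)%:~R <= (hc k m)%:~R - 1 :> R.
    by rewrite -[1]/(1%:~R) -intrB ler_int; lia.
  rewrite pv !value_ray; move: hnR sl; move: (monomial_value _ _ _) (monomial_value _ _ _).
  by move: (_%:~R) (_%:~R); clear => a c d e h1 h2 h3; nra.
have [lt|gt|eq] := ltgtP (- (l - s)) (- (2 * s)); last by lra.
- case: (dominant_absurd ic (ic_second ic m ki) n0F cn0) => n nF nn0.
  have [kn|kn] := leP (hc k m) (hc k n).
    case: (bounds n nF nn0 kn) => [->|[e ce h]]; first by left.
    by right; exists e => //; rewrite pn0; lra.
  right; exists 0; first exact: (coef2_le rhos s_ge0).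
  have [->|nb] := eqVneq n b; first by rewrite pn0 pb; lra.
  by have := left_lt n nF nb kn; rewrite pn0; lra.
case: (dominant_absurd ic (ic_second ic m ki) lb.1 cb) => n nF nb.
have [kn|kn] := leP (hc k m) (hc k n); last first.
  right; exists 0; first exact: (coef2_le rhos s_ge0).
  by have := left_lt n nF nb kn; rewrite pb; lra.
have [nn0|nn0] := eqVneq n n0.
  right; exists (- s); first by rewrite nn0; case: cn0.
  by rewrite nn0 pn0 pb; lra.
case: (bounds n nF nn0 kn) => [->|[e ce h]]; first by left.
by right; exists e => //; rewrite pb; lra.
Qed.

Lemma one_edge_bounded F v p t X k i s m m' n0 : inflection_config F p t X ->
  k != i -> veq (X k / X i) (- s) -> 0 < s -> p = v + s *: ray_dir R k ->
  edge_at F v k m m' n0 -> maximizers F p m ->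
  (forall n, maximizers F p n -> n = m \/ n = m') -> hc i m' = hc i m + 1 ->
  hc i n0 != hc i m -> (forall n, n \in exps F -> hc k m <= hc k n) -> False.
Proof.
move=> ic ki rhos s0 pv E mx lab imm' a0 unb.
have bounds := one_edge_bounds ic ki rhos s0 pv E mx lab imm'.
have hn0 := edge_at_height E ki imm'.
have hn0R : (hc k n0)%:~R = (hc k m)%:~R + 1 :> R by rewrite hn0 intrD.
have cn0 : veq (coef2 (X k / X i) (hc k n0 - hc k m) (hc i n0 - hc i m)) (- s).
  by apply: (coef2_eq1 rhos) => //; [rewrite hn0 addrC addKr|rewrite subr_eq0].
have pn0 : monomial_value F n0 p = monomial_value F m p - s.
  by rewrite pv !value_ray (maximizers_eq (ea_n E) (ea_m E)) hn0R; lra.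
apply: (dominant_absurd ic (ic_second ic m ki) (ea_n E).1 cn0) => n nF nn0.
case: (bounds n nF nn0 (unb n nF)) => [->|[e ce h]]; first by left.
by right; exists e => //; rewrite pn0; lra.
Qed.

End OneEdge.

(** * Three edges of the curve along the line *)

Lemma neg_mult_le (R : realDomainType) (a c d : R) :
  0 < c -> d <= -1 -> a <= c * d -> a <= - c.
Proof. by move=> *; nra. Qed.

Section Triods.
Variable R : realType.
Local Notation K := (puiseux R).
Local Notation exponent := (multinom 2).
Implicit Types (F : tropical_poly R) (p v : R * R) (k i j : 'I_3)
  (m n b : exponent) (s r l : R) (t : exponent -> K) (X : 'I_3 -> K)
  (E : 'I_3 -> exponent) (o : option R).

Definition rel_exp E k n : int := hc k n - hc k (E k) + 1.

(* Near v the curve is a tropical line: up to a common factor, E k is the k-th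
   homogeneous variable. *)
Record triod F v E : Prop := Triod {
  tr_max : forall k, maximizers F v (E k);
  tr_rel : forall k i, rel_exp E k (E i) = (k == i)%:R;
  tr_lab : forall n, maximizers F v n -> exists k, n = E k }.

(* The k-th edge at v has length l if o is [Some l] and is unbounded if o is
   [None]. *)
Definition triod_side F v E k o : Prop :=
  match o with
  | None => forall n, n \in exps F -> 0 <= rel_exp E k n
  | Some l => 0 < l /\ exists b, [/\ b \in exps F, rel_exp E k b = -1,
      monomial_value F b v - monomial_value F (E k) v = - l &
      forall n, n \in exps F -> n != b -> rel_exp E k n < 0 ->
        monomial_value F n v - monomial_value F (E k) v < l * (rel_exp E k n)%:~R]
  end.

(** An unbounded edge counts as infinitely long. *)
Definition le_len l o : Prop := if o is Some l' then l <= l' else True.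
Definition lt_len l o : Prop := if o is Some l' then l < l' else True.

Section Fixed.
Variables (F : tropical_poly R) (v : R * R) (E : 'I_3 -> exponent).
Hypothesis tr : triod F v E.
Variables k i j : 'I_3.
Hypothesis uij : uniq [:: k; i; j].

Let mu n := monomial_value F n v - monomial_value F (E k) v.

Lemma triod_distinct : [/\ k != i, k != j & i != j].
Proof. by move: uij; rewrite /= !inE negb_or andbT => /andP[/andP[-> ->] ->]. Qed.

Lemma rel_exp_sum n : rel_exp E k n + rel_exp E i n + rel_exp E j n = 1.
Proof.
have [ki kj ij] := triod_distinct.
have e m := homog_sum (m ord0 : int) (m ord_max : int) uij.
have := e n; have := e (E k).
have := tr_rel tr k k; have := tr_rel tr i k; have := tr_rel tr j k.
rewrite !eqxx ![_ == k]eq_sym (negPf ki) (negPf kj) /rel_exp /hc.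
by move: (homog _ _ _) (homog _ _ _) (homog _ _ _); lia.
Qed.

(** Nonnegative integers of sum 1 form a unit vector. *)
Lemma rel_exp_E n : 0 <= rel_exp E k n -> 0 <= rel_exp E i n -> 0 <= rel_exp E j n ->
  exists c : 'I_3, n = E c.
Proof.
have [ki kj ij] := triod_distinct; have S := rel_exp_sum n.
move=> hk hi hj.
have inE' (l : 'I_3) : rel_exp E k n = rel_exp E k (E l) -> rel_exp E i n = rel_exp E i (E l) -> n = E l.
  by rewrite /rel_exp => /addIr/addIr h1 /addIr/addIr h2; exact: (hc_inj ki).
have [k1|k1] := eqVneq (rel_exp E k n) 1.
  by exists k; apply: inE'; rewrite !(tr_rel tr) ?eqxx ?[i == k]eq_sym ?(negPf ki)//=; lia.
have [i1|i1] := eqVneq (rel_exp E i n) 1.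
  by exists i; apply: inE'; rewrite !(tr_rel tr) ?eqxx ?(negPf ki)//=; lia.
by exists j; apply: inE'; rewrite !(tr_rel tr) ?(negPf kj) ?(negPf ij)//=; lia.
Qed.

Lemma mu_eq (l : 'I_3) : monomial_value F (E l) v = monomial_value F (E k) v.
Proof. by apply: maximizers_eq; exact: tr_max. Qed.

Lemma side_le (l : 'I_3) o n : triod_side F v E l o -> n \in exps F -> rel_exp E l n < 0 ->
  exists2 c, o = Some c & mu n <= c * (rel_exp E l n)%:~R /\ mu n <= - c.
Proof.
case: o => [c [c0 [b [bF hb bc bP]]]|h] nF hn; last by have := h n nF; lia.
exists c => //.
have hnR : (rel_exp E l n)%:~R <= -1 :> R.
  by apply: (le_trans (_ : _ <= (-1)%:~R)); rewrite ?ler_int//; lia.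
suff h : mu n <= c * (rel_exp E l n)%:~R by split => //; exact: neg_mult_le h.
rewrite /mu -(mu_eq l); have [->|nb] := eqVneq n b.
  by rewrite bc hb mulrN1.
by apply: ltW; exact: bP.
Qed.

Lemma side_neg n : n \in exps F -> (forall c : 'I_3, n <> E c) ->
  [\/ rel_exp E k n < 0, rel_exp E i n < 0 | rel_exp E j n < 0].
Proof.
move=> nF nE.
have [hk|hk] := ltP (rel_exp E k n) 0; first by constructor 1.
have [hi|hi] := ltP (rel_exp E i n) 0; first by constructor 2.
have [hj|hj] := ltP (rel_exp E j n) 0; first by constructor 3.
by have [l /nE] := rel_exp_E hk hi hj.
Qed.

Lemma triod_hc n : (hc k n - hc k (E j) = rel_exp E k n) *
  (hc i n - hc i (E j) = rel_exp E i n).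
Proof.
have [ki kj ij] := triod_distinct.
have := tr_rel tr k j; have := tr_rel tr i j.
by rewrite (negPf kj) (negPf ij) /rel_exp /= => h1 h2; split; lia.
Qed.

(** The second order condition ignores the three monomials of a line, so the balance is left to
    those that lie beyond the edges. *)
Lemma coef2_E (rho : K) (l : 'I_3) : coef2 rho (rel_exp E k (E l)) (rel_exp E i (E l)) = 0.
Proof.
have [ki kj ij] := triod_distinct; rewrite !(tr_rel tr).
have [<-|kl] := eqVneq k l.
  by rewrite [i == k]eq_sym (negPf ki) coef2E /= !(mulr0, mul0r, subrr, addr0).
by apply: coef2_base => //; case: (i == l); [right|left].
Qed.

End Fixed.
End Triods.

Section TriodInflection.
Variable R : realType.
Local Notation K := (puiseux R).
Local Notation exponent := (multinom 2).
Implicit Types (F : tropical_poly R) (p v : R * R) (k i j : 'I_3)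
  (m n b : exponent) (s r l : R) (t : exponent -> K) (X : 'I_3 -> K)
  (E : 'I_3 -> exponent) (o : option R).

Variables (F : tropical_poly R) (v p : R * R) (E : 'I_3 -> exponent)
  (t : exponent -> K) (X : 'I_3 -> K) (k i j : 'I_3) (s : R).
Hypotheses (tr : triod F v E) (uij : uniq [:: k; i; j]).
Hypotheses (ic : inflection_config F p t X) (rhos : veq (X k / X i) (- s)).
Hypotheses (s_ge0 : 0 <= s) (pv : p = v + s *: ray_dir R k).

Let mu n := monomial_value F n v - monomial_value F (E k) v.
Let h n := rel_exp E k n.
Let g n := rel_exp E i n.
Let c n := coef2 (X k / X i) (h n) (g n).

Lemma triod_second : \sum_(n <- exps F) t n * c n = 0.
Proof.
have [ki _ _] := triod_distinct uij.
rewrite -[RHS](ic_second ic (E j) ki); apply: eq_bigr => n _.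
by rewrite /c /h /g !(triod_hc tr uij).
Qed.

Lemma value_p n : monomial_value F n p = monomial_value F (E j) p + mu n - s * (h n)%:~R.
Proof.
rewrite pv !value_ray /mu (mu_eq tr k j) /h -(triod_hc tr uij n).1 intrB; ring.
Qed.

Lemma nonneg_bound n : 0 <= h n -> exists2 e, vle (c n) e &
  monomial_value F n p + e <= monomial_value F (E j) p + mu n - 2 * s.
Proof.
move=> hn; have s0 := s_ge0; rewrite value_p.
have [h0|h0] := eqVneq (h n) 0.
  by exists (- (2 * s)); [exact: (coef2_h0 rhos)|rewrite h0; lra].
have [h1|h1] := eqVneq (h n) 1.
  by exists (- s); [exact: (coef2_h1 rhos s_ge0)|rewrite h1; lra].
exists 0; first exact: (coef2_le rhos s_ge0).
have : 2 <= (h n)%:~R :> R.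
  by apply: (le_trans (_ : _ <= 2%:~R)); rewrite ?ler_int//; lia.
by move=> /(ler_wpM2l s0); lra.
Qed.

Lemma coef2_mem n : (exists l : 'I_3, n = E l) -> c n = 0.
Proof. by move=> [l ->]; rewrite /c (coef2_E tr uij). Qed.

Lemma inE_dec n : (exists l : 'I_3, n = E l) \/ (forall l : 'I_3, n <> E l).
Proof.
have [|ne] := pselect (exists l : 'I_3, n = E l); first by left.
by right => l nl; apply: ne; exists l.
Qed.

Lemma neg_bound l b n : s <= l -> triod_side F v E k (Some l) ->
  b \in exps F -> h b = -1 -> mu b = - l ->
  (forall n, n \in exps F -> n != b -> h n < 0 -> mu n < l * (h n)%:~R) ->
  n \in exps F -> n != b -> h n < 0 ->
  monomial_value F n p < monomial_value F (E j) p - l + s.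
Proof.
move=> sl _ bF hb mb bP nF nb hn; rewrite value_p.
have hnR : (h n)%:~R <= -1 :> R.
  by apply: (le_trans (_ : _ <= (-1)%:~R)); rewrite ?ler_int//; lia.
have lt := bP n nF nb hn.
have : (l - s) * (h n)%:~R <= - (l - s) by nra.
by lra.
Qed.

(** At p the far end of the k-th edge is l - s below [E j], with a coefficient of valuation 0. Among
    h < 0 it is the largest; the last hypothesis puts the others below it. *)
Lemma far_end_dominates l : 0 < s -> s <= l -> triod_side F v E k (Some l) ->
  (forall n, n \in exps F -> 0 <= h n -> (forall c : 'I_3, n <> E c) ->
     mu n - 2 * s < s - l) -> False.
Proof.
move=> s0 sl side bound; have [l0 [b [bF hb mb bP]]] := side.
have cb : veq (c b) 0 by apply: (coef2_eq rhos) => //; rewrite -/(h b) /h hb.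
apply: (dominant_absurd ic triod_second bF cb) => n nF nb.
have pb : monomial_value F b p = monomial_value F (E j) p - l + s.
  by rewrite value_p /mu mb /h hb; lra.
have [hn|hn] := ltP (h n) 0.
  right; exists 0; first exact: (coef2_le rhos s_ge0).
  by have := neg_bound sl side bF hb mb bP nF nb hn; rewrite pb; lra.
have [nE|nE] := inE_dec n; first by left; exact: coef2_mem.
right; have [e ce le] := nonneg_bound hn; exists e => //.
by have := bound n nF hn nE; rewrite pb; lra.
Qed.

Lemma side_nonneg li lj n : triod_side F v E i li -> triod_side F v E j lj ->
  n \in exps F -> 0 <= h n -> (forall c : 'I_3, n <> E c) ->
  exists2 l, (li = Some l \/ lj = Some l) & mu n <= - l.
Proof.
move=> si sj nF hn nE; case: (side_neg tr uij nF nE) => hr.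
- by move: hn; rewrite leNgt hr.
- by have [l e [_ le]] := side_le tr uij si nF hr; exists l; [left|].
- by have [l e [_ le]] := side_le tr uij sj nF hr; exists l; [right|].
Qed.

(** If neither other edge is shorter than the k-th, all competitors of its far end are at least l +
    2s below, against l - s. *)
Lemma longest_needed l oi oj : 0 < s -> s <= l -> triod_side F v E k (Some l) ->
  triod_side F v E i oi -> triod_side F v E j oj ->
  le_len l oi -> le_len l oj -> False.
Proof.
move=> s0 sl sk si sj li lj; apply: (far_end_dominates s0 sl sk) => n nF hn nE.
have [l' ll' mn] := side_nonneg si sj nF hn nE.
suff : l <= l' by lra.
by case: ll' => e; [move: li; rewrite e|move: lj; rewrite e].
Qed.

(** By [longest_needed] the i-th edge is the unique shortest one. Only two summands can then be the
    largest: its far end, li + 2s below, and that of the k-th edge, l - s below. *)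
Lemma shortest_length li oj ok : 0 < s -> (forall l, ok = Some l -> s <= l) ->
  triod_side F v E k ok -> triod_side F v E i (Some li) -> triod_side F v E j oj ->
  lt_len li oj -> exists2 l, ok = Some l & l - li = 3 * s.
Proof.
move=> s0 sok sk si sj lj; have [ki kj ij] := triod_distinct uij.
have lk l : ok = Some l -> li < l.
  move=> e; rewrite ltNge; apply/negP => lli.
  apply: (@longest_needed l (Some li) oj) => //; rewrite -?e//.
    exact: sok.
  by case: (oj) lj => //= l'; lra.
have [li0 [b [bF gb mb bP]]] := si.
have mub : mu b = - li by rewrite /mu -(mu_eq tr k i).
have hb : 0 <= h b.
  rewrite leNgt; apply/negP => hb; have [l e [_ le]] := side_le tr uij sk bF hb.
  by have := lk l e; rewrite -/(mu b) in le; lra.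
have fb : 0 <= rel_exp E j b.
  rewrite leNgt; apply/negP => fb; have [l e [_ le]] := side_le tr uij sj bF fb.
  by move: lj; rewrite e /= -/(mu b) in le *; lra.
have hgf := rel_exp_sum tr uij b; rewrite gb in hgf.
have bnE (d : 'I_3) : b <> E d.
  by move=> bd; move: gb; rewrite bd (tr_rel tr); case: (i == d).
(* As g = -1 and the three exponents sum to 1, h is 0, 1 or 2. The loss hs along the ray and the
   valuation of the coefficient always add up to -2s. *)
have [e ce be] : exists2 e, veq (c b) e &
    monomial_value F b p + e = monomial_value F (E j) p - li - 2 * s.
  rewrite value_p mub.
  have [h0|h0] := eqVneq (h b) 0.
    exists (- (2 * s)); last by rewrite h0; lra.
    by apply: (coef2_eq0 rhos) => //; rewrite /g gb.
  have [h1|h1] := eqVneq (h b) 1.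
    exists (- s); last by rewrite h1; lra.
    by apply: (coef2_eq1 rhos) => //; rewrite /g gb.
  have h2 : h b = 2 by rewrite /h in h0 h1 hb *; lia.
  exists 0; last by rewrite h2; lra.
  by apply: (coef2_eq rhos).
have pos_lt n : n \in exps F -> n != b -> 0 <= h n -> (forall d : 'I_3, n <> E d) ->
    mu n < - li.
  move=> nF nb hn nE; case: (side_neg tr uij nF nE) => hr.
  - by move: hn; rewrite leNgt hr.
  - have hrR : (rel_exp E i n)%:~R <= -1 :> R.
      by apply: (le_trans (_ : _ <= (-1)%:~R)); rewrite ?ler_int//; lia.
    have := bP n nF nb hr; rewrite (mu_eq tr k i) -/(mu n).
    by move=> lt; nra.
  - have [l e' [_ le]] := side_le tr uij sj nF hr.
    by move: lj; rewrite e' /= -/(mu n) in le *; lra.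
have domi : (forall n, n \in exps F -> h n < 0 ->
    monomial_value F n p < monomial_value F (E j) p - li - 2 * s) -> False.
  move=> neg; apply: (dominant_absurd ic triod_second bF ce) => n nF nb.
  have [hn|hn] := ltP (h n) 0.
    right; exists 0; first exact: (coef2_le rhos s_ge0).
    by have := neg n nF hn; lra.
  have [nE|nE] := inE_dec n; first by left; exact: coef2_mem.
  right; have [e' ce' le] := nonneg_bound hn; exists e' => //.
  by have := pos_lt n nF nb hn nE; lra.
case: ok sk sok lk => [l|] sk sok lk; last first.
  by case: domi => n nF; have := sk n nF; rewrite -/(h n) leNgt => /negP.
exists l => //; have sl := sok l erefl.
have [l0 [b' [b'F hb' mb' b'P]]] := sk.
have [lt|gt|//] := ltgtP (l - li) (3 * s); last first.
  case: domi => n nF hn; have [->|nb'] := eqVneq n b'.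
    by rewrite value_p /h hb' /mu mb'; lra.
  by have := neg_bound sl sk b'F hb' mb' b'P nF nb' hn; lra.
exfalso; apply: (far_end_dominates s0 sl sk) => n nF hn nE.
have [->|nb] := eqVneq n b; first by rewrite mub; lra.
by have := pos_lt n nF nb hn nE; lra.
Qed.

(** The far ends of the two equal edges may cancel each other, so only the dominance of the k-th far
    end can be excluded, and an inequality is left. *)
Lemma equal_lengths l l' : 0 < s -> s <= l -> triod_side F v E k (Some l) ->
  triod_side F v E i (Some l') -> triod_side F v E j (Some l') -> 3 * s <= l - l'.
Proof.
move=> s0 sl sk si sj; rewrite leNgt; apply/negP => lt.
apply: (far_end_dominates s0 sl sk) => n nF hn nE.
have [d dd mn] := side_nonneg si sj nF hn nE.
have e : l' = d by case: dd => -[].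
by rewrite -e in mn; lra.
Qed.

End TriodInflection.

(** * Inflection points at the vertex of the line *)

Lemma binomial_relations (L : comNzRingType) (a b : int) (r : L) :
  a%:~R - b%:~R * r = 0 ->
  (a * (a - 1))%:~R - (2 * a * b)%:~R * r + (b * (b - 1))%:~R * (r * r) = 0 ->
  a%:~R * (1 + r) = 0.
Proof.
move=> /subr0_eq ab; rewrite !rmorphM !rmorphB /= ab => h.
by rewrite -[LHS]opprK -[RHS]oppr0 -h; ring.
Qed.

Section InflectionAtVertex.
Variable R : realType.
Local Notation K := (puiseux R).
Local Notation C := (R[i]).
Local Notation exponent := (multinom 2).
Implicit Types (F : tropical_poly R) (p v : R * R) (k i j : 'I_3)
  (m n b : exponent) (s r l : R) (t : exponent -> K) (X : 'I_3 -> K)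
  (E : 'I_3 -> exponent) (o : option R).

Lemma lead_int_rho (rho : K) (a b c : int) : veq rho 0 ->
  (a%:~R - b%:~R * rho + c%:~R * (rho * rho)) 0 =
  a%:~R - b%:~R * rho 0 + c%:~R * (rho 0 * rho 0) :> C.
Proof.
move=> [r0 _]; have z0 (z : int) : (z%:~R : K) 0 = z%:~R by rewrite pcoef_int eqxx mulr1.
have rr : vle (rho * rho) 0 by apply: (vleM_to r0 r0); rewrite addr0.
by rewrite !pcoefD pcoefN !lead0M ?z0//; exact: vle_int.
Qed.

(** Here rho has valuation 0 and powers of it no longer separate the summands. Instead, m' may not
    dominate either relation normalized at m, so its leading coefficients vanish;
    [binomial_relations] and 1 + rho(0) != 0 then give a = 0 and b = 0. *)
Lemma no_pair F p t X k i m m' : inflection_config F p t X -> k != i ->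
  veq (X k / X i) 0 -> veq (1 + X k / X i) 0 ->
  maximizers F p m -> maximizers F p m' -> m != m' ->
  (forall n, maximizers F p n -> n = m \/ n = m') -> False.
Proof.
move=> ic ki; have [rho rhoE] : exists rho, rho = X k / X i by exists (X k / X i).
rewrite -rhoE => rho0 rho1 mx m'x mm' lab.
have rhos : veq rho (- 0) by rewrite oppr0.
set a := hc k m' - hc k m; set b := hc i m' - hc i m.
have lead (c : int -> int -> K) : c 0 0 = 0 -> (forall h g, vle (c h g) 0) ->
    \sum_(n <- exps F) t n * c (hc k n - hc k m) (hc i n - hc i m) = 0 -> c a b 0 = 0.
  move=> c00 cle S0; apply: contrapT => /eqP cab.
  have ca : veq (c a b) 0 by split; rewrite ?oppr0.
  apply: (dominant_absurd ic S0 m'x.1 ca) => n nF nm'.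
  have [nx|nx] := pselect (maximizers F p n).
    left; case: (lab n nx) => [->|e]; first by rewrite !subrr.
    by rewrite e eqxx in nm'.
  right; exists 0 => //.
  by rewrite ltrD2r; exact: maximizers_lt.
have l1 : a%:~R - b%:~R * rho 0 = 0 :> C.
  have := lead (coef1 rho); rewrite /coef1 mul0r subrr => /(_ erefl (coef1_le rhos (lexx 0))).
  rewrite rhoE => /(_ (ic_first ic m ki)); rewrite -rhoE.
  have := lead_int_rho a b 0 rho0; rewrite !mul0r !addr0 => ->.
  by [].
have l2 : (a * (a - 1))%:~R - (2 * a * b)%:~R * rho 0 +
    (b * (b - 1))%:~R * (rho 0 * rho 0) = 0 :> C.
  have := lead (coef2 rho).
  rewrite (coef2_base _ (erefl 0) (or_introl erefl)) => /(_ erefl (coef2_le rhos (lexx 0))).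
  by rewrite rhoE => /(_ (ic_second ic m ki)); rewrite -rhoE coef2E lead_int_rho.
have r0 : rho 0 != 0 by case: rho0 => _; rewrite oppr0.
have r1 : 1 + rho 0 != 0 by case: rho1 => _; rewrite oppr0 pcoefD pcoef1 eqxx.
have /eqP := binomial_relations l1 l2.
rewrite mulf_eq0 (negPf r1) orbF intr_eq0 => /eqP a0.
have b0 : b = 0.
  apply/eqP; have := l1; rewrite a0 sub0r => /eqP.
  by rewrite oppr_eq0 mulf_eq0 (negPf r0) orbF intr_eq0.
move/eqP: mm'; apply; apply/esym; apply: (hc_inj ki); lia.
Qed.

Lemma vertex_label F p t X k i : inflection_config F p t X -> k != i ->
  veq (X k / X i) 0 -> veq (1 + X k / X i) 0 ->
  exists m0 m1 m2, [/\ maximizers F p m0, maximizers F p m1, maximizers F p m2,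
    `|edet m0 m1 m2| = 1 &
    forall m, maximizers F p m -> [\/ m = m0, m = m1 | m = m2]].
Proof.
move=> ic ki rho0 rho1.
have [m mx] := ic_max ic; have [m' m'x m'm] := ic_two ic mx.
have mm' : m != m' by rewrite eq_sym.
have [n [nF d1] lab] := pair_label (ic_nonsingular ic) mx m'x (ic_plane ic mx.1 m'x.1 mm').
have [nx|nx] := pselect (maximizers F p n); first by exists m, m', n.
case: (no_pair ic ki rho0 rho1 mx m'x mm') => n' h.
by case: (lab n' h) => [->|->|e]; [left|right|move: h; rewrite e].
Qed.

(** The far end of a unique shortest edge dominates. Its coefficient, with h = -1, is 2, 2 (1 + rho)
    or 2 (1 + rho)^2 for g = 0, 1, 2, always of valuation 0. *)
Lemma unique_shortest F v t X E k i j l oi oj : triod F v E -> uniq [:: k; i; j] ->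
  inflection_config F v t X -> veq (X k / X i) 0 -> veq (1 + X k / X i) 0 ->
  triod_side F v E k (Some l) -> triod_side F v E i oi -> triod_side F v E j oj ->
  lt_len l oi -> lt_len l oj -> False.
Proof.
move=> tr uij ic rho0 rho1 sk si sj li lj.
have rhos : veq (X k / X i) (- 0) by rewrite oppr0.
have vv : v = v + 0 *: ray_dir R k by rewrite scale0r addr0.
have S0 := triod_second tr uij ic.
have [l0 [b [bF hb mb bP]]] := sk.
have gb : 0 <= rel_exp E i b.
  rewrite leNgt; apply/negP => gb; have [l' e [_ le]] := side_le tr uij si bF gb.
  by move: li; rewrite e /=; lra.
have fb : 0 <= rel_exp E j b.
  rewrite leNgt; apply/negP => fb; have [l' e [_ le]] := side_le tr uij sj bF fb.
  by move: lj; rewrite e /=; lra.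
have hgf := rel_exp_sum tr uij b; rewrite hb in hgf.
have cb : veq (coef2 (X k / X i) (rel_exp E k b) (rel_exp E i b)) 0.
  rewrite hb; set rho := X k / X i in rho0 rho1 *.
  have two : veq (2%:~R : K) 0 by exact: veq_int.
  have two1 : veq (2%:~R * (1 + rho)) 0 by apply: veqM_to two rho1 _; rewrite addr0.
  have [g0|g0] := eqVneq (rel_exp E i b) 0.
    have -> : coef2 rho (-1) (rel_exp E i b) = 2%:~R by rewrite g0 coef2E; ring.
    by [].
  have [g1|g1] := eqVneq (rel_exp E i b) 1.
    have -> : coef2 rho (-1) (rel_exp E i b) = 2%:~R * (1 + rho) by rewrite g1 coef2E; ring.
    by [].
  have g2 : rel_exp E i b = 2 by lia.
  have -> : coef2 rho (-1) (rel_exp E i b) = 2%:~R * (1 + rho) * (1 + rho).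
    by rewrite g2 coef2E; ring.
  by apply: veqM_to two1 rho1 _; rewrite addr0.
apply: (dominant_absurd ic S0 bF cb) => n nF nb.
have [nE|nE] := inE_dec E n; first by left; exact: (coef2_mem X tr uij).
right; exists 0; first exact: (coef2_le rhos (lexx 0)).
case: (side_neg tr uij nF nE) => hr.
- have hrR : (rel_exp E k n)%:~R <= -1 :> R.
    by apply: (le_trans (_ : _ <= (-1)%:~R)); rewrite ?ler_int//; lia.
  have lt := bP n nF nb hr.
  have : l * (rel_exp E k n)%:~R <= - l by nra.
  by lra.
- have [l' e [_ le]] := side_le tr uij si nF hr.
  by move: li; rewrite e /=; lra.
- have [l' e [_ le]] := side_le tr uij sj nF hr.
  by move: lj; rewrite e /=; lra.
Qed.

End InflectionAtVertex.

(** * Edges at a vertex *)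

Section VertexRays.
Variable R : realType.
Local Notation K := (puiseux R).
Local Notation exponent := (multinom 2).
Implicit Types (F : tropical_poly R) (P : mpoly 2 K) (v : R * R) (k : 'I_3)
  (m n : exponent) (s : R) (o : option R).

(** Just after v, the monomials with the smallest k-th exponent win. If there are two, they span an
    edge along the ray; a single one keeps the curve off the ray; three would be collinear. *)
Lemma vertex_ray_min F v k m0 m1 m2 :
  maximizers F v m0 -> maximizers F v m1 -> maximizers F v m2 ->
  `|edet m0 m1 m2| = 1 ->
  (forall m, maximizers F v m -> [\/ m = m0, m = m1 | m = m2]) ->
  hc k m0 <= hc k m1 -> hc k m0 <= hc k m2 ->
  (exists m m' n, edge_at F v k m m' n) \/
  exists2 e, 0 < e & forall s m, 0 < s < e ->
    maximizers F (v + s *: ray_dir R k) m -> m = m0.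
Proof.
move=> h0 h1 h2 d1 lab; rewrite !le_eqVlt => /orP[/eqP e1|lt1] /orP[/eqP e2|lt2].
- have [i [j uij]] := ord3_pick k.
  have ki : k != i by move: uij; rewrite /= !inE; case: eqP.
  have := edet_hc m0 m1 m2 ki.
  by rewrite d1 -e1 -e2 subrr mul0r mulr0 subrr normr0.
- by left; exists m0, m1, m2; split.
- left; exists m0, m2, m1; split => //; first by rewrite edet_perm3 normrN.
  by move=> m /lab[]; [constructor 1|constructor 3|constructor 2].
right; apply: unique_after => // m /lab[] ->; rewrite ?eqxx// !slope_ray ltrN2 ltr_int//.
Qed.

Lemma vertex_ray F v k m0 m1 m2 :
  maximizers F v m0 -> maximizers F v m1 -> maximizers F v m2 ->
  `|edet m0 m1 m2| = 1 ->
  (forall m, maximizers F v m -> [\/ m = m0, m = m1 | m = m2]) ->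
  (exists m m' n, edge_at F v k m m' n) \/
  exists m, exists2 e, 0 < e & forall s m', 0 < s < e ->
    maximizers F (v + s *: ray_dir R k) m' -> m' = m.
Proof.
move=> h0 h1 h2 d1 lab.
have lab1 m : maximizers F v m -> [\/ m = m1, m = m2 | m = m0].
  by move=> /lab[]; [constructor 3|constructor 1|constructor 2].
have lab2 m : maximizers F v m -> [\/ m = m2, m = m0 | m = m1].
  by move=> /lab[]; [constructor 2|constructor 3|constructor 1].
have d2 : `|edet m1 m2 m0| = 1 by rewrite -edet_rot.
have d3 : `|edet m2 m0 m1| = 1 by rewrite -edet_rot.
have [le01|/ltW le10] := leP (hc k m0) (hc k m1).
  have [le02|/ltW le20] := leP (hc k m0) (hc k m2).
    by have [|h] := vertex_ray_min h0 h1 h2 d1 lab le01 le02; [left|right; exists m0].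
  have le21 := le_trans le20 le01.
  by have [|h] := vertex_ray_min h2 h0 h1 d3 lab2 le20 le21; [left|right; exists m2].
have [le12|/ltW le21] := leP (hc k m1) (hc k m2).
  by have [|h] := vertex_ray_min h1 h2 h0 d2 lab1 le12 le10; [left|right; exists m1].
have le20 := le_trans le21 le10.
by have [|h] := vertex_ray_min h2 h0 h1 d3 lab2 le20 le21; [left|right; exists m2].
Qed.

Definition arm_range o : set R := if o is Some l then [set s | 0 <= s <= l] else half_line.

Definition arm_face F v k o (e : face F) : Prop :=
  face_set e = arm v k (arm_range o) /\
  match o with
  | Some l => [/\ 0 < l, bounded_edge e, edge_length e = l &
      forall s, 0 <= s -> edge_dist e v (v + s *: ray_dir R k) = s]
  | None => unbounded_edge e
  end.

Definition edge_end F v k m m' o : Prop :=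
  match o with
  | Some l => [/\ 0 < l,
      (forall s, 0 <= s -> maximizers F (v + s *: ray_dir R k) m <-> s <= l) &
      exists b, [/\ maximizers F (v + l *: ray_dir R k) b, hc k b = hc k m - 1 &
        forall m0, maximizers F (v + l *: ray_dir R k) m0 -> [\/ m0 = m, m0 = m' | m0 = b]]]
  | None => forall n, n \in exps F -> hc k m <= hc k n
  end.

Lemma unbounded_along F v k m m' n : edge_at F v k m m' n ->
  (forall n, n \in exps F -> hc k m <= hc k n) ->
  forall s, 0 <= s -> maximizers F (v + s *: ray_dir R k) m.
Proof.
move=> E unb s s0; split; first by case: (ea_m E).
move=> m0 m0F; rewrite !value_ray; apply: lerB; first by case: (ea_m E) => _; exact.
by rewrite ler_wpM2l// ler_int; exact: unb.
Qed.

Lemma Trop_along P v k m m' n s r : let F := tropicalize P in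
  edge_at F v k m m' n -> 0 <= s -> s < r -> maximizers F (v + r *: ray_dir R k) m ->
  Trop (curve P) (v + s *: ray_dir R k).
Proof.
move=> F E s0 sr mr.
have ms : maximizers F (v + s *: ray_dir R k) m.
  by apply: (edge_convex E) mr; rewrite s0 ltW.
have m's := edge_along (ea_m E) (ea_m' E) (ea_eq E) ms.
apply: (tropical_lift ms m's (ea_det E)).
have [<-|s_neq0] := eqVneq 0 s; first by rewrite scale0r addr0; exact: ea_lab E.
have s_gt0 : 0 < s by rewrite lt_neqAle s_neq0.
move=> m0; rewrite -/F (edge_label E s_gt0 sr mr).
by move=> [->|->]; [constructor 1|constructor 2].
Qed.

Lemma unbounded_arm P v k m m' n : let F := tropicalize P in
  edge_at F v k m m' n -> (forall n, n \in exps F -> hc k m <= hc k n) ->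
  exists2 e : face F, arm_face v k None e &
    forall s, 0 <= s -> Trop (curve P) (v + s *: ray_dir R k).
Proof.
move=> F E unb; have along := unbounded_along E unb.
have [e ue fe] := edge_unbounded E along.
exists e => // s s0; have s1 : 0 <= s + 1 by rewrite addr_ge0.
by apply: (Trop_along E s0 _ (along _ s1)); rewrite ltrDl.
Qed.

Lemma edge_arm P v k m m' n : let F := tropicalize P in
  nonsingular F -> edge_at F v k m m' n ->
  exists o (e : face F), [/\ arm_face v k o e, edge_end F v k m m' o &
    arm_spec (Trop (curve P)) v k (arm_range o)].
Proof.
move=> F nsF E.
have [unb|nunb] := pselect (forall n, n \in exps F -> hc k m <= hc k n).
  have [e fe Te] := unbounded_arm E unb.
  by exists None, e; split => //; left.
have [|l [b [l0 lP [lb hb d1] lab [eps eps0 epsP]]]] := edge_far_end nsF E.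
  apply: contrapT => h; apply: nunb => b bF; rewrite leNgt; apply/negP => hb.
  by apply: h; exists b.
have [e [be fe le de]] := edge_bounded E l0 lP.
have lm : maximizers F (v + l *: ray_dir R k) m by apply/lP => //; exact: ltW.
have lm' := edge_along (ea_m E) (ea_m' E) (ea_eq E) lm.
exists (Some l), e; split => //; first by split => //; exists b.
right; exists l; split => //; first exact: ltW.
  move=> s /andP[s0]; rewrite le_eqVlt => /orP[/eqP->|sl].
    exact: (tropical_lift lm lm' d1 lab).
  exact: (Trop_along E s0 sl lm).
exists eps => // s ls Ts.
have [m0 m0s] : exists m0, maximizers F (v + s *: ray_dir R k) m0.
  by apply: (@exists_maximizer R F _ m); case: (ea_m E).
have [m1 m1s m1m0] := Trop_two Ts m0s.
by move/eqP: m1m0; apply; rewrite (epsP s ls m0)// (epsP s ls m1).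
Qed.

Lemma vertex_arm P v k m0 m1 m2 : let F := tropicalize P in
  nonsingular F ->
  maximizers F v m0 -> maximizers F v m1 -> maximizers F v m2 ->
  `|edet m0 m1 m2| = 1 ->
  (forall m, maximizers F v m -> [\/ m = m0, m = m1 | m = m2]) ->
  (exists m m' n, edge_at F v k m m' n) \/
  arm_spec (Trop (curve P)) v k [set 0].
Proof.
move=> F nsF h0 h1 h2 d1 lab.
have [|[m [e e0 eP]]] := vertex_ray k h0 h1 h2 d1 lab; first by left.
have Tv : Trop (curve P) v := tropical_lift h0 h1 d1 lab.
right; right; exists 0; split => //.
- by apply/seteqP; split => s /=; [move=> ->; rewrite lexx|rewrite -eq_le => /eqP].
- by move=> s; rewrite -eq_le => /eqP <-; rewrite scale0r addr0.
exists e => // s; rewrite add0r => se Ts.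
have [n ns] : exists n, maximizers F (v + s *: ray_dir R k) n.
  by apply: (@exists_maximizer R F _ m0); case: h0.
have [n' n's n'n] := Trop_two Ts ns.
by move/eqP: n'n; apply; rewrite (eP s n)// (eP s n').
Qed.

Lemma arm_specI (A B : set (R * R)) v k J : arm_spec A v k J ->
  (forall s, 0 <= s -> B (v + s *: ray_dir R k)) -> arm_spec (A `&` B) v k J.
Proof.
move=> AJ Bs; case: AJ => [[-> h]|[l [l0 -> h [e e0 he]]]].
  by left; split => // s s0; split; [exact: h|exact: Bs].
right; exists l; split => //.
  by move=> s sl; split; [exact: h|apply: Bs; case/andP: sl].
by exists e => // s sl [As _]; exact: (he s).
Qed.

(* The edges at a vertex of a tropical curve that follow the rays of a tropical
   line with the same vertex: there are none, one, or three of them. *)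
Lemma edge_orient F v k i m m' n : edge_at F v k m m' n -> k != i ->
  exists m0 m0', edge_at F v k m0 m0' n /\ hc i m0' = hc i m0 + 1 /\
    ((m0 = m /\ m0' = m') \/ (m0 = m' /\ m0' = m)).
Proof.
move=> E ki.
have : `|hc i m' - hc i m| = 1.
  have := edet_hc m m' n ki.
  rewrite (ea_det E) (ea_eq E) subrr mul0r sub0r normrN normrM.
  have := ea_lt E; rewrite (ea_eq E).
  move: `|hc i m' - hc i m| (normr_ge0 (hc i m' - hc i m)) => a a0.
  by move: (hc k n) (hc k m') => x y h1 h2; nia.
move=> d; have [d'|d'] : hc i m' = hc i m + 1 \/ hc i m = hc i m' + 1 by lia.
  by exists m, m'; do !split => //; left.
exists m', m; split; last by split => //; right.
case: E => h1 h2 h3 h4 h5 h6 h7; split => //.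
- by rewrite -h4.
- by rewrite edet_rot edet_perm3 normrN.
- by move=> m0 /h7[]; [constructor 2|constructor 1|constructor 3].
Qed.

(** Relative to m, in the k-th and i-th exponents, the triangle is (0, 0), (0, 1), (1, a) with a
    nonzero. An edge along another ray needs two equal exponents below the third, which fails for
    (0, 1, a) and for (0, -1, -1 - a). *)
Lemma one_edge F v k i j m m' n : uniq [:: k; i; j] -> edge_at F v k m m' n ->
  hc i m' = hc i m + 1 -> hc i n != hc i m ->
  forall m1 m1' n1, ~ edge_at F v i m1 m1' n1 /\ ~ edge_at F v j m1 m1' n1.
Proof.
move=> uij E imm' a0 m1 m1' n1.
have [ki kj ij] := triod_distinct uij.
have kn := edge_at_height E ki imm'.
have S := fun m => homog_sum (m ord0 : int) (m ord_max : int) uij.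
have Sm : hc k m + hc i m + hc j m = 0 := S m.
have Sm' : hc k m' + hc i m' + hc j m' = 0 := S m'.
have Sn : hc k n + hc i n + hc j n = 0 := S n.
have kmm' := ea_eq E; have lab := ea_lab E.
have h (r : 'I_3) (x y z : int) : hc r m = x -> hc r m' = y -> hc r n = z ->
    edge_at F v r m1 m1' n1 ->
    [\/ x = y /\ x < z, y = z /\ y < x | x = z /\ x < y].
  move=> <- <- <- E1; have := ea_eq E1; have := ea_lt E1.
  have [n1' n2' n3'] : [/\ m1 != m1', m1 != n1 & m1' != n1].
    by apply: edet_neq; rewrite -normr_eq0 (ea_det E1).
  move: n1' n2' n3'.
  case: (lab _ (ea_m E1)) => ->; case: (lab _ (ea_m' E1)) => ->; case: (lab _ (ea_n E1)) => ->;
    rewrite ?eqxx// => _ _ _ lt eq;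
    first [by constructor 1; rewrite ?eq -?eq; split; rewrite // ?eq -?eq
          |by constructor 2; rewrite ?eq -?eq; split; rewrite // ?eq -?eq
          |by constructor 3; rewrite ?eq -?eq; split; rewrite // ?eq -?eq].
split=> E1.
  by case: (h i _ _ _ erefl erefl erefl E1) => -[e lt]; lia.
by case: (h j _ _ _ erefl erefl erefl E1) => -[e lt]; lia.
Qed.

(** The triangle is now a translate of the Newton polygon of a line. *)
Lemma three_edges F v k i j m m' n : uniq [:: k; i; j] -> edge_at F v k m m' n ->
  hc i m' = hc i m + 1 -> hc i n = hc i m ->
  exists E, [/\ triod F v E, E k = n, E i = m' & E j = m].
Proof.
move=> uij E imm' a0.
have [ki kj ij] := triod_distinct uij.
have kn := edge_at_height E ki imm'.
have S := fun m => homog_sum (m ord0 : int) (m ord_max : int) uij.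
have Sm : hc k m + hc i m + hc j m = 0 := S m.
have Sm' : hc k m' + hc i m' + hc j m' = 0 := S m'.
have Sn : hc k n + hc i n + hc j n = 0 := S n.
have kmm' := ea_eq E.
pose G l := if l == k then n else if l == i then m' else m.
have Gk : G k = n by rewrite /G eqxx.
have Gi : G i = m' by rewrite /G eq_sym (negPf ki) eqxx.
have Gj : G j = m by rewrite /G ![j == _]eq_sym (negPf kj) (negPf ij).
exists G; split => //; split.
- move=> l; case: (ord3_cases l uij) => ->; rewrite ?Gk ?Gi ?Gj.
  + exact: ea_n E.
  + exact: ea_m' E.
  + exact: ea_m E.
- move=> l l'; rewrite /rel_exp.
  case: (ord3_cases l uij) => ->; case: (ord3_cases l' uij) => ->;
    rewrite ?Gk ?Gi ?Gj ?eqxx ?(negPf ki) ?(negPf kj) ?(negPf ij)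
      ?[i == k]eq_sym ?[j == k]eq_sym ?[j == i]eq_sym ?(negPf ki) ?(negPf kj) ?(negPf ij) /=; lia.
- move=> m0 /(ea_lab E)[] ->; [exists j|exists i|exists k]; by rewrite ?Gk ?Gi ?Gj.
Qed.

Lemma triod_edge F v E k i j : triod F v E -> uniq [:: k; i; j] ->
  edge_at F v k (E j) (E i) (E k).
Proof.
move=> tr uij; have [ki kj ij] := triod_distinct uij.
have rel := tr_rel tr; have hk := triod_hc tr uij.
have kj' := rel k j; have ki' := rel k i; have kk := rel k k.
have ii := rel i i; have ik := rel i k; have ij' := rel i j.
move: kj' ki' kk ii ik ij'; rewrite !eqxx (negPf kj) (negPf ki) [i == k]eq_sym (negPf ki) (negPf ij).
rewrite /rel_exp /= => kj' ki' kk ii ik ij'.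
split; [exact: tr_max|exact: tr_max|exact: tr_max|lia|lia| |].
  rewrite -(edet_hc _ _ _ ki).
  have -> : hc k (E i) - hc k (E j) = 0 by lia.
  have -> : hc i (E i) - hc i (E j) = 1 by lia.
  have -> : hc k (E k) - hc k (E j) = 1 by lia.
  by rewrite mul0r sub0r normrN mulr1.
move=> n /(tr_lab tr)[l ->].
by case: (ord3_cases l uij) => ->; [constructor 3|constructor 2|constructor 1].
Qed.

Lemma edge_end_side F v E k i j o : triod F v E -> uniq [:: k; i; j] ->
  edge_end F v k (E j) (E i) o -> triod_side F v E k o.
Proof.
move=> tr uij; have ed := triod_edge tr uij; have [ki kj ij] := triod_distinct uij.
have kj' := tr_rel tr k j; have kk := tr_rel tr k k.
move: kj' kk; rewrite eqxx (negPf kj) /= /rel_exp => kj' kk.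
have eqv := maximizers_eq (tr_max tr j) (tr_max tr k).
case: o => [l [l0 lP [b [lb hb lab]]]|h n nF]; last by have := h n nF; rewrite /rel_exp; lia.
have lm : maximizers F (v + l *: ray_dir R k) (E j) by apply/lP => //; exact: ltW.
split => //; exists b; split; [by case: lb|by rewrite /rel_exp; lia| |].
  have := maximizers_eq lb lm; rewrite !value_ray hb intrB -eqv; lra.
move=> n nF nb hn.
have : monomial_value F n (v + l *: ray_dir R k) < monomial_value F (E j) (v + l *: ray_dir R k).
  apply: maximizers_lt => // /lab[] e; move: hn; rewrite ?e.
  - by rewrite /rel_exp; lia.
  - by rewrite (tr_rel tr) (negPf ki).
  - by rewrite e eqxx in nb.
rewrite !value_ray /rel_exp eqv.
have -> : hc k n - hc k (E k) + 1 = hc k n - hc k (E j) by lia.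
by rewrite intrB mulrBr; lra.
Qed.

End VertexRays.

(** * The tropical tangent line *)

Section TangentLine.
Variable R : realType.
Local Notation K := (puiseux R).
Local Notation exponent := (multinom 2).
Local Notation i0 := (@ord0 1).
Local Notation i1 := (@ord_max 1).
Variables (P : mpoly 2 K) (q : K * K).
Implicit Types (m n : exponent) (v : R * R) (k i j r : 'I_3) (s : R).

Let T := tangent_line P q.
Let F := tropicalize T.
Let X := homog (tangent_X1 P q) (tangent_X2 P q).

Definition line_exp r : exponent :=
  match val r with 0%N => @mnm0 2 | 1%N => mnm1 i0 | _ => mnm1 i1 end.

Lemma line_exp_rel k r : rel_exp line_exp k (line_exp r) = (k == r)%:R.
Proof.
by case: k => [[|[|[|//]]] hk]; case: r => [[|[|[|//]]] hr];
  rewrite /rel_exp /hc /homog /line_exp /= ?mnm0E ?mnm1E.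
Qed.

Lemma tangent_coef m : mcoeff m T =
  meval (affine_pt q) (mderiv i0 P) * ((mnm1 i0 == m)%:R - q.1 * (m == @mnm0 2)%:R) +
  meval (affine_pt q) (mderiv i1 P) * ((mnm1 i1 == m)%:R - q.2 * (m == @mnm0 2)%:R).
Proof. by rewrite /T /tangent_line mcoeffD !mcoeffZ !mcoeffB !mcoeffX !mcoeffC. Qed.

Lemma line_exp_neq : [/\ (mnm1 i0 == @mnm0 2) = false, (mnm1 i1 == @mnm0 2) = false,
  (mnm1 i0 == mnm1 i1) = false & (mnm1 i1 == mnm1 i0) = false].
Proof.
have h m n (i : 'I_2) : m i != n i -> (m == n) = false.
  by move=> mn; apply/eqP => e; rewrite e eqxx in mn.
by split; [apply: (h _ _ i0)|apply: (h _ _ i1)|apply: (h _ _ i0)|apply: (h _ _ i0)];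
  rewrite ?mnm0E ?mnm1E.
Qed.

Lemma line_monomial (L : comNzRingType) (a b x y : L) r :
  (a * ((mnm1 i0 == line_exp r)%:R - x * (line_exp r == @mnm0 2)%:R) +
   b * ((mnm1 i1 == line_exp r)%:R - y * (line_exp r == @mnm0 2)%:R)) *
  (x ^+ line_exp r i0 * y ^+ line_exp r i1) = homog (x * a) (y * b) r.
Proof.
have [e1 e2 e3 e4] := line_exp_neq.
by case: r => [[|[|[|//]]] hr]; rewrite /line_exp /homog /= ?mnm0E ?mnm1E /= ?expr0 ?expr1
  ?e1 ?e2 ?e3 ?e4 ?eqxx /=; ring.
Qed.

Lemma tangent_term r : term T q (line_exp r) = X r.
Proof. by rewrite /term tangent_coef line_monomial. Qed.

Lemma tangent_support m : m \in msupp T -> exists r, m = line_exp r.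
Proof.
rewrite mcoeff_msupp => mT.
have [->|n0] := eqVneq m (@mnm0 2); first by exists ord0.
have [->|n1] := eqVneq m (mnm1 i0).
  by exists (inord 1); rewrite /line_exp /= inordK.
have [->|n2] := eqVneq m (mnm1 i1).
  by exists (inord 2); rewrite /line_exp /= inordK.
move: mT; rewrite tangent_coef (negPf n0) ![_ == m]eq_sym (negPf n1) (negPf n2).
by rewrite /= !mulr0 subrr !mulr0 addr0 eqxx.
Qed.

(** Two exponents are collinear, so a two-dimensional dual cell involves all three. *)
Lemma tangent_vertex v : is_vertex F v -> forall r, maximizers F v (line_exp r).
Proof.
move=> [G [G2 Gv]].
have Gmax : face_label G `<=` maximizers F v.
  by have : face_set G v by rewrite Gv.
have Gsupp m : face_label G m -> exists r, m = line_exp r.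
  by move=> /Gmax[mF _]; exact: tangent_support.
suff h r : face_label G (line_exp r) by move=> r; apply: Gmax.
apply: contrapT => hr; move: G2; rewrite /dual_cell.
(* The line a x + b y + c = 0 passes through the two exponents other than [line_exp r]. *)
pose a : R := match val r with 0%N => 1 | 1%N => 1 | _ => 0 end.
pose b : R := match val r with 0%N => 1 | 1%N => 0 | _ => 1 end.
pose c : R := match val r with 0%N => -1 | _ => 0 end.
apply: (@convex_hull_not_two_dimensional R _ a b c).
  rewrite xpair_eqE negb_and /a /b; case: (r) => [[|[|[|//]]] h] /=; rewrite ?oner_eq0 ?orbT//.
move=> _ [m Gm <-] /=; have [l ml] := Gsupp m Gm.
have {}hr : r <> l by move=> rl; apply: hr; rewrite rl -ml.
rewrite ml /a /b /c /line_exp; move: hr.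
case: (r) => [[|[|[|//]]] h]; case: (l) => [[|[|[|//]]] h'] rl;
  try (by case: rl; apply: val_inj); rewrite /= ?mnm0E ?mnm1E /=; lra.
Qed.

Variable v : R * R.
Hypothesis vT : is_vertex F v.

Lemma tangent_triod : triod F v line_exp.
Proof.
split; [exact: tangent_vertex|exact: line_exp_rel|].
by move=> n [nF _]; exact: tangent_support.
Qed.

Lemma tangent_edge k i j : uniq [:: k; i; j] ->
  edge_at F v k (line_exp j) (line_exp i) (line_exp k) /\
  forall n, n \in exps F -> hc k (line_exp j) <= hc k n.
Proof.
move=> uij; split; first exact: triod_edge tangent_triod uij.
have [ki kj ij] := triod_distinct uij.
move=> n nF; have [r ->] := tangent_support nF.
have := line_exp_rel k r; have := line_exp_rel k j; rewrite (negPf kj) /rel_exp /=.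
by case: (k == r) => /=; lia.
Qed.

Lemma tangent_ray k : exists2 e : face F, unbounded_edge e /\ face_set e = arm v k half_line &
  forall s, 0 <= s -> Trop (curve T) (v + s *: ray_dir R k).
Proof.
have [i [j uij]] := ord3_pick k; have [E unb] := tangent_edge uij.
by have [e [fe ue] h] := unbounded_arm E unb; exists e.
Qed.

Lemma tangent_rays y : Trop (curve T) y -> exists k s, 0 <= s /\ y = v + s *: ray_dir R k.
Proof.
move=> Ty.
have [m my] : exists m, maximizers F y m.
  by apply: (@exists_maximizer R F y (line_exp ord0)); case: (tangent_vertex vT ord0).
have [n ny nm] := Trop_two Ty my.
have [r mr] := tangent_support my.1; have [l nl] := tangent_support ny.1.
have rl : r != l by apply: contra_neq nm => rl; rewrite mr nl rl.
have [k uk] : exists k, uniq [:: k; l; r].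
  have [i [j uij]] := ord3_pick r.
  have [ri rj ij] := triod_distinct uij.
  case: (ord3_cases l uij) => lE; first by rewrite lE eqxx in rl.
    by exists j; rewrite lE /= !inE negb_or [j == i]eq_sym ij [j == r]eq_sym rj [i == r]eq_sym ri.
  by exists i; rewrite lE /= !inE negb_or ij [i == r]eq_sym ri [j == r]eq_sym rj.
have [E _] := tangent_edge uk.
have := edge_pointP (ea_m E) (ea_m' E) (ea_n E) (ea_eq E) (ea_lt E) (ea_det E).
move=> /(_ y); rewrite -mr -nl => /(_ my ny)[s s0 yE].
by exists k, s.
Qed.

Lemma tangent_through : q.1 != 0 -> q.2 != 0 -> curve T q.
Proof.
move=> q1 q2; split=> //.
have p0 : affine_pt q i0 = q.1 by [].
have p1 : affine_pt q i1 = q.2 by [].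
rewrite /T /tangent_line mevalD !mevalZ !mevalB !mevalXU !mevalC p0 p1.
by rewrite !subrr !mulr0 addr0.
Qed.

Lemma tangent_X_neq0 r : q.1 != 0 -> q.2 != 0 -> X r != 0.
Proof.
move=> q1 q2; have := term_veq q1 q2 (tangent_vertex vT r).1.
by rewrite tangent_term => /veq_neq0.
Qed.

(** The three terms of the line have equal values at v; along the k-th ray X_k falls behind the two
    others at unit speed. *)
Lemma tangent_ratio k i s : q.1 != 0 -> q.2 != 0 -> k != i ->
  Val q = v + s *: ray_dir R k -> veq (X k / X i) (- s).
Proof.
move=> q1 q2 ki qv.
have h r : veq (X r) (monomial_value F (line_exp r) v - s * (hc k (line_exp r))%:~R).
  rewrite -value_ray -qv -tangent_term.
  exact: (term_veq q1 q2 (tangent_vertex vT r).1).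
apply: (veqM_to (h k) (veqV (h i))).
rewrite (maximizers_eq (tangent_vertex vT k) (tangent_vertex vT i)).
have := line_exp_rel k k; have := line_exp_rel k i.
rewrite eqxx (negPf ki) /rel_exp /= => h1 _.
have -> : hc k (line_exp k) = hc k (line_exp i) + 1 by lia.
by rewrite intrD; ring.
Qed.

(** The three terms sum to 0, so this is -X_j / X_i, again a ratio of terms of equal valuation. *)
Lemma tangent_ratio1 k i : q.1 != 0 -> q.2 != 0 -> k != i ->
  Val q = v -> veq (1 + X k / X i) 0.
Proof.
move=> q1 q2 ki qv.
have [j uij] : exists j, uniq [:: j; i; k].
  have [a [b uab]] := ord3_pick k; have [ka kb ab] := triod_distinct uab.
  case: (ord3_cases i uab) => iE; first by rewrite iE eqxx in ki.
    by exists b; rewrite iE /= !inE negb_or [b == a]eq_sym ab [b == k]eq_sym kb [a == k]eq_sym ka.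
  by exists a; rewrite iE /= !inE negb_or ab [a == k]eq_sym ka [b == k]eq_sym kb.
have [ji jk ik] := triod_distinct uij.
have qj : Val q = v + 0 *: ray_dir R j by rewrite scale0r addr0.
have := veqN (tangent_ratio q1 q2 ji qj); rewrite oppr0.
suff -> : - (X j / X i) = 1 + X k / X i by [].
have Xi := tangent_X_neq0 i q1 q2.
have S : X j + X i + X k = 0 := homog_sum _ _ uij.
apply: (mulIf Xi); rewrite mulNr divfK// mulrDl mul1r divfK//.
by apply/eqP; rewrite eq_sym -addr_eq0 addrC addrA S.
Qed.

Lemma inflection_point_config : P != 0 -> ~ is_line (curve P) ->
  nonsingular (tropicalize P) -> curve P q -> inflection_point P q ->
  inflection_config (tropicalize P) (Val q) (term P q) X.
Proof.
move=> P0 nline nsP [q1 q2 Pq] infl.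
have X0 r := tangent_X_neq0 r q1 q2.
have S0 : \sum_(m <- msupp P) term P q m = 0 by rewrite -meval_terms.
(* In degree 1, P itself would exhibit the curve as a line. *)
have d1 : (mpoly.msize P).-1 != 1%N.
  apply/eqP => d1; apply: nline; exists P; split => //.
  by move: d1; case: (mpoly.msize P) => [//|n] /= ->.
have S2 := inflection_second q1 q2 d1 infl.
have TP : Trop (curve P) (Val q) by exists q.
have first := fun k i b => first_relation S0 (tangent_X1E P q) (tangent_X2E P q) k b (X0 i).
have second := fun k i b (ki : k != i) =>
  second_relation S0 (tangent_X1E P q) (tangent_X2E P q) S2 b ki (X0 i).
have Xki k i : k != i -> 1 + X k / X i != 0.
  move=> ki; have [j uij] : exists j, uniq [:: k; i; j].
    have [a [b uab]] := ord3_pick k; have [ka kb ab] := triod_distinct uab.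
    case: (ord3_cases i uab) => iE; first by rewrite iE eqxx in ki.
      by exists b; rewrite iE.
    by exists a; rewrite iE /= !inE negb_or ka kb [b == a]eq_sym ab.
  apply: contraNneq (X0 j) => e.
  have S : X k + X i + X j = 0 := homog_sum _ _ uij.
  have : X k + X i = 0.
    by rewrite -[X k](divfK (X0 i)) -[X in _ + X]mul1r -mulrDl [_ + 1]addrC e mul0r.
  by move=> e'; rewrite e' add0r in S; rewrite S.
split.
- exact: msupp_uniq.
- exact: nsP.
- by move=> m mP; exact: term_veq.
- have : msupp P != [::] by rewrite msupp_eq0.
  case mE: (msupp P) => [//|m l] _.
  by apply: (@exists_maximizer R (tropicalize P) _ m); rewrite /= mE mem_head.
- by move=> m; exact: Trop_two.
(* A collinear support contradicts the second order condition; the coordinate k is chosen so that m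
   and m' differ in it. *)
- move=> m m' mP m'P mm'; apply: contrapT => none.
  have col n : n \in msupp P -> edet m m' n = 0.
    by move=> nP; apply: contrapT => /eqP ?; apply: none; exists n.
  have main k i : k != i -> hc k m' != hc k m -> False.
    move=> ki km; apply: (collinear_absurd S0 (tangent_X1E P q) (tangent_X2E P q) S2
      (b := m) (a := (hc k m' - hc k m)%:~R) (a' := (hc i m' - hc i m)%:~R) ki
      (X0 k) (X0 i) (Xki k i ki)).
      by rewrite (veq_neq0 (veq_int R _))// subr_eq0.
    move=> n nP; rewrite -!intrM; congr (_%:~R); apply/eqP; rewrite -subr_eq0.
    by rewrite -normr_eq0 (edet_hc _ _ _ ki) col.
  have k01 : (ord0 : 'I_3) != inord 1 by rewrite -val_eqE /= inordK.
  have [e0|n0] := eqVneq (hc ord0 m') (hc ord0 m); last exact: (main _ _ k01 n0).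
  have [e1|n1] := eqVneq (hc (inord 1) m') (hc (inord 1) m).
    by move/eqP: mm'; apply; apply/esym; exact: (hc_inj k01).
  by apply: (main _ ord0 _ n1); rewrite eq_sym.
- by move=> k i b _; exact: first.
- by move=> k i b ki; exact: second.
Qed.

End TangentLine.

(** * Inflection sets *)

Section Assembly.
Variable R : realType.
Local Notation K := (puiseux R).
Local Notation exponent := (multinom 2).
Implicit Types (F G : tropical_poly R) (v p : R * R) (k i j r : 'I_3) (s l : R)
  (m n : exponent) (o : option R).

Lemma uniq3_rot k i j : uniq [:: k; i; j] -> uniq [:: i; j; k].
Proof.
rewrite /= !inE !negb_or !andbT => /andP[/andP[ki kj] ij].
by rewrite ij [i == k]eq_sym ki [j == k]eq_sym kj.
Qed.

Lemma uniq3_swap k i j : uniq [:: k; i; j] -> uniq [:: k; j; i].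
Proof.
rewrite /= !inE !negb_or !andbT => /andP[/andP[ki kj] ij].
by rewrite ki kj eq_sym ij.
Qed.

Lemma bigcup_ord3 T (A : 'I_3 -> set T) k i j : uniq [:: k; i; j] ->
  \bigcup_r A r = A k `|` A i `|` A j.
Proof.
move=> u; apply/seteqP; split => x.
  by move=> [r _]; case: (ord3_cases r u) => ->; [left; left|left; right|right].
by move=> [[|]|] h; [exists k|exists i|exists j].
Qed.

Section Union.
Variables (F G : tropical_poly R) (v : R * R) (O : 'I_3 -> option R) (e : 'I_3 -> face F).
Hypothesis fO : forall r, arm_face v r (O r) (e r).
Let U := \bigcup_r arm v r (arm_range (O r)).

Lemma arm_face_vertex r : face_set (e r) v.
Proof.
case: (fO r) => -> h; exists 0; last by rewrite scale0r addr0.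
by case: (O r) h => [l [l0 _ _ _]|_] /=; rewrite /half_line /= ?lexx// ltW.
Qed.

Lemma arm_face_neq r r' : r != r' -> e r <> e r'.
Proof.
move=> rr' ee; have [fr hr] := fO r; have [fr' _] := fO r'.
have [s s0 sr] : exists2 s, 0 < s & arm_range (O r) s.
  case: (O r) hr => [l [l0 _ _ _]|_]; first by exists l; rewrite //= lexx ltW.
  by exists 1; rewrite //= /half_line /= ler01.
have : face_set (e r') (v + s *: ray_dir R r) by rewrite -ee fr; exists s.
rewrite fr' => -[s' s'r h].
have s'0 : 0 <= s'.
  by case: (O r') s'r => [l /andP[]|].
have := ray_coord_le0 v s'0 rr'; rewrite h ray_coordE.
by rewrite leNgt s0.
Qed.

Lemma arm_adjacent k i j : uniq [:: k; i; j] -> adjacent_union v U (e k) (e i) (e j).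
Proof.
move=> u; have [ki kj ij] := triod_distinct u.
split; [by split; exact: arm_face_neq|by split; exact: arm_face_vertex|].
by rewrite /U (bigcup_ord3 _ u); have [-> _] := fO k; have [-> _] := fO i; have [-> _] := fO j.
Qed.

Lemma arm_bounded r l : O r = Some l -> [/\ 0 < l, bounded_edge (e r), edge_length (e r) = l &
  forall s, 0 <= s <= l -> edge_point (e r) v s (v + s *: ray_dir R r)].
Proof.
move=> Or; have [fr] := fO r; rewrite Or => -[l0 be le de]; split => // s /andP[s0 sl].
split; last exact: de.
by rewrite fr Or; exists s => //=; rewrite s0.
Qed.

Lemma arm_unbounded r : O r = None -> unbounded_edge (e r).
Proof. by move=> Or; have [_] := fO r; rewrite Or. Qed.

(** [Infl_three_ge_lt] lists the edges by decreasing length, so the role of the k-th edge depends on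
    how it compares with the j-th. *)
Lemma inflection_set_shortest k i j s l li : uniq [:: k; i; j] -> 0 < s ->
  O k = Some l -> O i = Some li -> lt_len li (O j) -> l - li = 3 * s ->
  inflection_set F G v U (v + s *: ray_dir R k).
Proof.
move=> u s0 Ok Oi lj ls.
have [l0 bk lk pk] := arm_bounded Ok; have [li0 bi lei _] := arm_bounded Oi.
have sE : s = (l - li) / 3 by rewrite ls mulrAC divff// mul1r.
have ps : edge_point (e k) v ((l - li) / 3) (v + s *: ray_dir R k).
  by rewrite -sE; apply: pk; rewrite ltW//; lra.
have lil : li < l by lra.
case Oj: (O j) lj => [lj|] /= lj'; last first.
  apply: (@Infl_two_lt _ F G v U (e k) (e i) (e j) _ bk bi (arm_unbounded Oj) (arm_adjacent u)); by rewrite lk lei.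
have [lj0 bj lej _] := arm_bounded Oj.
have [h|h] := leP lj l.
  apply: (@Infl_three_ge_lt _ F G v U (e k) (e j) (e i) (e k) _ bk bj bi (arm_adjacent (uniq3_swap u)) _ _ (or_introl erefl));
    by rewrite ?lk ?lei ?lej.
have u' : uniq [:: j; k; i] by apply/uniq3_rot/uniq3_rot.
apply: (@Infl_three_ge_lt _ F G v U (e j) (e k) (e i) (e k) _ bj bk bi (arm_adjacent u') _ _ (or_intror erefl));
  by rewrite ?lk ?lei ?lej// ltW.
Qed.

(** The other two edges decide: if one is strictly shorter, s is determined; if they are equally
    long and bounded, p may move on e3 or on a segment; if both are unbounded, the k-th edge would
    be shortest or the curve a line. *)
Lemma inflection_set_interior k i j s : uniq [:: k; i; j] -> 0 < s ->
  arm_range (O k) s ->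
  (forall l, O k = Some l -> le_len l (O i) -> le_len l (O j) -> False) ->
  (forall li, O i = Some li -> lt_len li (O j) -> exists2 l, O k = Some l & l - li = 3 * s) ->
  (forall lj, O j = Some lj -> lt_len lj (O i) -> exists2 l, O k = Some l & l - lj = 3 * s) ->
  (forall l l', O k = Some l -> O i = Some l' -> O j = Some l' -> 3 * s <= l - l') ->
  (exists r, O r <> None) ->
  inflection_set F G v U (v + s *: ray_dir R k).
Proof.
move=> u s0 sk N1 N2 N2' N3 N4.
have u' := uniq3_swap u.
have min_i li : O i = Some li -> lt_len li (O j) -> inflection_set F G v U (v + s *: ray_dir R k).
  move=> Oi lj; have [l Ok ls] := N2 li Oi lj.
  exact: (inflection_set_shortest u s0 Ok Oi lj ls).
have min_j lj : O j = Some lj -> lt_len lj (O i) -> inflection_set F G v U (v + s *: ray_dir R k).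
  move=> Oj li; have [l Ok ls] := N2' lj Oj li.
  exact: (inflection_set_shortest u' s0 Ok Oj li ls).
case Oi: (O i) => [li|]; last first.
  case Oj: (O j) => [lj|]; first by apply: (min_j lj Oj); rewrite Oi.
  case Ok: (O k) => [l|]; first by case: (N1 l Ok); rewrite ?Oi ?Oj.
  by case: N4 => r; case: (ord3_cases r u) => ->; rewrite ?Ok ?Oi ?Oj.
case Oj: (O j) => [lj|]; last by apply: (min_i li Oi); rewrite Oj.
have [lt|gt|eq] := ltgtP li lj; first by apply: (min_i li Oi); rewrite Oj.
  by apply: (min_j lj Oj); rewrite Oi.
have [li0 bi lei _] := arm_bounded Oi; have [lj0 bj lej _] := arm_bounded Oj.
case Ok: (O k) => [l|]; last first.
  have u2 : uniq [:: i; j; k] := uniq3_rot u.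
  apply: (@Infl_two_eq _ F G v U (e i) (e j) (e k) _ bi bj (arm_unbounded Ok) (arm_adjacent u2)); rewrite ?lei ?lej//.
  by case: (fO k) => -> _; exists s.
have [l0 bk lk pk] := arm_bounded Ok.
have le := N3 l li Ok Oi; rewrite Oj eq in le; have {}le := le erefl.
have d0 : 0 <= (l - lj) / 3 by lra.
have dl : (l - lj) / 3 <= l by lra.
apply: (@Infl_three_lt_eq _ F G v U (e k) (e i) (e j) (v + ((l - lj) / 3) *: ray_dir R k)) => //.
- exact: arm_adjacent.
- by rewrite lk lei eq; lra.
- by rewrite lei lej.
- by rewrite lk lei eq; apply: pk; rewrite d0.
rewrite -arm_segment; last by lra.
by exists s => //=; rewrite ltW//=; lra.
Qed.

(** Two equal shortest edges always admit v: as the end of the unbounded edge, as the only point, or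
    as the end of the segment. *)
Lemma inflection_set_vertex_eq k i j l : uniq [:: k; i; j] ->
  O k = Some l -> O i = Some l -> le_len l (O j) -> inflection_set F G v U v.
Proof.
move=> u Ok Oi lj.
have [l0 bk lk pk] := arm_bounded Ok; have [_ bi lei _] := arm_bounded Oi.
case Oj: (O j) lj => [l'|] /= lj; last first.
  apply: (@Infl_two_eq _ F G v U (e k) (e i) (e j) _ bk bi (arm_unbounded Oj) (arm_adjacent u)); rewrite ?lk ?lei//.
  exact: arm_face_vertex.
have [l'0 bj lej pj] := arm_bounded Oj.
have [eq|neq] := eqVneq l l'.
  by apply: (@Infl_three_eq _ F G v U (e k) (e i) (e j) bk bi bj (arm_adjacent u)); rewrite ?lk ?lei ?lej.
have lt : l < l' by rewrite lt_neqAle neq.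
have u' : uniq [:: j; k; i] by apply/uniq3_rot/uniq3_rot.
apply: (@Infl_three_lt_eq _ F G v U (e j) (e k) (e i) (v + ((l' - l) / 3) *: ray_dir R j)) => //.
- exact: arm_adjacent.
- by rewrite lej lk.
- by rewrite lk lei.
- by rewrite lej lk; apply: pj; apply/andP; split; lra.
exact: segment_left.
Qed.

(** Some edge is bounded, so there is a shortest one; it is not unique, which reduces to two equal
    shortest edges. *)
Lemma inflection_set_vertex k i j : uniq [:: k; i; j] ->
  (forall k i j l, uniq [:: k; i; j] -> O k = Some l -> lt_len l (O i) -> lt_len l (O j) -> False) ->
  (exists r, O r <> None) ->
  inflection_set F G v U v.
Proof.
move=> u0 N1 N4.
have step k' i' j' l : uniq [:: k'; i'; j'] -> O k' = Some l -> le_len l (O i') -> le_len l (O j') ->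
    inflection_set F G v U v.
  move=> u Ok li lj.
  have [ei|ni] := pselect (O i' = Some l).
    exact: (inflection_set_vertex_eq u Ok ei lj).
  have [ej|nj] := pselect (O j' = Some l).
    exact: (inflection_set_vertex_eq (uniq3_swap u) Ok ej li).
  have strict o : o <> Some l -> le_len l o -> lt_len l o.
    case: o => [l'|] //= ne; rewrite lt_neqAle => ->; rewrite andbT.
    by apply/eqP => ll; apply: ne; rewrite ll.
  by case: (N1 k' i' j' l u Ok); exact: strict.
have [r Or] : exists r, exists l, O r = Some l /\ forall r', le_len l (O r').
  have [r0 Or0] := N4.
  have : exists r l, O r = Some l by case E0: (O r0) Or0 => [l|] // _; exists r0, l.
  pose w r' : R := if O r' is Some l then l else 0.
  move=> [r1 [l1 O1]].
  have [|r2 [_ r2s] r2P] := @seq_argmin R _ (enum 'I_3) (fun r => O r != None) w.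
    by apply/hasP; exists r1; rewrite ?mem_enum// O1.
  exists r2; case O2: (O r2) r2s => [l|] // _; exists l; split => // r'.
  case Or': (O r') => [l'|] //=; have := r2P r'; rewrite mem_enum Or' /w O2 Or'.
  by move=> /(_ isT isT).
move: Or => [l [Or le]]; have [a [b uab]] := ord3_pick r.
exact: (step r a b l uab Or).
Qed.

End Union.

Lemma three_terms (L : comNzRingType) (c c1 c2 x y : L) a b :
  c * (x ^+ a * y ^+ b) + c1 * (x ^+ a.+1 * y ^+ b) + c2 * (x ^+ a * y ^+ b.+1) =
  x ^+ a * y ^+ b * (c * 1 + c1 * x + c2 * y).
Proof. by rewrite !exprS; ring. Qed.

(* P is then a monomial times the equation of a line. *)
Lemma triod_line (P : mpoly 2 K) v E : triod (tropicalize P) v E ->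
  (forall k, triod_side (tropicalize P) v E k None) -> is_line (curve P).
Proof.
move=> tr unb.
have k01 : (ord0 : 'I_3) != inord 1 by rewrite -val_eqE /= inordK.
have u : uniq [:: ord0; inord 1; inord 2 : 'I_3].
  by rewrite /= !inE -!val_eqE /= !inordK.
have supp n : n \in msupp P -> exists r : 'I_3, n = E r.
  move=> nP; apply: (rel_exp_E tr u); [exact: (unb ord0)|exact: (unb (inord 1))|exact: (unb (inord 2))].
have Emem r : E r \in msupp P := (tr_max tr r).1.
have [d01 d02 d12] := triod_distinct u.
have hE k r r' : hc k (E r) - hc k (E r') = (k == r)%:R - (k == r')%:R.
  by have := tr_rel tr k r; have := tr_rel tr k r'; rewrite /rel_exp; lia.
have z1 m : hc (inord 1) m = m ord0 :> int by rewrite /hc /homog /= inordK.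
have z2 m : hc (inord 2) m = m ord_max :> int by rewrite /hc /homog /= inordK.
have e10 := hE (inord 1) (inord 1) ord0; have e11 := hE (inord 2) (inord 1) ord0.
have e20 := hE (inord 1) (inord 2) ord0; have e21 := hE (inord 2) (inord 2) ord0.
move: e10 e11 e20 e21; rewrite !z1 !z2 !eqxx [inord 1 == ord0]eq_sym (negPf d01)
  [inord 2 == ord0]eq_sym (negPf d02) [inord 2 == inord 1]eq_sym (negPf d12) /=.
move=> e10 e11 e20 e21.
have x1 : E (inord 1) ord0 = (E ord0 ord0).+1 by lia.
have y1 : E (inord 1) ord_max = E ord0 ord_max by lia.
have x2 : E (inord 2) ord0 = E ord0 ord0 by lia.
have y2 : E (inord 2) ord_max = (E ord0 ord_max).+1 by lia.
have E_inj r r' : r != r' -> E r != E r'.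
  move=> rr'; apply: contra_neq rr' => e; apply/eqP.
  by have := hE r r r'; rewrite e subrr eqxx; case: (r == r').
pose c r := mcoeff (E r) P.
pose lin : mpoly 2 K := c ord0 *: mpolyX K (line_exp ord0) +
  c (inord 1) *: mpolyX K (line_exp (inord 1)) + c (inord 2) *: mpolyX K (line_exp (inord 2)).
have l0 : line_exp ord0 = @mnm0 2 by [].
have l1 : line_exp (inord 1) = mnm1 ord0 by rewrite /line_exp /= inordK.
have l2 : line_exp (inord 2) = mnm1 ord_max by rewrite /line_exp /= inordK.
have [n1 n2 n3 n4] := line_exp_neq.
have coefl m : mcoeff m lin = c ord0 * (@mnm0 2 == m)%:R + c (inord 1) * (mnm1 ord0 == m)%:R +
    c (inord 2) * (mnm1 ord_max == m)%:R.
  by rewrite /lin !mcoeffD !mcoeffZ !mcoeffX l0 l1 l2.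
exists lin; split.
  apply/eqP; rewrite eqn_leq; apply/andP; split.
    rewrite msizeE; apply/bigmax_leqP_seq => m mlin _.
    move: mlin; rewrite mcoeff_msupp coefl.
    have [<-|m0] := eqVneq (@mnm0 2) m; first by rewrite mdeg0.
    have [<-|m1] := eqVneq (mnm1 ord0) m; first by rewrite mdeg1.
    have [<-|m2] := eqVneq (mnm1 ord_max) m; first by rewrite mdeg1.
    by rewrite !mulr0 !addr0 eqxx.
  have : mnm1 ord0 \in msupp lin.
    rewrite mcoeff_msupp coefl eqxx [@mnm0 2 == _]eq_sym n1 n4 !mulr0 add0r addr0 mulr1.
    by rewrite -mcoeff_msupp.
  by move=> /msize_mdeg_lt; rewrite mdeg1.
have in_supp q : {in msupp P, forall m, m != E ord0 -> m != E (inord 1) -> m != E (inord 2) ->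
    term P q m = 0}.
  by move=> m /supp[r ->]; case: (ord3_cases r u) => ->; rewrite eqxx.
have PE q : meval (affine_pt q) P =
    q.1 ^+ E ord0 ord0 * q.2 ^+ E ord0 ord_max * meval (affine_pt q) lin.
  rewrite meval_terms (sum_three (msupp_uniq P) (Emem ord0) (Emem (inord 1)) (E_inj _ _ d01)
    (E_inj _ _ d02) (E_inj _ _ d12) (in_supp q)) Emem /term x1 y1 x2 y2.
  rewrite /lin l0 l1 l2 mpolyX0 !mevalD !mevalZ !mevalXU meval1 /affine_pt.
  exact: three_terms.
apply/seteqP; split => q [q1 q2 lq]; last by split; rewrite // PE lq mulr0.
split => //; move/eqP: lq.
by rewrite PE !mulf_eq0 !expf_eq0 (negPf q1) (negPf q2) !andbF /= => /eqP.
Qed.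

End Assembly.

(** * The component E and its inflection set *)

Section InflectionPoint.
Variable R : realType.
Local Notation K := (puiseux R).
Local Notation exponent := (multinom 2).
Implicit Types (k i j r : 'I_3) (s l : R) (m n : exponent) (o : option R).

Lemma triod_arms (P : mpoly 2 K) v E : let F := tropicalize P in
  nonsingular F -> triod F v E ->
  exists O (e : 'I_3 -> face F), [/\ forall r, arm_face v r (O r) (e r),
    forall r, triod_side F v E r (O r),
    forall r, arm_spec (Trop (curve P)) v r (arm_range (O r)) &
    forall r i s, r != i -> 0 <= s -> maximizers F (v + s *: ray_dir R r) (E i) ->
      arm_range (O r) s].
Proof.
move=> F nsF tr.
have : forall r, exists oe : option R * face F, [/\ arm_face v r oe.1 oe.2,
    triod_side F v E r oe.1, arm_spec (Trop (curve P)) v r (arm_range oe.1) &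
    forall i s, r != i -> 0 <= s -> maximizers F (v + s *: ray_dir R r) (E i) ->
      arm_range oe.1 s].
  move=> r; have [i [j u]] := ord3_pick r; have ed := triod_edge tr u.
  have [d [e [fe ee ae]]] := edge_arm nsF ed.
  exists (d, e); split => //=; first exact: (edge_end_side tr u ee).
  move=> i' s ri' s0 h.
  have mj : maximizers F (v + s *: ray_dir R r) (E j).
    case: (ord3_cases i' u) => e'; rewrite e' in h => //; first by rewrite e' eqxx in ri'.
    have ed' := triod_edge tr (uniq3_swap u).
    exact: (edge_along (ea_m ed') (ea_m' ed') (ea_eq ed') h).
  by case: d ee {fe ae} => [l [_ lP _]|_] //=; rewrite s0; apply/lP.
move=> /choice[oe oeP]; exists (fun r => (oe r).1), (fun r => (oe r).2).
by split => r; case: (oeP r).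
Qed.

Lemma single_arm v k (J : set R) : J 0 ->
  \bigcup_r arm v r (if r == k then J else [set 0]) = arm v k J.
Proof.
move=> J0; apply/seteqP; split => [y [r _]|y yk]; last by exists k; rewrite ?eqxx.
case: eqP => [->//|_] [s /= -> <-]; rewrite scale0r addr0.
by exists 0; rewrite // scale0r addr0.
Qed.

Variables (P : mpoly 2 K) (q : K * K) (v : R * R).
Let F := tropicalize P.
Let T := tangent_line P q.
Let p := Val q.
Let E0 := connected_component (Trop (curve P) `&` Trop (curve T)) p.
Hypotheses (P0 : P != 0) (nline : ~ is_line (curve P)) (nsF : nonsingular F).
Hypotheses (Pq : curve P q) (infl : inflection_point P q) (vT : is_vertex (tropicalize T) v).

Lemma component_arms J r s : (forall r, arm_spec (Trop (curve P)) v r (J r)) ->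
  J r s -> p = v + s *: ray_dir R r -> E0 = \bigcup_r arm v r (J r).
Proof.
move=> JP Js ps; apply: connected_component_arms.
- by move=> y [_ /(tangent_rays vT)].
- by move=> r'; apply: arm_specI => //; have [_ _] := tangent_ray vT r'.
- by exists r => //; exists s.
Qed.

Lemma triod_nonline E O : triod F v E -> (forall r, triod_side F v E r (O r)) ->
  exists r, O r <> None.
Proof.
move=> tr sO; apply: contrapT => h; apply: nline; apply: (triod_line tr) => r.
have := sO r; case e: (O r) => [l|] // _.
by case: h; exists r; rewrite e.
Qed.

Lemma inflection_on_ray k s : 0 < s -> p = v + s *: ray_dir R k ->
  inflection_set F (tropicalize T) v E0 p.
Proof.
move=> s0 ps; have [i [j u]] := ord3_pick k; have [ki kj ij] := triod_distinct u.
have [q1 q2 _] := Pq; have s_ge0 := ltW s0.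
have ic := inflection_point_config vT P0 nline nsF Pq infl.
have rho r : k != r -> veq _ (- s) := fun kr => tangent_ratio vT q1 q2 kr ps.
have [m [m' [n [ed mp m'p lab imm']]]] := vertex_of_line ic ki (rho i ki) s0 ps.
(* Equality means that the triangle dual to v is that of a line, so that three edges leave v along
   the rays; otherwise only one does. *)
have [a0|a0] := eqVneq (hc i n) (hc i m).
  have [E [tr Ek Ei Ej]] := three_edges u ed imm' a0.
  have [len [e [fO sO aO rO]]] := triod_arms nsF tr.
  have sk : arm_range (len k) s by apply: (rO k j); rewrite ?Ej -?ps.
  have sl l : len k = Some l -> s <= l by move=> e'; move: sk; rewrite e' => /andP[].
  rewrite (component_arms aO sk ps) ps.
  apply: (inflection_set_interior (tropicalize T) fO u s0 sk).
  - move=> l Ok; apply: (longest_needed tr u ic (rho i ki) s_ge0 ps s0 (sl l Ok));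
      by rewrite -?Ok.
  - move=> li Oi; apply: (shortest_length tr u ic (rho i ki) s_ge0 ps s0 sl); by rewrite -?Oi.
  - move=> lj Oj; apply: (shortest_length tr (uniq3_swap u) ic (rho j kj) s_ge0 ps s0 sl);
      by rewrite -?Oj.
  - move=> l l' Ok Oi Oj; apply: (equal_lengths tr u ic (rho i ki) s_ge0 ps s0 (sl l Ok));
      first [by rewrite -Ok|by rewrite -Oi|by rewrite -Oj].
  - exact: (triod_nonline tr sO).
have [[l|] [e [[fe he] ee ae]]] := edge_arm nsF ed; last first.
  by case: (one_edge_bounded ic ki (rho i ki) s0 ps ed mp lab imm' a0 ee).
have [l0 be le de] := he; have [_ lP [b [lb hb labl]]] := ee.
have sl : s <= l by apply/lP => //; rewrite -ps.
have lm : maximizers F (v + l *: ray_dir R k) m by apply/lP => //; exact: ltW.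
have l3 := one_edge_length ic ki (rho i ki) s0 ps ed mp lab imm' a0 sl lm lb hb labl.
have EE : E0 = face_set e.
  rewrite fe -(single_arm _ _ (J := arm_range (Some l))); last by rewrite /= lexx ltW.
  apply: (component_arms (r := k) (s := s)) => //; last by rewrite eqxx /= s_ge0.
  move=> r; case: eqP => [->//|/eqP rk].
  have [[m1 [m1' [n1 ed1]]]|//] := vertex_arm r nsF (ea_m ed) (ea_m' ed) (ea_n ed) (ea_det ed) (ea_lab ed).
  have [h1 h2] := one_edge u ed imm' a0 m1 m1' n1.
  by case: (ord3_cases r u) => e'; move: rk ed1; rewrite e' ?eqxx// => _ ed1; by [case: h1|case: h2].
apply: (Infl_edge_third _ be _ EE).
  by rewrite fe; exists 0; rewrite ?scale0r ?addr0//= lexx ltW.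
split; last by rewrite ps le de// l3 mulrAC divff// mul1r.
by rewrite fe; exists s; rewrite //= s_ge0.
Qed.

Lemma inflection_at_vertex : p = v -> inflection_set F (tropicalize T) v E0 p.
Proof.
move=> pv; have [q1 q2 _] := Pq.
have p0 r : p = v + 0 *: ray_dir R r by rewrite scale0r addr0.
have ic := inflection_point_config vT P0 nline nsF Pq infl.
pose X := homog (tangent_X1 P q) (tangent_X2 P q).
have rho0 k i : k != i -> veq (X k / X i) 0.
  by move=> ki; have := tangent_ratio vT q1 q2 ki (p0 k); rewrite oppr0.
have rho1 k i (ki : k != i) := tangent_ratio1 vT q1 q2 ki pv.
have k01 : (ord0 : 'I_3) != inord 1 by rewrite -val_eqE /= inordK.
have [m0 [m1 [m2 []]]] := vertex_label ic k01 (rho0 _ _ k01) (rho1 _ _ k01).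
rewrite -/p pv => h0 h1 h2 d1 lab.
have arm_cases r := vertex_arm r nsF h0 h1 h2 d1 lab.
have [[k [m [m' [n ed0]]]]|none] := pselect (exists k m m' n, edge_at F v k m m' n); last first.
  apply: Infl_vertex; rewrite (component_arms (J := fun=> [set 0]) (r := ord0) (s := 0))//.
    apply/seteqP; split => [_ [r _ [s /= -> <-]]|_ ->]; first by rewrite scale0r addr0.
    by exists ord0 => //; exists 0; rewrite // scale0r addr0.
  by move=> r; case: (arm_cases r) => // -[m [m' [n ed]]]; case: none; exists r, m, m', n.
have [i [j u]] := ord3_pick k; have [ki kj ij] := triod_distinct u.
have [m3 [m3' [ed [imm' _]]]] := edge_orient ed0 ki.
have [a0|a0] := eqVneq (hc i n) (hc i m3).
  have [E [tr _ _ _]] := three_edges u ed imm' a0.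
  have [len [e [fO sO aO rO]]] := triod_arms nsF tr.
  have O0 : arm_range (len k) 0 by apply: (rO k j) => //; rewrite scale0r addr0; exact: (tr_max tr j).
  rewrite (component_arms aO O0 (p0 k)).
  apply: (inflection_set_vertex (tropicalize T) fO u); last exact: (triod_nonline tr sO).
  move=> k' i' j' l u' Ok; have [ki' _ _] := triod_distinct u'.
  have ic' : inflection_config F v (term P q) _ := eq_ind p (fun y => inflection_config F y _ _) ic v pv.
  apply: (unique_shortest tr u' ic' (rho0 _ _ ki') (rho1 _ _ ki')); by rewrite -?Ok.
have [d [e [[fe he] ee ae]]] := edge_arm nsF ed.
have r0 : arm_range d 0 by case: d he {fe ee ae} => [l [l0 _ _ _]|_] /=; rewrite /half_line /= ?lexx// ltW.
have EE : E0 = arm v k (arm_range d).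
  rewrite -(single_arm _ _ r0).
  apply: (component_arms (r := k) (s := 0)) => //; last by rewrite eqxx.
  move=> r; case: eqP => [->//|/eqP rk].
  have [[m4 [m4' [n4 ed3]]]|//] := arm_cases r.
  have [h3 h4] := one_edge u ed imm' a0 m4 m4' n4.
  by case: (ord3_cases r u) => e'; move: rk ed3; rewrite e' ?eqxx// => _ ed3; by [case: h3|case: h4].
case: d fe he ee ae r0 EE => [l|] fe he ee ae r0 EE.
  have [l0 be le de] := he.
  apply: (Infl_edge_vertex _ be); rewrite ?EE//.
  by rewrite fe; exists 0; rewrite // scale0r addr0.
(* A single unbounded edge of the curve fills the whole ray of the line. *)
have [eL [ueL feL] _] := tangent_ray vT k.
by apply: (@Infl_line_edge _ _ _ _ _ eL ueL); rewrite EE feL.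
Qed.

End InflectionPoint.

Theorem proposition5p2 (R : realType) (P : mpoly 2 (puiseux R))
    (q : puiseux R * puiseux R) (v : R * R) :
  let X := curve P in
  let T := tangent_line P q in
  let C := Trop X in
  let L := Trop (curve T) in
  let p := Val q in
  let E := connected_component (C `&` L) p in
  P != 0 -> ~ is_line X -> nonsingular (tropicalize P) ->
  X q -> inflection_point P q ->
  is_vertex (tropicalize T) v ->
  inflection_set (tropicalize P) (tropicalize T) v E p.
Proof.
move=> X T C L p E P0 nline nsF Pq infl vT.
have [q1 q2 _] := Pq.
have Lp : Trop (curve T) (Val q) by exists q => //; exact: tangent_through.
have [k [s [s0 ps]]] := tangent_rays vT Lp.
have [s1|s1] := eqVneq s 0.
  have pv : p = v by rewrite /p ps s1 scale0r addr0.
  exact: (inflection_at_vertex P0 nline nsF Pq infl vT pv).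
by apply: (inflection_on_ray P0 nline nsF Pq infl vT _ ps); rewrite lt_neqAle eq_sym s1.
Qed.
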